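(* There exist positive absolute constants $C_1,C_2$ (independent of $n,\beta,\alpha,\epsilon$) such that the following holds. Let $n\ge 1$ be an integer, $\beta>0$ and $\alpha>(n-1)\beta/2$. Let $\lambda_1\le\lambda_2\le\cdots\le\lambda_n$ be drawn from the $\beta$-Laguerre ensemble with parameter $\alpha$, and let $x_1<x_2<\cdots<x_n$ be the zeros of the polynomial $x\mapsto L_n^{(2\alpha/\beta-n)}(x/\beta)$. Then for any $\epsilon>0$, $$\Pr\left(\frac1{2\alpha}\max_{1\le i\le n}|\lambda_i-x_i|>\epsilon\right)\le C_1\,n\,e^{-C_2\alpha\epsilon\min\{\epsilon,1\}}.$$
   Context: The $\beta$-Laguerre ensemble with parameter $\alpha>(n-1)\beta/2$ (where $\beta>0$ is an arbitrary positive real) is the probability distribution of $n$ random variables with joint density $$f_{\mathrm{Lag}}(\lambda_1,\ldots,\lambda_n)\propto\prod_{1\le i<j\le n}|\lambda_i-\lambda_j|^\beta\prod_{i=1}^n\lambda_i^{\alpha-\frac{(n-1)\beta}{2}-1}e^{-\lambda_i/2},\qquad \lambda_i>0,$$ with the variables listed in nondecreasing order $\lambda_1\le\cdots\le\lambda_n$. For $p>-1$ the Laguerre polynomial is $L_n^{(p)}(x):=\sum_{i=0}^n\binom{n+p}{n-i}\frac{(-x)^i}{i!}$, with $\binom{n+p}{n-i}=\frac{\Gamma(n+p+1)}{\Gamma(n-i+1)\Gamma(p+i+1)}$; it has $n$ distinct real zeros. *)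

(* Defs.v *)
From HB Require Import structures.
From mathcomp Require Import all_boot all_order all_algebra.
From mathcomp Require Import all_classical all_reals all_analysis.

Set Implicit Arguments.
Unset Strict Implicit.
Unset Printing Implicit Defensive.

Import Order.TTheory GRing.Theory Num.Theory.
Import numFieldNormedType.Exports.

Local Open Scope classical_set_scope.
Local Open Scope ring_scope.

(* Lebesgue measure on R^n, as the n-fold product of [lebesgue_measure]:
   R^0 carries the point mass, and R^(n+1) the image of the product measure on
   R * R^n under [tcons]. Borel sets are taken over [measurableTypeR R], which
   is R with the measurable structure on which [lebesgue_measure] is defined. *)
Section lebesgue_tuple.
Context {R : realType}.
Local Notation RT := (measurableTypeR R).
Local Open Scope ereal_scope.

Definition tcons n (p : RT * n.-tuple RT) : n.+1.-tuple RT :=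
  [tuple of p.1 :: p.2].

Definition tuncons n (t : n.+1.-tuple RT) : RT * n.-tuple RT :=
  (thead t, [tuple of behead t]).

Lemma tconsK n : cancel (@tcons n) (@tuncons n).
Proof. by case=> x t; congr pair; exact: val_inj. Qed.

Lemma tunconsK n : cancel (@tuncons n) (@tcons n).
Proof. by move=> t; rewrite [t in RHS]tuple_eta; exact: val_inj. Qed.

Lemma measurable_tcons n : measurable_fun [set: RT * n.-tuple RT] (@tcons n).
Proof. exact: measurable_cons. Qed.

Lemma measurable_tuncons n :
  measurable_fun [set: n.+1.-tuple RT] (@tuncons n).
Proof.
by apply: measurable_fun_pair; [exact: measurable_tnth|exact: measurable_behead].
Qed.

Section lebesgue_tupleS.
Variables (n : nat) (m : {sigma_finite_measure set (n.-tuple RT) -> \bar R}).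

Definition lebesgue_tupleS : set (n.+1.-tuple RT) -> \bar R :=
  pushforward (@lebesgue_measure R \x m) (@tcons n).

Let mtcons (A : set (n.+1.-tuple RT)) :
  measurable A -> measurable (@tcons n @^-1` A).
Proof. by move=> mA; rewrite -[_ @^-1` _]setTI; exact: measurable_tcons. Qed.

Let lebesgue_tupleS0 : lebesgue_tupleS set0 = 0.
Proof. by rewrite /lebesgue_tupleS /pushforward preimage_set0 measure0. Qed.

Let lebesgue_tupleS_ge0 A : 0 <= lebesgue_tupleS A.
Proof. by rewrite /lebesgue_tupleS /pushforward; exact: measure_ge0. Qed.

Let lebesgue_tupleS_sigma_additive : semi_sigma_additive lebesgue_tupleS.
Proof.
move=> F mF tF mUF; rewrite /lebesgue_tupleS /pushforward preimage_bigcup.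
apply: measure_semi_sigma_additive.
- by move=> k; exact: mtcons.
- apply/trivIsetP => /= i j _ _ ij; rewrite -preimage_setI.
  by move/trivIsetP : tF => /(_ _ _ _ _ ij) ->//; rewrite preimage_set0.
- by rewrite -preimage_bigcup; exact: mtcons.
Qed.

HB.instance Definition _ := isMeasure.Build _ _ _ lebesgue_tupleS
  lebesgue_tupleS0 lebesgue_tupleS_ge0 lebesgue_tupleS_sigma_additive.

Let lebesgue_tupleS_sigma_finite : sigma_finite setT lebesgue_tupleS.
Proof.
have /sigma_finiteP[F [TF ndF Foo]] := sigma_finiteT (@lebesgue_measure R).
have /sigma_finiteP[G [TG ndG Goo]] := sigma_finiteT m.
have preFG k : @tcons n @^-1` (@tuncons n @^-1` (F k `*` G k)) = F k `*` G k.
  rewrite -comp_preimage (_ : _ \o _ = id) ?preimage_id//.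
  by apply/funext => p; exact: tconsK.
exists (fun k => @tuncons n @^-1` (F k `*` G k)).
  rewrite -preimage_bigcup predeqE => t; split=> // _.
  have : (\bigcup_k F k) (tuncons t).1 by rewrite -TF.
  have : (\bigcup_k G k) (tuncons t).2 by rewrite -TG.
  move=> [l _ Gl] [k _ Fk]; exists (maxn k l) => //; split.
  - by move: Fk; exact/subsetPset/ndF/leq_maxl.
  - by move: Gl; exact/subsetPset/ndG/leq_maxr.
move=> k; have [mF Fk] := Foo k; have [mG Gk] := Goo k; split.
  rewrite -[X in measurable X]setTI; apply: measurable_tuncons => //.
  exact: measurableX.
rewrite /lebesgue_tupleS /pushforward preFG product_measure1E//.
by rewrite lte_mul_pinfty// ge0_fin_numE.
Qed.

HB.instance Definition _ := Measure_isSigmaFinite.Build _ _ _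
  lebesgue_tupleS lebesgue_tupleS_sigma_finite.

End lebesgue_tupleS.

Fixpoint lebesgue_tuple n : {sigma_finite_measure set (n.-tuple RT) -> \bar R} :=
  match n with
  | 0 => \d_ ([tuple] : 0.-tuple RT)
  | n'.+1 => lebesgue_tupleS (lebesgue_tuple n')
  end.

Lemma lebesgue_tuple_box n (A : 'I_n -> set RT) :
  (forall i, measurable (A i)) ->
  lebesgue_tuple n [set t | forall i, A i (tnth t i)] =
  \prod_(i < n) lebesgue_measure (A i).
Proof.
elim: n A => [|n ih] A mA.
  rewrite big_ord0 /= diracE mem_set//= => -[].
  by [].
rewrite big_ord_recl -(ih (fun i => A (lift ord0 i)) (fun i => mA _)).
rewrite /= /lebesgue_tupleS /pushforward.
rewrite (_ : _ @^-1` _ = A ord0 `*`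
    [set t : n.-tuple RT | forall i, A (lift ord0 i) (tnth t i)]).
  rewrite product_measure1E//.
  rewrite (_ : [set t | _] = \bigcap_(i in [set: 'I_n])
      ((fun t : n.-tuple RT => tnth t i) @^-1` A (lift ord0 i))).
    apply: fin_bigcap_measurable => // i _; rewrite -[X in measurable X]setTI.
    by apply: measurable_tnth => //; exact: mA.
  by apply/seteqP; split=> [t tA i _|t tA i]; exact: tA.
apply/seteqP; split=> [[y t] /= tA|[y t] /= [yA tA] i].
  split=> [|i]; first exact: (tA ord0).
  by have := tA (lift ord0 i); rewrite tnthS.
have [j ->|->] := unliftP ord0 i; last exact: yA.
by rewrite tnthS; exact: tA.
Qed.
End lebesgue_tuple.

Section laguerre.
Context {R : realType}.

Definition Gamma (z : R) : R :=
  \int[lebesgue_measure]_(t in `]0, +oo[) (t `^ (z - 1) * expR (- t)).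

(* L_n^{(p)}; the ratio of Gamma values is the binomial coefficient
   binom(n + p, n - i). *)
Definition laguerre_poly (n : nat) (p : R) : {poly R} :=
  \sum_(i < n.+1)
    (Gamma (n%:R + p + 1) / (Gamma (n%:R - i%:R + 1) * Gamma (p + i%:R + 1))
      / i`!%:R) *: (- 'X) ^+ i.

(* Unnormalized density of the nondecreasingly ordered ensemble: it is
   supported on 0 < t_1 <= ... <= t_n. *)
Definition laguerre_density (beta alpha : R) (n : nat) (t : n.-tuple R) : R :=
  if sorted <=%R t && all (fun y => 0 < y) t then
    (\prod_(i < n) \prod_(j < n | (i < j)%N) `|tnth t i - tnth t j| `^ beta) *
    \prod_(i < n) (tnth t i `^ (alpha - (n%:R - 1) * beta / 2 - 1)
                    * expR (- tnth t i / 2))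
  else 0.

(* [lam] are the ordered points of the beta-Laguerre ensemble: their joint
   density with respect to Lebesgue measure on R^n is proportional to
   [laguerre_density]. The constant [c] is forced by [P setT = 1]. *)
Definition laguerre_ensemble (beta alpha : R) (n : nat)
    (d : measure_display) (T : measurableType d) (P : probability T R)
    (lam : 'I_n -> {RV P >-> R}) : Prop :=
  exists2 c : R, 0 < c &
    forall A : set (n.-tuple (measurableTypeR R)), measurable A ->
      P [set w | A [tuple lam i w | i < n]] =
      (c%:E * \int[lebesgue_tuple n]_(t in A)
                (laguerre_density beta alpha t)%:E)%E.

End laguerre.

(* Main.v *)
Require Import Defs.
From mathcomp Require Import all_boot all_order all_algebra.
From mathcomp Require Import all_classical all_reals all_analysis.
From mathcomp Require Import measurable_realfun.
From mathcomp Require Import ring lra zify.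
Import Order.TTheory GRing.Theory Num.Theory.
Import numFieldNormedType.Exports.
Local Open Scope classical_set_scope.
Local Open Scope ring_scope.
Set Implicit Arguments.
Unset Strict Implicit.
Unset Printing Implicit Defensive.

(* Integration by parts in the Laguerre density against a field
   (F_1(t_1), ..., F_n(t_n)) gives, with a = alpha - (n - 1) beta / 2 - 1,
     E [ sum_i (F_i'(t_i) + a F_i(t_i) / t_i - F_i(t_i) / 2)
         + beta sum_(i < j) (F_j(t_j) - F_i(t_i)) / (t_j - t_i) ] = 0,
   while the zeros satisfy the Stieltjes relations
     beta sum_(j <> i) 1 / (x_i - x_j) + (a + 1) / x_i - 1 / 2 = 0.
   Take F_i(t) = 2 s (s - r_i)_+^p with s = sqrt t and r_i = sqrt x_i. The divided
   differences of the F_i at the points are at most those of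
   G_i(t) = 2 r_i (s - r_i)_+^p at the zeros, so the Stieltjes relations remove
   the interaction, and e_i = (s_i - r_i)_+ satisfies
     E sum_i (e_i^(p+1) - 5 p e_i^(p-1)) <= 0.
   With p proportional to T^2, Markov's inequality yields
   P(max_i e_i >= T) <= C n exp(- c T^2). The lower tail is symmetric, except for
   a modification of the field near t = 0; and x_i <= 32 alpha turns deviations
   of the square roots into deviations of the points.
   To avoid boundary terms, the density is first multiplied by cutoffs at
   distance dl from the collisions and from the origin, and at r at infinity;
   the error tends to 0 with dl, then with r -> oo. *)

(** * Divided differences of the test fields *)

(** The zeros are the critical point of the weight with exponent a + 1, not a, and in s = sqrt t the
    weight has exponent 2 a + 1, possibly negative, so log-concavity is not at hand. The factor 2 s
    makes the confining term t / 2, together with its counterpart at the zero, contribute exactly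
    -e^(p+1). Its derivative supplies half of the missing exponent; the other half leaves -e^p / s
    on the upper side, which has the right sign, and +e^p / s on the lower side. The lower field is
    therefore modified below s = r / (4p): above this level e^p / s <= 4p e^(p-1), and with the p
    e^(p-1) from the derivative of e^p this is the 5p of the moment inequality. Below it the field
    is linear in t, and its derivative restores the full a + 1. The cutoffs have slopes of order 1 /
    dl, so their errors are controlled by sign or by the comparison itself: at the origin and at
    infinity the extra terms vanish or are favourable; at a collision the divided difference of the
    F_i is bounded above, uniformly in dl, by that of the G_i, and the error is a constant times the
    mass of the gaps below dl. *)

Section pair_inequalities.
Variable R : realFieldType.
Implicit Types s r K : R.

Lemma ler_div2 (a b c d : R) : 0 < b -> 0 < d -> a * d <= c * b -> a / b <= c / d.
Proof. by move=> b0 d0; rewrite ler_pdivrMr// mulrAC ler_pdivlMr. Qed.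

Definition pospart (z : R) := Num.max z 0.

Lemma pospart_ge0 z : 0 <= pospart z.
Proof. by rewrite /pospart le_max lexx orbT. Qed.

Lemma pospart_id z : 0 <= z -> pospart z = z.
Proof. by move=> z0; apply/max_idPl. Qed.

Lemma pospart_eq0 z : z <= 0 -> pospart z = 0.
Proof. by move=> z0; apply/max_idPr. Qed.

Lemma pospart_le : {homo pospart : y z / y <= z}.
Proof. by move=> y z yz; rewrite /pospart ge_max !le_max yz lexx !orbT. Qed.

(** Separates a divided difference in s^2 into a difference quotient in s and a symmetric term,
    which can then be compared one by one. *)
Lemma split_quotient {s1 s2 : R} K1 K2 : 0 <= s2 -> s2 < s1 ->
  (s1 * K1 - s2 * K2) / (s1 ^+ 2 - s2 ^+ 2) =
  2^-1 * ((K1 - K2) / (s1 - s2) + (K1 + K2) / (s1 + s2)).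
Proof.
move=> s20 s21.
have h1 : s1 - s2 != 0 by rewrite gt_eqF// subr_gt0.
have h2 : s1 + s2 != 0 by rewrite gt_eqF//; lra.
have -> : s1 ^+ 2 - s2 ^+ 2 = (s1 - s2) * (s1 + s2) by ring.
by field; rewrite h1 h2.
Qed.

(** When both positive parts are active, the sign of K1 - K2 is that of (r1 - r2) - (s1 - s2), so
    passing from the spacing r1 - r2 to s1 - s2 always increases the quotient of the differences;
    the symmetric term increases because s1 + s2 < r1 + r2. The remaining cases have K1 = 0 or K2 =
    0 and reduce to comparing single terms. *)
Lemma pair_sqrt p {s1 s2 r1 r2 : R} : (0 < p)%N ->
  0 <= s2 -> s2 < s1 -> 0 <= r2 -> r2 < r1 ->
  (r1 * pospart (r1 - s1) ^+ p - r2 * pospart (r2 - s2) ^+ p)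
    / (r1 ^+ 2 - r2 ^+ 2) <=
  (s1 * pospart (r1 - s1) ^+ p - s2 * pospart (r2 - s2) ^+ p)
    / (s1 ^+ 2 - s2 ^+ 2).
Proof.
move=> p0 s20 s21 r20 r21.
set K1 := _ ^+ p; set K2 := pospart (r2 - s2) ^+ p.
have K10 : 0 <= K1 by rewrite exprn_ge0// pospart_ge0.
have K20 : 0 <= K2 by rewrite exprn_ge0// pospart_ge0.
have S0 : 0 < s1 ^+ 2 - s2 ^+ 2 by nra.
have R0 : 0 < r1 ^+ 2 - r2 ^+ 2 by nra.
have zK (z : R) : z <= 0 -> pospart z ^+ p = 0.
  by move=> z0; rewrite pospart_eq0// expr0n gtn_eqF.
have [h1|h1] := leP r1 s1; have [h2|h2] := leP r2 s2.
- by rewrite /K1 /K2 !zK ?subr_le0// !mulr0 subr0 !mul0r.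
- rewrite /K1 zK ?subr_le0// !mulr0 !sub0r !mulNr lerN2.
  apply: ler_div2 => //.
  have h : r1 ^+ 2 - r2 ^+ 2 <= s1 ^+ 2 - s2 ^+ 2 by nra.
  rewrite mulrAC [leRHS]mulrAC ler_wpM2r//.
  by apply: ler_pM => //; exact: ltW.
- rewrite /K2 zK ?subr_le0// !mulr0 !subr0.
  apply: ler_div2 => //.
  rewrite mulrAC [leRHS]mulrAC ler_wpM2r//.
  have h : s1 * s2 ^+ 2 <= r1 * s2 ^+ 2 by rewrite ler_wpM2r ?sqr_ge0 ?ltW.
  have h' : s1 * r2 ^+ 2 <= s1 * s2 ^+ 2 by rewrite ler_wpM2l//; nra.
  have : s1 * r1 * s1 <= s1 * r1 * r1 by rewrite ler_wpM2l ?mulr_ge0//; lra.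
  nra.
- rewrite !split_quotient// ler_wpM2l ?invr_ge0//.
  apply: lerD; last first.
    by apply: ler_div2; nra.
  apply: ler_div2; rewrite ?subr_gt0//.
  have [h|h] := leP (r2 - s2) (r1 - s1).
    have : K2 <= K1.
      by apply: lerXn2r; rewrite ?nnegrE ?pospart_ge0//; exact: pospart_le.
    nra.
  have : K1 <= K2.
    by apply: lerXn2r; rewrite ?nnegrE ?pospart_ge0//; apply/pospart_le/ltW.
  nra.
Qed.

Lemma convex_expr_diff p (a b : R) : 0 <= b <= a ->
  a ^+ p - b ^+ p <= p%:R * a ^+ p.-1 * (a - b).
Proof.
move=> /andP[b0 ba]; rewrite subrXX mulrC ler_wpM2r ?subr_ge0//.
apply: (@le_trans _ _ (\sum_(i < p) a ^+ p.-1)); last first.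
  by rewrite sumr_const card_ord mulr_natl.
apply: ler_sum => i _.
have a0 := le_trans b0 ba.
have -> : p.-1 = (p.-1 - i + i)%N by rewrite subnK// -ltnS prednK ?ltn_ord//; case: p i => // -[].
rewrite exprD addnK.
rewrite ler_wpM2l ?exprn_ge0//.
by apply: lerXn2r; rewrite ?nnegrE.
Qed.
End pair_inequalities.

(** * Divided differences of the lower field near the hard edge *)

Section pair_floor.
Variables (R : realFieldType) (p : nat).
Hypothesis p2 : (2 <= p)%N.

(* At the hard edge the field of the lower tail is singular in [s = 0]; the
   cutoff [s >= r / (4p)] removes the singularity and is scale invariant. *)
Definition floor_at (s r : R) := Num.max s (r / (4 * p%:R)).
Definition lowdev (s r : R) := pospart (r - floor_at s r).

Let p0 : (0 < p)%N. Proof. exact: leq_trans p2. Qed.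
Let pR : 2 <= p%:R :> R. Proof. by rewrite (ler_nat _ 2). Qed.
Let tau : R := (4 * p%:R)^-1.
Let tau0 : 0 < tau. Proof. by rewrite invr_gt0; have := pR; lra. Qed.
Let taup : tau * p%:R = 4^-1.
Proof. by rewrite /tau; field; rewrite gt_eqF//; have := pR; lra. Qed.
Let tau8 : tau <= 8^-1. Proof. by have := taup; have := pR; have := tau0; nra. Qed.

Lemma lowdev_ge0 s r : 0 <= lowdev s r.
Proof. exact: pospart_ge0. Qed.

Lemma floor_at_gt0 s r : 0 < r -> 0 < floor_at s r.
Proof. by move=> r0; rewrite /floor_at lt_max mulr_gt0 ?orbT. Qed.

Lemma lowdev_le (s r : R) : 0 < r -> lowdev s r <= (1 - tau) * r.
Proof.
move=> r0; rewrite /lowdev -[leRHS]pospart_id; last first.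
  by rewrite mulr_ge0 ?(ltW r0)//; have := tau8; lra.
apply: pospart_le; rewrite mulrBl mul1r lerD2l lerN2 /floor_at mulrC.
by rewrite le_max mulrC lexx orbT.
Qed.

Let floor_low s r : s <= tau * r -> floor_at s r = tau * r.
Proof. by move=> h; rewrite /floor_at mulrC; apply/max_idPr. Qed.

Let floor_high s r : tau * r <= s -> floor_at s r = s.
Proof. by move=> h; rewrite /floor_at [r / _]mulrC; apply/max_idPl. Qed.

Let lowdev_low s r : 0 < r -> s <= tau * r -> lowdev s r = (1 - tau) * r.
Proof.
move=> r0 h; rewrite /lowdev floor_low// pospart_id; first by ring.
by have := tau8; nra.
Qed.

Let exprp (z : R) : z ^+ p = z * z ^+ p.-1.
Proof. by rewrite -exprS prednK. Qed.

(** The lower field at t = s^2 is -2 t times this quantity; below the floor it is constant in s and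
    proportional to r^(p-1). *)
Let slope s r := lowdev s r ^+ p / floor_at s r.

Let slope_le_low {s r} : 0 < r ->
  slope s r <= (1 - tau) ^+ p / tau * r ^+ p.-1.
Proof.
move=> r0.
have -> : (1 - tau) ^+ p / tau * r ^+ p.-1 = ((1 - tau) * r) ^+ p / (tau * r).
  rewrite exprMn (exprp r); field.
  by rewrite (gt_eqF r0) (gt_eqF tau0).
apply: ler_div2; rewrite ?floor_at_gt0 ?mulr_gt0//.
apply: ler_pM; rewrite ?exprn_ge0 ?lowdev_ge0//.
- by rewrite mulr_ge0 ?ltW.
- apply: lerXn2r; rewrite ?nnegrE ?lowdev_ge0 ?lowdev_le//.
  by rewrite mulr_ge0 ?(ltW r0)//; have := tau8; lra.
- by rewrite /floor_at le_max [r / _]mulrC lexx orbT.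
Qed.

Let slope_low s r : 0 < r -> s <= tau * r ->
  slope s r = (1 - tau) ^+ p / tau * r ^+ p.-1.
Proof.
move=> r0 h; rewrite /slope floor_low// lowdev_low//.
rewrite exprMn (exprp r); field.
by rewrite (gt_eqF r0) (gt_eqF tau0).
Qed.

(* The right-hand side is at most the slope as soon as one of the two points
   lies below its floor: then the larger one is a bounded multiple of its
   floor, or the two nodes are well separated. *)
Let quotient_le_slope s1 s2 r1 r2 : 0 <= s2 -> s2 < s1 -> 0 < r2 -> r2 < r1 ->
  (s1 < tau * r1) || (s2 < tau * r2) ->
  (r1 * lowdev s1 r1 ^+ p - r2 * lowdev s2 r2 ^+ p) / (r1 ^+ 2 - r2 ^+ 2)
    <= slope s1 r1.
Proof.
move=> s20 s21 r20 r21 low.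
have r10 : 0 < r1 by exact: lt_trans r21.
have fl0 : 0 < floor_at s1 r1 by exact: floor_at_gt0.
have R0 : 0 < r1 ^+ 2 - r2 ^+ 2 by nra.
have [K12|K21] := leP (lowdev s1 r1) (lowdev s2 r2).
  have le1 : lowdev s1 r1 ^+ p <= lowdev s2 r2 ^+ p.
    by apply: lerXn2r; rewrite ?nnegrE ?lowdev_ge0.
  have K0 : 0 <= lowdev s1 r1 ^+ p by rewrite exprn_ge0// lowdev_ge0.
  have [e0|e0] := eqVneq (lowdev s1 r1) 0.
    rewrite /slope e0 expr0n gtn_eqF// mulr0 sub0r mul0r mulNr oppr_le0.
    by rewrite divr_ge0 ?(ltW R0)// mulr_ge0 ?(ltW r20)// exprn_ge0// lowdev_ge0.
  have flr : floor_at s1 r1 <= r1.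
    rewrite leNgt; apply/negP => h; move/eqP : e0; apply.
    by rewrite /lowdev pospart_eq0// subr_le0 ltW.
  apply: ler_div2 => //.
  apply: (@le_trans _ _ (lowdev s1 r1 ^+ p * (r1 - r2) * floor_at s1 r1)).
    rewrite ler_wpM2r ?(ltW fl0)//.
    by have := ler_wpM2l (ltW r20) le1; lra.
  rewrite -mulrA ler_wpM2l//.
  by nra.
set e1 := lowdev s1 r1 in K21 *; set e2 := lowdev s2 r2 in K21 *.
have e20 : 0 <= e2 by exact: lowdev_ge0.
have e10 : 0 < e1 by exact: le_lt_trans K21.
have K20 : 0 <= e2 ^+ p by rewrite exprn_ge0.
have K10 : 0 < e1 ^+ p by rewrite exprn_gt0.
have e1E : e1 = r1 - floor_at s1 r1.
  rewrite /e1 /lowdev pospart_id// ltW// ltNge; apply/negP => h.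
  by move: e10; rewrite /e1 /lowdev pospart_eq0 ?ltxx.
have [/andP[s2low far]|near] := boolP ((s2 < tau * r2) && (r2 <= (1 - tau) * r1)).
  apply: ler_div2 => //.
  apply: (@le_trans _ _ (r1 * e1 ^+ p * floor_at s1 r1)).
    by rewrite ler_wpM2r ?(ltW fl0)// lerBlDr lerDl mulr_ge0// ltW.
  rewrite [r1 * _]mulrC -mulrA ler_wpM2l ?(ltW K10)//.
  have e2E : e2 = (1 - tau) * r2 by apply: lowdev_low => //; exact: ltW.
  have : r2 * r2 <= e1 * r1.
    have h1 : r2 * ((1 - tau) * r1) <= e1 * r1.
      rewrite mulrA ler_wpM2r ?(ltW r10)//; apply: ltW.
      by rewrite mulrC -e2E.
    by apply: le_trans h1; rewrite ler_wpM2l// ltW.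
  by rewrite e1E; nra.
(* Otherwise the floor at index 1 is of size tau r1. The mean value bound below costs a factor p,
   which tau p = 1/4 absorbs. *)
have flsmall : floor_at s1 r1 <= 2 * tau * r1.
  have [s1low|s1high] := ltP s1 (tau * r1).
    by rewrite floor_low ?(ltW s1low)//; have := tau0; nra.
  move: low; rewrite ltNge s1high/= => s2low.
  move: near; rewrite s2low/= -ltNge => near.
  have e2E : e2 = (1 - tau) * r2 by apply: lowdev_low => //; exact: ltW.
  have : (1 - tau) * ((1 - tau) * r1) <= e1.
    apply: le_trans (ltW K21); rewrite e2E ler_wpM2l ?(ltW near)//.
    by have := tau8; lra.
  rewrite e1E; have := tau0; nra.
have fl12 : floor_at s2 r2 <= floor_at s1 r1.
  rewrite /floor_at ge_max !le_max (ltW s21)/=; apply/orP; right.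
  by rewrite ler_wpM2r// ltW.
have e12 : e1 - e2 <= r1 - r2.
  have : r2 - floor_at s2 r2 <= e2 by rewrite /e2 /lowdev/pospart le_max lexx.
  by rewrite e1E; lra.
have dK : e1 ^+ p - e2 ^+ p <= p%:R * e1 ^+ p.-1 * (r1 - r2).
  apply: (@le_trans _ _ (p%:R * e1 ^+ p.-1 * (e1 - e2))).
    by apply: convex_expr_diff; rewrite e20 ltW.
  by rewrite ler_wpM2l// mulr_ge0// exprn_ge0// ltW.
apply: ler_div2 => //.
have Kp : e1 ^+ p = e1 * e1 ^+ p.-1 by rewrite -exprS prednK.
have L0 : 0 < e1 ^+ p.-1 by rewrite exprn_gt0.
apply: (@le_trans _ _ ((e1 ^+ p + r2 * (p%:R * e1 ^+ p.-1)) * (r1 - r2) * (2 * tau * r1))).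
  apply: ler_pM; rewrite ?(ltW fl0)//.
    have : r2 * e2 ^+ p <= r1 * e1 ^+ p.
      apply: ler_pM; rewrite ?(ltW r20) ?(ltW r21)//.
      by apply: lerXn2r; rewrite ?nnegrE ?(ltW e10)// ltW.
    by lra.
  by have := ler_wpM2l (ltW r20) dK; lra.
have -> : r1 ^+ 2 - r2 ^+ 2 = (r1 + r2) * (r1 - r2) by ring.
rewrite mulrAC [leRHS]mulrA ler_wpM2r ?subr_ge0 ?(ltW r21)//.
rewrite Kp; set L := e1 ^+ p.-1 in L0 *.
have -> : (e1 * L + r2 * (p%:R * L)) * (2 * tau * r1) =
  (2 * tau * e1 * r1 + r2 / 2 * r1) * L.
  by have := taup => tp; transitivity ((2 * tau * e1 + r2 * 2 * (tau * p%:R)) * r1 * L); [ring|rewrite tp; field].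
rewrite [e1 * L * _]mulrAC ler_wpM2r ?(ltW L0)//.
have e1r : (3 / 4) * r1 <= e1 by rewrite e1E; have := tau8; nra.
by have := tau8; nra.
Qed.

(** If the slope at 1 is smaller than at 2, then s1 lies above its floor, since slopes below the
    floor are maximal and increase with the node; [pair_sqrt] applies with s2 raised to its floor,
    and lowering it back only increases the right-hand side. If the slope at 1 is at least that at
    2, the right-hand side is at least the slope at 1, and [quotient_le_slope] concludes unless both
    points are above their floors, where [pair_sqrt] applies as it is. *)
Lemma pair_floor s1 s2 r1 r2 : 0 <= s2 -> s2 < s1 -> 0 < r2 -> r2 < r1 ->
  (r1 * lowdev s1 r1 ^+ p - r2 * lowdev s2 r2 ^+ p) / (r1 ^+ 2 - r2 ^+ 2) <=
  (s1 ^+ 2 * (lowdev s1 r1 ^+ p / floor_at s1 r1)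
     - s2 ^+ 2 * (lowdev s2 r2 ^+ p / floor_at s2 r2)) / (s1 ^+ 2 - s2 ^+ 2).
Proof.
move=> s20 s21 r20 r21.
have r10 : 0 < r1 by exact: lt_trans r21.
have S0 : 0 < s1 ^+ 2 - s2 ^+ 2 by nra.
have R0 : 0 < r1 ^+ 2 - r2 ^+ 2 by nra.
rewrite -!/(slope _ _).
have sp1 : 0 < floor_at s1 r1 by exact: floor_at_gt0.
have sp2 : 0 < floor_at s2 r2 by exact: floor_at_gt0.
have K1E : lowdev s1 r1 ^+ p = floor_at s1 r1 * slope s1 r1.
  by rewrite /slope mulrC divfK ?gt_eqF.
have K2E : lowdev s2 r2 ^+ p = floor_at s2 r2 * slope s2 r2.
  by rewrite /slope mulrC divfK ?gt_eqF.
have [m12|m21] := ltP (slope s1 r1) (slope s2 r2).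
  have s1high : tau * r1 <= s1.
    rewrite leNgt; apply/negP => s1low.
    move: m12; rewrite ltNge => /negP; apply.
    rewrite [in leRHS]slope_low ?(ltW s1low)//; apply: (le_trans (slope_le_low r20)).
    apply: ler_wpM2l.
      by rewrite divr_ge0 ?(ltW tau0)// exprn_ge0//; have := tau8; lra.
    by apply: lerXn2r; rewrite ?nnegrE ltW.
  have f1 : floor_at s1 r1 = s1 by exact: floor_high.
  have f2s1 : floor_at s2 r2 < s1.
    rewrite /floor_at gt_max s21/= [r2 / _]mulrC.
    by apply: lt_le_trans s1high; rewrite ltr_pM2l.
  have s2f2 : s2 <= floor_at s2 r2 by rewrite /floor_at le_max lexx.
  have := @pair_sqrt R p s1 (floor_at s2 r2) r1 r2 p0 (ltW sp2) f2s1 (ltW r20) r21.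
  have -> : pospart (r1 - s1) = lowdev s1 r1 by rewrite /lowdev f1.
  have -> : pospart (r2 - floor_at s2 r2) = lowdev s2 r2 by [].
  move=> /le_trans; apply.
  rewrite K1E K2E f1.
  have F0 : 0 < s1 ^+ 2 - floor_at s2 r2 ^+ 2 by nra.
  apply: ler_div2 => //.
  set f := floor_at s2 r2 in f2s1 s2f2 sp2 F0 *.
  set m1 := slope s1 r1 in m12 *; set m2 := slope s2 r2 in m12 *.
  rewrite -subr_ge0.
  have -> : (s1 ^+ 2 * m1 - s2 ^+ 2 * m2) * (s1 ^+ 2 - f ^+ 2) -
    (s1 * (s1 * m1) - f * (f * m2)) * (s1 ^+ 2 - s2 ^+ 2) =
    s1 ^+ 2 * ((f ^+ 2 - s2 ^+ 2) * (m2 - m1)) by ring.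
  by rewrite mulr_ge0 ?sqr_ge0// mulr_ge0//; nra.
have [low|] := boolP ((s1 < tau * r1) || (s2 < tau * r2)); last first.
  rewrite negb_or -!leNgt => /andP[h1 h2].
  have f1 : floor_at s1 r1 = s1 by exact: floor_high.
  have f2 : floor_at s2 r2 = s2 by exact: floor_high.
  have := @pair_sqrt R p s1 s2 r1 r2 p0 s20 s21 (ltW r20) r21.
  rewrite /slope /lowdev f1 f2 => /le_trans; apply.
  have s1n0 : s1 != 0 by rewrite -f1 gt_eqF.
  have s2n0 : s2 != 0 by rewrite -f2 gt_eqF.
  have h (s K : R) : s != 0 -> s ^+ 2 * (K / s) = s * K by move=> ?; field.
  by rewrite !h.
apply: (le_trans (quotient_le_slope s20 s21 r20 r21 low)).
rewrite ler_pdivlMr//.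
have : 0 <= s2 ^+ 2 * (slope s1 r1 - slope s2 r2).
  by rewrite mulr_ge0 ?sqr_ge0// subr_ge0.
by rewrite !mulrBr; lra.
Qed.
End pair_floor.

(** * Integration by parts against a cutoff density *)

Section tuple_integral.
Context {R : realType}.
Local Notation RT := (measurableTypeR R).

Definition upd n (t : n.-tuple RT) (i : 'I_n) (y : RT) : n.-tuple RT :=
  [tuple if j == i then y else tnth t j | j < n].

Lemma tnth_upd n (t : n.-tuple RT) i y j :
  tnth (upd t i y) j = if j == i then y else tnth t j.
Proof. by rewrite tnth_mktuple. Qed.

Lemma upd_tcons0 n (x y : RT) (t : n.-tuple RT) :
  upd (tcons (x, t)) ord0 y = tcons (y, t).
Proof.
apply: eq_from_tnth => j; rewrite tnth_upd.
by have [k ->|->//] := unliftP ord0 j; rewrite !tnthS.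
Qed.

Lemma upd_tconsS n (x y : RT) (t : n.-tuple RT) i :
  upd (tcons (x, t)) (lift ord0 i) y = tcons (x, upd t i y).
Proof.
apply: eq_from_tnth => j; rewrite tnth_upd.
have [k ->|->] := unliftP ord0 j; last by [].
by rewrite !tnthS tnth_upd (inj_eq lift_inj).
Qed.

Definition box n (r : R) : set (n.-tuple RT) :=
  [set t | forall j, [set` `[0, r]%R] (tnth t j)].
Arguments box : clear implicits.

Lemma measurable_box n r : measurable (box n r).
Proof.
rewrite (_ : box n r = \bigcap_(i in [set: 'I_n])
    ((fun t : n.-tuple RT => tnth t i) @^-1` [set` `[0, r]%R])).
  apply: fin_bigcap_measurable => // i _; rewrite -[X in measurable X]setTI.
  by apply: measurable_tnth => //.
by apply/seteqP; split=> [t tA i _|t tA i]; exact: tA.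
Qed.

Lemma lebesgue_box_fin n r : (lebesgue_tuple n (box n r) < +oo)%E.
Proof.
rewrite (lebesgue_tuple_box (A := fun=> [set` `[0, r]%R]))//.
suff: (\prod_(i < n) lebesgue_measure [set` `[0%R, r]%R] < +oo /\
  0 <= \prod_(i < n) @lebesgue_measure R [set` `[0%R, r]%R])%E by case.
apply: (big_ind (fun x : \bar R => (x < +oo)%E /\ (0 <= x)%E)) => [|x y [? ?] [? ?]|i _].
- by rewrite ltry lee01.
- split; last exact: mule_ge0.
  by apply: lte_mul_pinfty => //; rewrite ge0_fin_numE.
- by rewrite lebesgue_measure_itv/= lte_fin; case: ifP => h; rewrite ?ltry ?lte_fin//= lee_fin; split => //; lra.
Qed.

Lemma integrable_box n (f : n.-tuple RT -> R) (M r : R) :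
  measurable_fun setT f -> (forall t, `|f t| <= M) ->
  (forall t, f t != 0 -> box n r t) ->
  (lebesgue_tuple n).-integrable setT (EFin \o f).
Proof.
move=> mf fM fr; apply/integrableP; split; first exact/measurable_EFinP.
apply: (@le_lt_trans _ _ (\int[lebesgue_tuple n]_(t in setT) (M%:E * (\1_(box n r) t)%:E))%E).
  apply: ge0_le_integral => //.
  - by apply/measurableT_comp => //; apply/measurable_EFinP.
  - apply/measurable_EFinP; apply: measurable_funM => //.
    apply: measurable_indic; exact: measurable_box.
  move=> t _ /=; rewrite lee_fin indicE.
  have [->|ft0] := eqVneq (f t) 0.
    by rewrite normr0 mulr_ge0//; exact: le_trans (fM t).
  by rewrite mem_set ?mulr1//; exact: fr.
have M0 : 0 <= M by exact: le_trans (fM [tuple 0 | i < n]).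
rewrite ge0_integralZl//.
- rewrite integral_indic ?setIT//; last exact: measurable_box.
  by apply: lte_mul_pinfty (lebesgue_box_fin n r) => //; rewrite lee_fin.
- by apply/measurable_EFinP; apply: measurable_indic; exact: measurable_box.
Qed.

Lemma measurable_tcons1 n (x : RT) :
  measurable_fun [set: n.-tuple RT] (fun t => tcons (x, t)).
Proof. by apply: (measurableT_comp (measurable_tcons (n:=n))); exact: pair1_measurable. Qed.

(* Fubini along one coordinate *)
Lemma integral_slice0 n (i : 'I_n) (f : n.-tuple RT -> R) (M r : R) :
  measurable_fun setT f -> (forall t, `|f t| <= M) ->
  (forall t, f t != 0 -> box n r t) ->
  (forall t, \int[lebesgue_measure]_y (f (upd t i y))%:E = 0)%E ->
  (\int[lebesgue_tuple n]_t (f t)%:E = 0)%E.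
Proof.
elim: n i f => [|n ih] i f mf fM fr f0; first by case: i f0 => -[].
have fi := integrable_box mf fM fr.
have mc := @measurable_tcons R n.
have fci : (@lebesgue_measure R \x lebesgue_tuple n)%E.-integrable setT
    (EFin \o f \o @tcons R n).
  apply/integrableP; split.
    apply: measurableT_comp mc; exact/measurable_EFinP.
  move/integrableP : fi => [_]; rewrite /= /lebesgue_tupleS.
  rewrite ge0_integral_pushforward//.
  have mfE : measurable_fun setT (EFin \o f) by exact/measurable_EFinP.
  exact: (measurableT_comp (@abse_measurable R setT) mfE).
transitivity (\int[(@lebesgue_measure R \x lebesgue_tuple n)%E]_p (f (tcons p))%:E)%E.
  rewrite /= /lebesgue_tupleS integral_pushforward//=.
  exact/measurable_EFinP.
have [i' ii'|ii'] := unliftP ord0 i; last first.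
  rewrite -(integral21_prod_meas1 fci)//.
  apply: integral0_eq => t _; rewrite /fubini_G/=.
  rewrite -[RHS](f0 (tcons (0, t))) ii'.
  by apply: eq_integral => y _; rewrite upd_tcons0.
rewrite -(integral12_prod_meas1 fci)//.
apply: integral0_eq => x _; rewrite /fubini_F/=.
apply: (ih i' (fun t => f (tcons (x, t)))).
- by apply: measurableT_comp => //; exact: measurable_tcons1.
- by [].
- by move=> t /fr h j; have := h (lift ord0 j); rewrite tnthS.
- by move=> t; rewrite -[RHS](f0 (tcons (x, t))) ii'; apply: eq_integral => y _; rewrite upd_tconsS.
Qed.
End tuple_integral.
Arguments box {R} n r.

(** * Powers of the positive part and logarithmic derivatives *)

Section one_variable.
Context {R : realType}.
Implicit Types (f g l : R -> R) (y z : R).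

Lemma pospart_continuous : continuous (@pospart R : R -> R).
Proof.
move=> y.
apply: (@continuous_max R R id (cst 0) y); [exact: cvg_id|exact: cvg_cst].
Qed.

Definition pospow (c z : R) : R := pospart z `^ c.

Lemma pospow_gt0E c z : 0 < z -> pospow c z = z `^ c.
Proof. by move=> z0; rewrite /pospow pospart_id// ltW. Qed.

Lemma pospow_le0E c z : c != 0 -> z <= 0 -> pospow c z = 0.
Proof. by move=> c0 z0; rewrite /pospow pospart_eq0// powR0. Qed.

Lemma pospow_ge0 c z : 0 <= pospow c z.
Proof. exact: powR_ge0. Qed.

Lemma near_pospow_gt0 c z : 0 < z -> \near z, z `^ c = pospow c z.
Proof. by move=> z0; near=> y; rewrite pospow_gt0E//; near: y; exact: lt_nbhsr. Unshelve. all: end_near. Qed.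

Lemma near_pospow_lt0 c z : c != 0 -> z < 0 -> \near z, cst 0 z = pospow c z.
Proof. by move=> c0 z0; near=> y; rewrite pospow_le0E// ltW//; near: y; exact: lt_nbhsl. Unshelve. all: end_near. Qed.

Lemma pospow_continuous c : 0 < c -> continuous (pospow c).
Proof.
move=> c0 z; have cn0 : c != 0 by rewrite gt_eqF.
have [z0|z0|->] := ltgtP z 0.
- rewrite /continuous_at pospow_le0E ?(ltW z0)//.
  apply: cvg_trans (near_eq_cvg (near_pospow_lt0 cn0 z0)) _.
  exact: cvg_cst.
- rewrite /continuous_at pospow_gt0E//.
  apply: cvg_trans (near_eq_cvg (near_pospow_gt0 c z0)) _.
  have : {for z, continuous (fun y : R => y `^ c)}.
    apply/differentiable_continuous/derivable1_diffP.
    exact: (@ex_derive _ _ _ _ _ _ _ (is_derive1_powR c z0)).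
  exact.
- apply/continuous_withinNx; rewrite pospow_le0E//.
  apply: (@cvg_at_right_left_dnbhs _ R^o).
    apply: cvg_trans (powR_cvg0 c0); apply: near_eq_cvg; near=> y.
    by rewrite [RHS]pospow_gt0E.
  apply: (@cvg_trans _ (cst 0 y @[y --> 0^'-])); last exact: cvg_cst.
  by apply: near_eq_cvg; near=> y; rewrite [RHS]pospow_le0E//= ltW.
Unshelve. all: end_near. Qed.

Lemma is_derive_pospow c z : 1 < c ->
  is_derive z 1 (pospow c) (c * pospow (c - 1) z).
Proof.
move=> c1; have c0 : c != 0 by lra.
have c10 : 0 < c - 1 by lra.
have c1n0 : c - 1 != 0 by rewrite gt_eqF.
have [z0|z0|->] := ltgtP z 0.
- rewrite pospow_le0E ?(ltW z0) ?gt_eqF// mulr0.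
  exact: near_eq_is_derive (near_pospow_lt0 c0 z0) _.
- rewrite pospow_gt0E//.
  exact: near_eq_is_derive (near_pospow_gt0 c z0) (is_derive1_powR c z0).
- rewrite (pospow_le0E (c := c - 1)) ?gt_eqF// mulr0.
  have lim0 : h^-1 *: ((pospow c \o shift 0) (h *: 1) - pospow c 0) @[h --> 0^'] --> (0 : R).
    have : pospow (c - 1) h @[h --> 0^'] --> (0 : R).
      have := @pospow_continuous (c - 1) c10 0.
      by move/continuous_withinNx; rewrite pospow_le0E// gt_eqF.
    apply: cvg_trans; apply: near_eq_cvg; near=> h.
    have h0 : h != 0 by near: h; exact: nbhs_dnbhs_neq.
    rewrite /= addr0 /GRing.scale/= mulr1 [pospow c 0]pospow_le0E// subr0.
    have [hn|hp] := leP h 0; first by rewrite (pospow_le0E c0 hn) (pospow_le0E c1n0 hn) mulr0.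
    rewrite !pospow_gt0E// powRB ?h0 ?implybT// powRr1 ?(ltW hp)//.
    by rewrite mulrC.
  split; first by apply/cvg_ex; exists 0.
  exact/cvg_lim.
Unshelve. all: end_near. Qed.

(* [l] is the logarithmic derivative of [f], extended to the zeros of [f]. *)
Definition C1log f l :=
  (forall y, is_derive y 1 f (f y * l y)) /\ continuous (fun y => f y * l y).

Lemma is_derive_continuous f (f' : R -> R) :
  (forall y, is_derive y 1 f (f' y)) -> continuous f.
Proof.
move=> df y; apply/differentiable_continuous/derivable1_diffP.
exact: (@ex_derive _ _ _ _ _ _ _ (df y)).
Qed.

Lemma C1log_continuous f l : C1log f l -> continuous f.
Proof. by case=> /is_derive_continuous. Qed.

Lemma C1log_cst (k : R) : C1log (cst k) (cst 0).
Proof.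
split=> [y|y]; first by rewrite mulr0; exact: is_derive_cst.
by rewrite /= mulr0; exact: cvg_cst.
Qed.

Lemma C1log_mul f g l m : C1log f l -> C1log g m ->
  C1log (fun y => f y * g y) (fun y => l y + m y).
Proof.
move=> fl gm; have cf := C1log_continuous fl; have cg := C1log_continuous gm.
case: fl => df cfl; case: gm => dg cgm; split=> y.
  have -> : f y * g y * (l y + m y) = f y *: (g y * m y) + g y *: (f y * l y).
    by rewrite /GRing.scale/=; ring.
  exact: is_deriveM.
have -> : (fun y => f y * g y * (l y + m y)) =
    (fun y => f y * (g y * m y)) \+ (fun y => g y * (f y * l y)).
  by apply/funext => z /=; ring.
by apply: continuousD; apply: continuousM; [exact: cf|exact: cgm|exact: cg|exact: cfl].
Qed.

Lemma C1log_prod (I : Type) (s : seq I) (f l : I -> R -> R) :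
  (forall i, C1log (f i) (l i)) ->
  C1log (fun y => \prod_(i <- s) f i y) (fun y => \sum_(i <- s) l i y).
Proof.
move=> fl; elim: s => [|i s ih].
  under eq_fun do rewrite big_nil; under [X in C1log _ X]eq_fun do rewrite big_nil.
  exact: C1log_cst.
under eq_fun do rewrite big_cons; under [X in C1log _ X]eq_fun do rewrite big_cons.
exact: C1log_mul.
Qed.

Lemma C1log_affine f l (e k : R) : C1log f l ->
  C1log (fun y => f (k + e * y)) (fun y => e * l (k + e * y)).
Proof.
case=> df cfl; have da (y : R) : is_derive y 1 (fun y => k + e * y) e.
  suff : is_derive y 1 (fun y => k + e * y) (0 + (e *: (1 : R) + y *: (0 : R))).
    by rewrite /GRing.scale/= add0r mulr0 addr0 mulr1.
  by apply: is_deriveD; apply: is_deriveM.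
split=> y.
  have -> : f (k + e * y) * (e * l (k + e * y)) = f (k + e * y) * l (k + e * y) * e.
    by ring.
  by apply: (@is_derive1_comp _ f (fun y => k + e * y)).
have -> : (fun y => f (k + e * y) * (e * l (k + e * y))) =
    cst e \* (fun y => f (k + e * y) * l (k + e * y)) by apply/funext => z /=; ring.
apply: continuousM; first exact: cvg_cst.
apply: (@continuous_comp _ _ _ (fun y => k + e * y) (fun y => f y * l y)); last exact: cfl.
exact: (is_derive_continuous da).
Qed.

End one_variable.

(** * A continuously differentiable cutoff of a power weight *)

Section cutoff.
Context {R : realType}.
Implicit Types (dl c z : R).

(** Denominator of the cutoff factor z^2 / (z^2 + (dl - z)_+^2). It is C^1, never vanishes for dl >
    0, and equals z^2 for z >= dl; being rational on each piece, the factor has an explicit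
    logarithmic derivative. *)
Definition cutden dl z : R := pospart z ^+ 2 + pospart (dl - z) ^+ 2.

Definition cutden' dl z : R := 2 * pospart z - 2 * pospart (dl - z).

(* [z_+ `^ c] times a continuously differentiable factor that is [1] for
   [z >= dl] and vanishes to second order at [0] *)
Definition zeta dl c z : R := pospow (c + 2) z / cutden dl z.

Definition lzeta dl c z : R :=
  (c + 2) / pospart z - cutden' dl z / cutden dl z.

(** For z > 0 this is z times the logarithmic derivative of the cutoff factor. It depends on z / dl
    only, hence its bounds 0 and 4 for z >= 0 are uniform in dl. *)
Definition cutexcess dl z : R := 2 * dl * pospart (dl - z) / cutden dl z.

Lemma cutden_gt0 dl z : 0 < dl -> 0 < cutden dl z.
Proof.
move=> dl0; rewrite /cutden; have [z0|z0] := leP z 0.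
  by rewrite ltr_wpDl ?sqr_ge0// exprn_gt0// pospart_id; lra.
by rewrite ltr_pwDl ?sqr_ge0// exprn_gt0// pospart_id; lra.
Qed.

Lemma is_derive_pospart2 z :
  is_derive z 1 (fun z => pospart z ^+ 2) (2 * pospart z).
Proof.
have -> : (fun z => pospart z ^+ 2) = pospow 2 :> (R -> R).
  by apply/funext => y; rewrite /pospow powR_mulrn ?pospart_ge0.
have -> : 2 * pospart z = 2 * pospow (2 - 1) z.
  by rewrite /pospow (_ : 2 - 1 = 1) ?powRr1 ?pospart_ge0//; ring.
by apply: is_derive_pospow; lra.
Qed.

Lemma is_derive_cutden dl z : is_derive z 1 (cutden dl) (cutden' dl z).
Proof.
have d1 := is_derive_pospart2 z.
have d2 : is_derive z 1 (fun y => dl - y) (-1).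
  suff : is_derive z 1 (fun y => dl - y) (0 - 1) by rewrite sub0r.
  exact: is_deriveB.
have d3 : is_derive z 1 (fun y => pospart (dl - y) ^+ 2) (2 * pospart (dl - z) * -1).
  apply: (@is_derive1_comp _ (fun y => pospart y ^+ 2) (fun y => dl - y)) => //.
  exact: is_derive_pospart2.
have -> : cutden' dl z = 2 * pospart z + 2 * pospart (dl - z) * -1.
  by rewrite /cutden'; ring.
exact: is_deriveD.
Qed.

Lemma cutden'_continuous dl : continuous (cutden' dl).
Proof.
move=> z.
have -> : cutden' dl = (cst 2 \* @pospart R) \- (cst 2 \* (@pospart R \o (fun y => dl - y))) by [].
apply: cvgB; apply: cvgM; [exact: cvg_cst|exact: pospart_continuous|exact: cvg_cst|].
apply: continuous_comp; last exact: pospart_continuous.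
by apply: cvgB; [exact: cvg_cst|exact: cvg_id].
Qed.

Lemma cutden_continuous dl : continuous (cutden dl).
Proof. exact: is_derive_continuous (is_derive_cutden dl). Qed.

Lemma zeta_le0E dl c z : -1 < c -> z <= 0 -> zeta dl c z = 0.
Proof. by move=> c1 z0; rewrite /zeta pospow_le0E ?mul0r//; lra. Qed.

Lemma zeta_ge0 dl c z : 0 < dl -> 0 <= zeta dl c z.
Proof. by move=> dl0; rewrite divr_ge0 ?pospow_ge0// ltW// cutden_gt0. Qed.

Lemma pospow_split c z : 0 < z -> pospow (c + 2) z = z `^ c * z ^+ 2.
Proof.
move=> z0; rewrite pospow_gt0E// powRD; last by rewrite (gt_eqF z0) implybT.
by rewrite (powR_mulrn 2) ?ltW.
Qed.

Lemma zeta_le dl c z : 0 < dl -> 0 < z -> zeta dl c z <= z `^ c.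
Proof.
move=> dl0 z0; rewrite /zeta pospow_split// -mulrA.
rewrite ler_piMr ?powR_ge0// ler_pdivrMr ?cutden_gt0// mul1r /cutden.
by rewrite [pospart z]pospart_id ?(ltW z0)// lerDl sqr_ge0.
Qed.

Lemma zeta_far dl c z : 0 < dl -> dl <= z -> zeta dl c z = z `^ c.
Proof.
move=> dl0 dlz; have z0 : 0 < z by exact: lt_le_trans dlz.
rewrite /zeta pospow_split// /cutden [pospart z]pospart_id ?(ltW z0)//.
rewrite [pospart (dl - z)]pospart_eq0 ?subr_le0// expr0n addr0 mulfK//.
by rewrite expf_neq0// gt_eqF.
Qed.

Lemma lzetaE dl c z : 0 < dl -> 0 < z ->
  lzeta dl c z = (c + cutexcess dl z) / z.
Proof.
move=> dl0 z0; rewrite /lzeta /cutexcess.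
have d0 : cutden dl z != 0 by rewrite gt_eqF// cutden_gt0.
have E : cutden' dl z * z = 2 * cutden dl z - 2 * dl * pospart (dl - z).
  rewrite /cutden' /cutden [pospart z]pospart_id ?(ltW z0)//.
  have [h|h] := leP dl z; last by rewrite pospart_id; [ring|lra].
  by rewrite pospart_eq0 ?subr_le0//; ring.
rewrite [pospart z]pospart_id ?(ltW z0)//.
have zn0 : z != 0 by rewrite gt_eqF.
have -> : cutden' dl z / cutden dl z = cutden' dl z * z / cutden dl z / z.
  by field; rewrite zn0 d0.
by rewrite E; field; rewrite zn0 d0.
Qed.

Lemma cutexcess_ge0 dl z : 0 < dl -> 0 <= cutexcess dl z.
Proof.
move=> dl0; rewrite divr_ge0 ?(ltW (cutden_gt0 _ dl0))//.
by rewrite !mulr_ge0 ?pospart_ge0// ltW.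
Qed.

Lemma cutexcess_far dl z : dl <= z -> cutexcess dl z = 0.
Proof.
by move=> dlz; rewrite /cutexcess pospart_eq0 ?subr_le0// mulr0 mul0r.
Qed.

Lemma cutexcess_le dl z : 0 < dl -> 0 <= z -> cutexcess dl z <= 4.
Proof.
move=> dl0 z0; have [h|h] := leP dl z; first by rewrite cutexcess_far.
rewrite ler_pdivrMr ?cutden_gt0// /cutden !pospart_id ?subr_ge0 ?(ltW h)//.
have := sqr_ge0 (z - (dl - z)); have := sqr_ge0 z; have := sqr_ge0 (dl - z).
by lra.
Qed.

Lemma lzeta_far dl z : 0 < dl -> dl <= z -> lzeta dl 0 z = 0.
Proof.
move=> dl0 dlz; rewrite lzetaE ?cutexcess_far ?addr0 ?mul0r//.
exact: lt_le_trans dlz.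
Qed.

Lemma lzeta0_ge0 dl z : 0 < dl -> 0 < z -> 0 <= lzeta dl 0 z.
Proof.
by move=> dl0 z0; rewrite lzetaE// add0r divr_ge0 ?cutexcess_ge0 ?ltW.
Qed.

(** The factor z^2 raises the exponent to c + 2 > 1, which makes the product C^1 at 0 even when z^c
    is singular there. *)
Lemma C1log_zeta dl c : 0 < dl -> -1 < c -> C1log (zeta dl c) (lzeta dl c).
Proof.
move=> dl0 c1.
have dn0 z : cutden dl z != 0 by rewrite gt_eqF// cutden_gt0.
have E z : zeta dl c z * lzeta dl c z =
    pospow (c + 2) z * (- cutden dl z ^- 2 * cutden' dl z) +
    (cutden dl z)^-1 * ((c + 2) * pospow (c + 2 - 1) z).
  have [z0|z0] := leP z 0.
    by rewrite zeta_le0E// !pospow_le0E ?mul0r ?mulr0 ?addr0//; lra.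
  rewrite /zeta /lzeta [pospart z]pospart_id ?(ltW z0)//.
  have -> : pospow (c + 2) z = z * pospow (c + 2 - 1) z.
    by rewrite !pospow_gt0E// mulr_powRB1 ?ltW//; lra.
  by field; rewrite (gt_eqF z0) (dn0 z).
split=> [z|].
  rewrite E.
  have dV : is_derive z 1 (fun y => (cutden dl y)^-1) (- cutden dl z ^- 2 *: cutden' dl z).
    by apply: is_deriveV => //; exact: is_derive_cutden.
  have dP : is_derive z 1 (pospow (c + 2)) ((c + 2) * pospow (c + 2 - 1) z).
    by apply: is_derive_pospow; lra.
  exact: is_deriveM.
have -> : (fun z => zeta dl c z * lzeta dl c z) =
  (pospow (c + 2) \* ((fun z => - ((cutden dl \* cutden dl) z)^-1) \* cutden' dl)) \+
  ((fun z => (cutden dl z)^-1) \* ((cst (c + 2)) \* pospow (c + 2 - 1))).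
  by apply/funext => z; rewrite E.
have cd := @cutden_continuous dl.
move=> z; apply: continuousD.
  apply: continuousM; first by apply: pospow_continuous; lra.
  apply: continuousM; last exact: cutden'_continuous.
  apply: continuousN; apply: continuousV; first by rewrite mulf_neq0.
  by apply: continuousM; exact: cd.
apply: continuousM; first by apply: continuousV => //; exact: cd.
apply: continuousM; first exact: cvg_cst.
by apply: pospow_continuous; lra.
Qed.

Lemma measurable_lzeta dl c : 0 < dl -> measurable_fun setT (lzeta dl c).
Proof.
move=> dl0; apply: measurable_funB.
  apply: measurable_funM => //.
  have -> : (fun z : R => (pospart z)^-1) = (powR (R:=R) ^~ (-1)) \o (@pospart R).
    by apply/funext => z /=; rewrite powR_inv1 ?pospart_ge0.
  apply: measurableT_comp; first exact: measurable_powR.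
  by apply: continuous_measurable_fun; exact: pospart_continuous.
apply: continuous_measurable_fun => z.
apply: continuousM; first exact: cutden'_continuous.
by apply: continuousV; [rewrite gt_eqF// cutden_gt0|exact: cutden_continuous].
Qed.

End cutoff.

(** * Fundamental theorem of calculus across a break point *)

Section pieces.
Context {R : realType}.
Local Notation mu := (@lebesgue_measure R).

Lemma integral_derive_itv (f f' : R -> R) (a b : R) : a < b ->
  (forall y : R, a <= y <= b -> is_derive y 1 f (f' y)) ->
  (forall y : R, a <= y <= b -> {for y, continuous f'}) ->
  (\int[mu]_(y in `[a, b]) (f' y)%:E = (f b - f a)%:E)%E.
Proof.
move=> ab df cf'.
have cf y : a <= y <= b -> {for y, continuous f}.
  move=> yab; apply/differentiable_continuous/derivable1_diffP.
  exact: (@ex_derive _ _ _ _ _ _ _ (df _ yab)).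
have cwf : {within `[a, b], continuous f}.
  by apply: continuous_in_subspaceT => y; rewrite inE/= in_itv/= => /cf.
have /(continuous_within_itvP _ ab)[_ fa fb] := cwf.
rewrite (continuous_FTC2 ab _ _ _ (F := f)) ?EFinB//.
- by apply: continuous_in_subspaceT => y; rewrite inE/= in_itv/= => /cf'.
- split => // y; rewrite in_itv/= => /andP[ay yb].
  by apply: (@ex_derive _ _ _ _ _ _ _ (df y _)); rewrite !ltW.
- move=> y; rewrite in_itv/= => /andP[ay yb].
  rewrite derive1E; apply: (@derive_val _ _ _ _ _ _ _ (df y _)).
  by rewrite !ltW.
Qed.

(** The primitive may have a corner at m, as the lower field does where its linear part begins; the
    two increments cancel because the values agree at m and vanish at 0 and r. *)
Lemma integral_two_pieces (g f1 f1' f2 f2' : R -> R) (m r : R) :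
  0 < m -> m < r -> measurable_fun setT g ->
  (forall y : R, 0 <= y <= m -> is_derive y 1 f1 (f1' y)) ->
  (forall y : R, 0 <= y <= m -> {for y, continuous f1'}) ->
  (forall y : R, m <= y <= r -> is_derive y 1 f2 (f2' y)) ->
  (forall y : R, m <= y <= r -> {for y, continuous f2'}) ->
  (forall y : R, 0 <= y <= m -> g y = f1' y) ->
  (forall y : R, m < y <= r -> g y = f2' y) ->
  (forall y : R, ~~ (0 <= y <= r) -> g y = 0) ->
  f1 0 = 0 -> f1 m = f2 m -> f2 r = 0 ->
  (\int[mu]_y (g y)%:E = 0)%E.
Proof.
move=> m0 mr mg df1 cf1 df2 cf2 g1 g2 g0 f10 f12 f2r.
have -> : (\int[mu]_y (g y)%:E = \int[mu]_(y in `[0%R, r]) (g y)%:E)%E.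
  rewrite [RHS]integral_mkcond; apply: eq_integral => y _.
  rewrite /patch; case: ifPn => //; rewrite notin_setE/= in_itv/= => /negP.
  by move=> /g0 ->.
have -> : [set` `[0%R, r]] = [set` `[0%R, m]] `|` [set` `]m, r]] :> set R.
  by apply: itv_bndbnd_setU; rewrite bnd_simp ltW.
have -> : (\int[mu]_(y in [set` `[0%R, m]] `|` [set` `]m, r]]) (g y)%:E =
  \int[mu]_(y in `[0%R, m]) (g y)%:E + \int[mu]_(y in `]m, r]) (g y)%:E)%E.
  rewrite integral_setU_EFin//.
  - exact: measurable_funTS.
  - apply/disj_setPS => y [/=]; rewrite !in_itv/= => /andP[_ ym] /andP[].
    by rewrite ltNge ym.
have -> : (\int[mu]_(y in `[0%R, m]) (g y)%:E = (f1 m - f1 0)%:E)%E.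
  rewrite -(integral_derive_itv m0 df1 cf1).
  by apply: eq_integral => y; rewrite inE/= in_itv/= => /g1 ->.
have -> : (\int[mu]_(y in `]m, r]) (g y)%:E = (f2 r - f2 m)%:E)%E.
  rewrite -(integral_derive_itv mr df2 cf2).
  rewrite -integral_itv_obnd_cbnd.
    by apply: eq_integral => y; rewrite inE/= in_itv/= => /g2 ->.
  apply/measurable_EFinP; apply: (@eq_measurable_fun _ _ _ _ _ g).
    by move=> y; rewrite inE/= in_itv/= => /g2.
  exact: measurable_funTS.
by rewrite -EFinD f10 f12 f2r; congr EFin; ring.
Qed.

Lemma continuous_bounded (f : R -> R) (a b : R) :
  (forall y : R, a <= y <= b -> {for y, continuous f}) ->
  exists M, forall y, a <= y <= b -> `|f y| <= M.
Proof.
move=> cf; have [ab|ba] := leP a b; last first.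
  by exists 0 => y /andP[ay yb]; move: (lt_le_trans ba (le_trans ay yb)); rewrite ltxx.
have c : {within `[a, b], continuous (fun y => `|f y|)}.
  apply: continuous_in_subspaceT => y; rewrite inE/= in_itv/= => /cf h.
  exact: cvg_norm.
have [c0 _ h] := EVT_max ab c.
by exists `|f c0| => y yab; apply: h; rewrite in_itv.
Qed.
End pieces.

(** * Integration by parts in one coordinate of a product weight *)

Section by_parts.
Context {R : realType}.
Local Notation RT := (measurableTypeR R).
Variables (n : nat) (A lA Z lZ : R -> R).

(* One product over all ordered pairs: the diagonal carries the one-body
   weight, the strict upper triangle the interaction. *)
Definition factor (t : n.-tuple RT) (q : 'I_n * 'I_n) : R :=
  if (q.1 < q.2)%N then Z (tnth t q.2 - tnth t q.1)
  else if q.1 == q.2 then A (tnth t q.1) else 1.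

Definition dlog_factor (i : 'I_n) (t : n.-tuple RT) (q : 'I_n * 'I_n) : R :=
  if (q.1 < q.2)%N then
    lZ (tnth t q.2 - tnth t q.1) * ((q.2 == i)%:R - (q.1 == i)%:R)
  else if q.1 == q.2 then (q.1 == i)%:R * lA (tnth t q.1) else 0.

Definition weight t := \prod_q factor t q.

Definition dlog_weight i t := \sum_q dlog_factor i t q.

Hypotheses (hA : C1log A lA) (hZ : C1log Z lZ).

Lemma C1log_factor t i q :
  C1log (fun y => factor (upd t i y) q) (fun y => dlog_factor i (upd t i y) q).
Proof.
have ext (f f' l l' : R -> R) : f' =1 f -> l' =1 l -> C1log f l -> C1log f' l'.
  by move=> /funext -> /funext ->.
rewrite /factor /dlog_factor; case: (boolP (q.1 < q.2)%N) => [lt12|_]; last first.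
  case: (boolP (q.1 == q.2)) => _; last exact: C1log_cst.
  have [qi|qi] := eqVneq q.1 i.
    by apply: ext hA => y; rewrite tnth_upd qi eqxx ?mul1r.
  apply: ext (C1log_cst (A (tnth t q.1))) => y; first by rewrite tnth_upd (negbTE qi).
  by rewrite mul0r.
have ne12 : q.1 != q.2 by rewrite -val_eqE/= neq_ltn lt12.
have [q2i|q2i] := eqVneq q.2 i.
  have q1i : q.1 != i by rewrite -q2i.
  apply: ext (C1log_affine 1 (- tnth t q.1) hZ) => y.
    rewrite !tnth_upd q2i eqxx (negbTE q1i).
    by congr Z; ring.
  rewrite !tnth_upd q2i eqxx (negbTE q1i).
  by rewrite subr0 mulr1 mul1r; congr lZ; ring.
have [q1i|q1i] := eqVneq q.1 i.
  apply: ext (C1log_affine (-1) (tnth t q.2) hZ) => y.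
    rewrite !tnth_upd q1i eqxx (negbTE q2i).
    by congr Z; ring.
  rewrite !tnth_upd q1i eqxx (negbTE q2i).
  by rewrite sub0r mulrN1 mulN1r; congr (- lZ _); ring.
apply: ext (C1log_cst (Z (tnth t q.2 - tnth t q.1))) => y.
  by rewrite !tnth_upd (negbTE q1i) (negbTE q2i).
by rewrite subr0 mulr0.
Qed.

Lemma C1log_weight t i :
  C1log (fun y => weight (upd t i y)) (fun y => dlog_weight i (upd t i y)).
Proof.
by apply: C1log_prod => q; exact: C1log_factor.
Qed.

Hypotheses (mlA : measurable_fun setT lA) (mlZ : measurable_fun setT lZ).

Let mA : measurable_fun setT A.
Proof. by apply: continuous_measurable_fun; exact: C1log_continuous hA. Qed.

Let mZ : measurable_fun setT Z.
Proof. by apply: continuous_measurable_fun; exact: C1log_continuous hZ. Qed.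

Lemma measurable_comp_tnth (g : R -> R) i : measurable_fun setT g ->
  measurable_fun [set: n.-tuple RT] (fun t => g (tnth t i)).
Proof. by move=> mg; apply: (measurableT_comp mg); exact: measurable_tnth. Qed.

Lemma measurable_comp_tnthB (g : R -> R) i j : measurable_fun setT g ->
  measurable_fun [set: n.-tuple RT] (fun t => g (tnth t i - tnth t j)).
Proof.
move=> mg; apply: (measurableT_comp mg).
by apply: measurable_funB; exact: measurable_tnth.
Qed.

Lemma measurable_factor q : measurable_fun setT (factor ^~ q).
Proof.
rewrite /factor; case: (boolP (q.1 < q.2)%N) => _.
  exact: measurable_comp_tnthB.
by case: (boolP (q.1 == q.2)) => _; [exact: measurable_comp_tnth|exact: measurable_cst].
Qed.

Lemma measurable_weight : measurable_fun setT weight.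
Proof. by apply: measurable_prod => q _; exact: measurable_factor. Qed.

Lemma measurable_dlog_factor i q : measurable_fun setT (dlog_factor i ^~ q).
Proof.
rewrite /dlog_factor; case: (boolP (q.1 < q.2)%N) => _.
  apply: measurable_funM => //; exact: measurable_comp_tnthB.
case: (boolP (q.1 == q.2)) => _; last exact: measurable_cst.
by apply: measurable_funM => //; exact: measurable_comp_tnth.
Qed.

Lemma measurable_dlog_weight i : measurable_fun setT (dlog_weight i).
Proof. by apply: measurable_sum => q; exact: measurable_dlog_factor. Qed.

Variable r : R.
Hypothesis A0 : forall y : R, ~~ (0 < y < r) -> A y = 0.

Lemma weight_support t : weight t != 0 -> forall j, 0 < tnth t j < r.
Proof.
move=> + j; apply: contraNT => /A0 Aj0.
by rewrite /weight (bigD1 (j, j))//= /factor/= ltnn eqxx Aj0 mul0r.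
Qed.

(** Logarithmic derivatives are unbounded near the zeros of the factors. Only the product of a
    factor with its own logarithmic derivative is continuous, so these two are paired and the other
    factors are bounded separately. *)
Lemma weight_bounded : exists M, forall t,
  `|weight t| <= M /\ forall i q, `|weight t * dlog_factor i t q| <= M.
Proof.
have bounded (f l : R -> R) a b : C1log f l -> exists M M', forall y, a <= y <= b ->
    `|f y| <= M /\ `|f y * l y| <= M'.
  move=> fl; have cf : continuous f by exact: C1log_continuous fl.
  have [M hM] := @continuous_bounded R f a b (fun y _ => cf y).
  have [M' hM'] := @continuous_bounded R _ a b (fun y _ => fl.2 y).
  by exists M, M' => y yab; split; [exact: hM|exact: hM'].
have [MA [MA' hMA]] := bounded _ _ 0 r hA.
have [MZ [MZ' hMZ]] := bounded _ _ (- r) r hZ.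
(* The default value 1 covers the pairs whose factor is identically 1. *)
pose M := \big[Num.max/1]_(x <- [:: MA; MA'; MZ; MZ']) x.
have M1 : 1 <= M by exact: bigmax_ge_id.
have leM x : x \in [:: MA; MA'; MZ; MZ'] -> x <= M.
  by move=> xs; apply: le_bigmax_seq xs _.
exists (\prod_(q : 'I_n * 'I_n) M) => t.
have M0 : 0 <= \prod_(q : 'I_n * 'I_n) M.
  by apply: prodr_ge0 => _ _; exact: le_trans M1.
have [->|/weight_support tr] := eqVneq (weight t) 0.
  by split=> [|i q]; rewrite ?mul0r normr0.
have tr0 j : 0 <= tnth t j <= r by case/andP: (tr j) => *; rewrite !ltW.
have trB i j : - r <= tnth t i - tnth t j <= r.
  by move: (tr0 i) (tr0 j) => /andP[? ?] /andP[? ?]; lra.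
have fM q : `|factor t q| <= M.
  rewrite /factor; case: ifPn => _.
    by apply: le_trans (hMZ _ (trB _ _)).1 (leM _ _); rewrite !inE eqxx ?orbT.
  case: ifPn => _; last by rewrite normr1.
  by apply: le_trans (hMA _ (tr0 _)).1 (leM _ _); rewrite !inE eqxx ?orbT.
have flM i q : `|factor t q * dlog_factor i t q| <= M.
  rewrite /factor /dlog_factor; case: ifPn => _.
    rewrite mulrA normrM; apply: (@le_trans _ _ (MZ' * 1)).
      apply: ler_pM => //; first exact: (hMZ _ (trB _ _)).2.
      by case: (_ == _); case: (_ == _); rewrite ?subr0 ?sub0r ?subrr ?normrN ?normr0 ?normr1.
    by rewrite mulr1; apply: leM; rewrite !inE eqxx ?orbT.
  case: ifPn => _; last by rewrite mulr0 normr0; exact: le_trans M1.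
  rewrite mulrCA normrM; apply: (@le_trans _ _ (1 * MA')).
    apply: ler_pM => //; last exact: (hMA _ (tr0 _)).2.
    by case: (_ == _); rewrite ?normr0 ?normr1.
  by rewrite mul1r; apply: leM; rewrite !inE eqxx ?orbT.
split=> [|i q].
  by rewrite /weight normr_prod; apply: ler_prod => q _; rewrite normr_ge0 fM.
rewrite /weight (bigD1 q)//= [leRHS](bigD1 q)//= mulrAC normrM.
apply: ler_pM => //; rewrite normr_prod; apply: ler_prod => q' _.
by rewrite normr_ge0 fM.
Qed.

Variables (F1 F1' F2 F2' : R -> R) (m : R) (i : 'I_n).
Hypotheses (m0 : 0 < m) (mr : m < r).
Hypothesis dF1 : forall y : R, 0 <= y <= m -> is_derive y 1 F1 (F1' y).
Hypothesis cF1 : forall y : R, 0 <= y <= m -> {for y, continuous F1'}.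
Hypothesis dF2 : forall y : R, m <= y <= r -> is_derive y 1 F2 (F2' y).
Hypothesis cF2 : forall y : R, m <= y <= r -> {for y, continuous F2'}.
Hypothesis F12 : F1 m = F2 m.
Hypotheses (mF1 : measurable_fun setT F1) (mF2 : measurable_fun setT F2).
Hypotheses (mF1' : measurable_fun setT F1') (mF2' : measurable_fun setT F2').

Definition glue (f g : R -> R) y := if y <= m then f y else g y.

Lemma measurable_glue f g : measurable_fun setT f -> measurable_fun setT g ->
  measurable_fun setT (glue f g).
Proof.
move=> mf mg; apply: measurable_fun_ifT => //.
by apply: measurable_fun_ler => //; exact: measurable_cst.
Qed.

Definition by_parts_integrand t :=
  weight t * (glue F1' F2' (tnth t i) + glue F1 F2 (tnth t i) * dlog_weight i t).

Lemma measurable_by_parts : measurable_fun setT by_parts_integrand.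
Proof.
apply: measurable_funM; first exact: measurable_weight.
apply: measurable_funD.
  by apply: measurable_comp_tnth; exact: measurable_glue.
apply: measurable_funM; last exact: measurable_dlog_weight.
by apply: measurable_comp_tnth; exact: measurable_glue.
Qed.

Lemma by_parts_bounded : exists M, forall t, `|by_parts_integrand t| <= M.
Proof.
have cont (f f' : R -> R) (a b : R) : (forall y : R, a <= y <= b -> is_derive y 1 f (f' y)) ->
    forall y : R, a <= y <= b -> {for y, continuous f}.
  move=> df y yab; apply/differentiable_continuous/derivable1_diffP.
  exact: (@ex_derive _ _ _ _ _ _ _ (df _ yab)).
have [M1 h1] := continuous_bounded (cont _ _ _ _ dF1).
have [M2 h2] := continuous_bounded (cont _ _ _ _ dF2).
have [M3 h3] := continuous_bounded cF1.
have [M4 h4] := continuous_bounded cF2.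
have [MW hW] := weight_bounded.
have MW0 : 0 <= MW by exact: le_trans (hW [tuple 0 | i < n]).1.
pose a := Num.max 0 (Num.max M1 M2); pose b := Num.max 0 (Num.max M3 M4).
have a0 : 0 <= a by rewrite le_max lexx.
have b0 : 0 <= b by rewrite le_max lexx.
exists (MW * b + \sum_(q : 'I_n * 'I_n) a * MW) => t.
have S0 : 0 <= \sum_(q : 'I_n * 'I_n) a * MW by apply: sumr_ge0 => *; exact: mulr_ge0.
have [W0|W0] := eqVneq (weight t) 0.
  by rewrite /by_parts_integrand W0 mul0r normr0 addr_ge0// mulr_ge0.
have /andP[ti0 tir] := weight_support W0 i.
have glue_le (f g : R -> R) Mf Mg : (forall y, 0 <= y <= m -> `|f y| <= Mf) ->
    (forall y, m <= y <= r -> `|g y| <= Mg) ->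
    `|glue f g (tnth t i)| <= Num.max 0 (Num.max Mf Mg).
  rewrite /glue => hf hg; case: ifPn => him.
    by rewrite !le_max hf ?orbT// him (ltW ti0).
  by rewrite -ltNge in him; rewrite !le_max hg ?orbT// (ltW him) (ltW tir).
rewrite /by_parts_integrand mulrDr; apply: (le_trans (ler_normD _ _)).
apply: lerD; first by rewrite normrM ler_pM//; [exact: (hW t).1|exact: glue_le].
rewrite mulrCA /dlog_weight mulr_sumr mulr_sumr.
apply: (le_trans (ler_norm_sum _ _ _)); apply: ler_sum => q _.
by rewrite normrM ler_pM//; [exact: glue_le|exact: (hW t).2].
Qed.

Lemma by_parts_support t : by_parts_integrand t != 0 -> box n r t.
Proof.
rewrite mulf_eq0 negb_or => /andP[/weight_support h _] j /=.
by rewrite in_itv/=; case/andP: (h j) => *; rewrite !ltW.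
Qed.

Lemma integrable_by_parts :
  (lebesgue_tuple n).-integrable setT (EFin \o by_parts_integrand).
Proof.
have [M hM] := by_parts_bounded.
exact: integrable_box measurable_by_parts hM by_parts_support.
Qed.

(** With the other coordinates frozen, the integrand along coordinate i is on each piece the
    derivative of field times weight. The weight vanishes at 0 and at r, and the field is continuous
    at m. *)
Lemma integral_by_parts : (\int[lebesgue_tuple n]_t (by_parts_integrand t)%:E = 0)%E.
Proof.
have [M hM] := by_parts_bounded.
apply: (integral_slice0 (i := i) measurable_by_parts hM by_parts_support) => t.
have [dW cW] := C1log_weight t i.
set w := (fun y => weight (upd t i y)) in dW cW.
set l := (fun y => dlog_weight i (upd t i y)) in dW cW.
have cw (y : R) : {for y, continuous w} by exact: (is_derive_continuous dW).
have w0 (y : R) : ~~ (0 < y < r) -> w y = 0.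
  move=> h; apply/eqP; apply: contraNT h => /weight_support/(_ i).
  by rewrite tnth_upd eqxx.
have E (y : R) : by_parts_integrand (upd t i y) = w y * (glue F1' F2' y + glue F1 F2 y * l y).
  by rewrite /by_parts_integrand tnth_upd eqxx.
have prod_derive (F F' : R -> R) (y : R) : is_derive y 1 F (F' y) ->
    is_derive y 1 (fun y => F y * w y) (F y * (w y * l y) + w y * F' y).
  by move=> dF; exact: is_deriveM.
have prod_cont (F F' : R -> R) (y : R) : is_derive y 1 F (F' y) -> {for y, continuous F'} ->
    {for y, continuous (fun y => F y * (w y * l y) + w y * F' y)}.
  move=> dF cF'; apply: continuousD; apply: continuousM => //; last exact: cW.
  apply/differentiable_continuous/derivable1_diffP.
  exact: (@ex_derive _ _ _ _ _ _ _ dF).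
apply: (@integral_two_pieces _ (fun y => by_parts_integrand (upd t i y))
   (fun y => F1 y * w y) (fun y => F1 y * (w y * l y) + w y * F1' y)
   (fun y => F2 y * w y) (fun y => F2 y * (w y * l y) + w y * F2' y) m r) => //.
- apply: (measurableT_comp measurable_by_parts).
  apply/measurable_fun_tnthP => j.
  rewrite (_ : _ \o _ = if j == i then id else cst (tnth t j)); last first.
    by apply/funext => y /=; rewrite tnth_upd; case: ifP.
  by case: ifP => _; [exact: measurable_id|exact: measurable_cst].
- by move=> y /dF1; exact: prod_derive.
- by move=> y ym; apply: prod_cont; [exact: dF1|exact: cF1].
- by move=> y /dF2; exact: prod_derive.
- by move=> y ym; apply: prod_cont; [exact: dF2|exact: cF2].
- by move=> y /andP[_ ym]; rewrite E /glue ym; ring.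
- by move=> y /andP[ym _]; rewrite E /glue leNgt ym/=; ring.
- move=> y h; rewrite E w0 ?mul0r//; apply: contra h => /andP[? ?].
  by rewrite !ltW.
- by rewrite w0 ?mulr0// ltxx.
- by rewrite F12.
- by rewrite w0 ?mulr0// ltxx andbF.
Qed.

End by_parts.

(** * The Gamma function and the zeros of Laguerre polynomials *)

Section gamma.
Context {R : realType}.
Local Notation mu := (@lebesgue_measure R).

Definition gammaint (z t : R) : R := t `^ (z - 1) * expR (- t).

(** The right end k + 2 keeps the interval nondegenerate at k = 0, where it is [1, 2]. *)
Definition cutitv (k : nat) : set R := [set` `[k.+1%:R^-1, k.+2%:R]].

Let lohi k : k.+1%:R^-1 < k.+2%:R :> R.
Proof.
apply: (@le_lt_trans _ _ 1); first by rewrite invf_le1 ?ler1n.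
by rewrite ltr1n.
Qed.

Lemma gammaint_ge0 (z t : R) : 0 <= gammaint z t.
Proof. by rewrite mulr_ge0 ?powR_ge0 ?expR_ge0. Qed.

(** The inequality u <= e^u at u = t / (2c), raised to the power 2c, gives t^(2c) <= (2c)^(2c)
    e^t. *)
Lemma gamma_tail (c t : R) : 0 < c -> 0 < t ->
  t `^ c * expR (- t) <= (2 * c) `^ (2 * c) * t `^ (- c).
Proof.
move=> c0 t0; rewrite powRN expRN.
have tc : 0 < t `^ c by rewrite powR_gt0.
rewrite ler_pdivlMr// mulrAC ler_pdivrMr ?expR_gt0//.
have -> : t `^ c * t `^ c = t `^ (2 * c).
  rewrite -powRD; last by rewrite (gt_eqF t0) implybT.
  by congr (_ `^ _); ring.
have -> : expR t = expR (t / (2 * c)) `^ (2 * c).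
  by rewrite -expRM divfK// gt_eqF//; lra.
rewrite -powRM ?expR_ge0//; last by lra.
apply: ge0_ler_powR; rewrite ?nnegrE; first by lra.
- exact: ltW.
- by rewrite mulr_ge0 ?expR_ge0//; lra.
have := expR_ge1Dx (t / (2 * c)) => h.
have : 2 * c * (1 + t / (2 * c)) <= 2 * c * expR (t / (2 * c)).
  by rewrite ler_wpM2l//; lra.
rewrite mulrDr mulr1 [2 * c * (t / _)]mulrC divfK; last by rewrite gt_eqF//; lra.
by lra.
Qed.

Lemma is_derive_powR_expR (z t : R) : 0 < t ->
  is_derive t 1 (fun t : R => t `^ z * expR (- t))
    (z * gammaint z t - gammaint (z + 1) t).
Proof.
move=> t0; have dp := is_derive1_powR z t0.
have dN : is_derive t 1 (fun t : R => expR (- t)) (expR (- t) * -1).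
  by apply: (@is_derive1_comp _ expR (fun t => - t)); exact: is_deriveN.
have -> : z * gammaint z t - gammaint (z + 1) t =
    t `^ z * (expR (- t) * -1) + expR (- t) * (z * t `^ (z - 1)).
  by rewrite /gammaint addrK; ring.
exact: is_deriveM.
Qed.

Lemma gammaint_continuous (z t : R) : 0 < t -> {for t, continuous (gammaint z)}.
Proof.
move=> t0; apply/differentiable_continuous/derivable1_diffP.
have := is_derive_powR_expR (z - 1) t0 => h.
exact: (@ex_derive _ _ _ _ _ _ _ h).
Qed.

Lemma gammaint_integrable z k : mu.-integrable (cutitv k) (EFin \o gammaint z).
Proof.
apply: continuous_compact_integrable; first exact: segment_compact.
apply: continuous_in_subspaceT => t; rewrite inE /cutitv/= in_itv/= => /andP[t0 _].
by apply: gammaint_continuous; exact: lt_le_trans t0.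
Qed.

Lemma cutitv_nondecreasing : nondecreasing_seq cutitv.
Proof.
move=> k l kl; apply/subsetPset => t; rewrite /cutitv/= !in_itv/=.
move=> /andP[h1 h2]; apply/andP; split.
  by apply: le_trans h1; rewrite lef_pV2 ?posrE// ler_nat.
by apply: (le_trans h2); rewrite ler_nat.
Qed.

Lemma bigcup_cutitv : \bigcup_k cutitv k = [set` `]0, +oo[] :> set R.
Proof.
apply/seteqP; split=> t /=.
  move=> [k _]; rewrite /cutitv/= !in_itv/= andbT => /andP[h _].
  exact: lt_le_trans h.
rewrite in_itv/= andbT => t0.
have [k1 hk1] : exists k, t <= k%:R.
  by exists (Num.bound t); rewrite ltW// archi_boundP// ltW.
have [k2 hk2] : exists k, t^-1 <= k%:R.
  by exists (Num.bound t^-1); rewrite ltW// archi_boundP// invr_ge0 ltW.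
exists (maxn k1 k2) => //; rewrite /cutitv/= in_itv/=; apply/andP; split.
  rewrite -[leRHS]invrK lef_pV2 ?posrE ?invr_gt0//.
  by apply: (le_trans hk2); rewrite ler_nat; lia.
by apply: (le_trans hk1); rewrite ler_nat; lia.
Qed.

Definition egamma z : \bar R := (\int[mu]_(t in `]0%R, +oo[) (gammaint z t)%:E)%E.

Lemma GammaE z : Gamma z = fine (egamma z).
Proof. by []. Qed.

Lemma measurable_gammaint z : measurable_fun setT (gammaint z).
Proof.
apply: measurable_funM; first exact: measurable_powR.
apply: measurableT_comp => //.
Qed.

Lemma cutitv_cvg z :
  (\int[mu]_(t in cutitv k) (gammaint z t)%:E @[k --> \oo] --> egamma z)%E.
Proof.
rewrite /egamma -bigcup_cutitv; apply: ge0_nondecreasing_set_cvg_integral.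
- exact: cutitv_nondecreasing.
- by move=> k; exact: measurable_itv.
- move=> k; apply/measurable_EFinP; apply: measurable_funTS.
  exact: measurable_gammaint.
- by move=> k t _; rewrite lee_fin gammaint_ge0.
Qed.

Lemma powR_continuous (c t : R) : 0 < t ->
  {for t, continuous (fun t : R => t `^ c)}.
Proof.
move=> t0; apply/differentiable_continuous/derivable1_diffP.
exact: (@ex_derive _ _ _ _ _ _ _ (is_derive1_powR c t0)).
Qed.

(** The majorant is a multiple of the derivative of -(1 + t^z)^(-1), so it controls the integral at
    0 and at infinity at once. The constant comes from (1 + u)^2 <= 2 (1 + u^2) with u = t^z, and
    [gamma_tail] for u^2 e^(-t). *)
Lemma gammaint_le (z t : R) : 0 < z -> 0 < t ->
  gammaint z t <= (4 + 2 * (4 * z) `^ (4 * z)) * (t `^ (z - 1) * (1 + t `^ z) ^- 2).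
Proof.
move=> z0 t0; rewrite /gammaint mulrCA ler_wpM2l ?powR_ge0//.
have tz : 0 < t `^ z by rewrite powR_gt0.
rewrite ler_pdivlMr; last by rewrite exprn_gt0//; lra.
have e1 : expR (- t) <= 1 by rewrite -expR0 ler_expR; lra.
have e0 : 0 < expR (- t) by exact: expR_gt0.
have C0 : 0 <= (4 * z) `^ (4 * z) by exact: powR_ge0.
suff : t `^ z * t `^ z * expR (- t) <= 1 + (4 * z) `^ (4 * z).
  set u := t `^ z in tz *; set C := _ `^ (4 * z) in C0 *; set e := expR _ in e1 e0 *.
  move=> h; have : 0 <= (1 - u) ^+ 2 * e by rewrite mulr_ge0 ?sqr_ge0 ?ltW.
  by nra.
have -> : t `^ z * t `^ z = t `^ (2 * z).
  rewrite -powRD; last by rewrite (gt_eqF t0) implybT.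
  by congr (_ `^ _); ring.
have [t1|t1] := leP t 1.
  apply: (@le_trans _ _ (1 * 1)); last by lra.
  apply: ler_pM; rewrite ?powR_ge0 ?(ltW e0)//.
  have E1 : (1 : R) `^ (2 * z) = 1 by rewrite powR1.
  rewrite -[leRHS]E1; apply: ge0_ler_powR; rewrite ?nnegrE ?(ltW t0)//.
  by lra.
have z20 : 0 < 2 * z by lra.
apply: (le_trans (gamma_tail z20 t0)).
have -> : 2 * (2 * z) = 4 * z by ring.
apply: (@le_trans _ _ ((4 * z) `^ (4 * z) * 1)); last by lra.
rewrite ler_wpM2l// powRN invf_le1 ?powR_gt0//.
have E1 : (1 : R) `^ (2 * z) = 1 by rewrite powR1.
rewrite -[leLHS]E1; apply: ge0_ler_powR; rewrite ?nnegrE ?(ltW t0)//.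
  exact: ltW.
exact: ltW.
Qed.

Lemma egamma_fin (z : R) : 0 < z -> (egamma z < +oo)%E.
Proof.
move=> z0; set C : R := 4 + 2 * (4 * z) `^ (4 * z).
have C0 : 0 < C by rewrite /C; have := powR_ge0 (4 * z) (4 * z); lra.
pose h (t : R) : R := C * (t `^ (z - 1) * (1 + t `^ z) ^- 2).
pose H (t : R) : R := - (C / z) * (1 + t `^ z)^-1.
have den0 (t : R) : 0 < 1 + t `^ z by have := powR_ge0 t z; lra.
have dH (t : R) : 0 < t -> is_derive t 1 H (h t).
  move=> t0; have dp := is_derive1_powR z t0.
  have d1 : is_derive t 1 (fun t : R => 1 + t `^ z) (z * t `^ (z - 1)).
    suff : is_derive t 1 (fun t : R => 1 + t `^ z) (0 + z * t `^ (z - 1)).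
      by rewrite add0r.
    exact: is_deriveD.
  have d2 : is_derive t 1 (fun t : R => (1 + t `^ z)^-1)
     (- (1 + t `^ z) ^- 2 *: (z * t `^ (z - 1))).
    by apply: is_deriveV; rewrite gt_eqF.
  have -> : h t = - (C / z) *: (- (1 + t `^ z) ^- 2 *: (z * t `^ (z - 1))).
    by rewrite /h /GRing.scale/=; field; rewrite !gt_eqF.
  exact: is_deriveZ.
have ch (t : R) : 0 < t -> {for t, continuous h}.
  move=> t0; rewrite /h.
  have -> : (fun t : R => C * (t `^ (z - 1) * (1 + t `^ z) ^- 2)) =
    cst C \* ((fun t => t `^ (z - 1)) \* ((fun t => (1 + t `^ z)^-1) \* (fun t => (1 + t `^ z)^-1))).
    by apply/funext => y /=; rewrite expr2 invfM.
  have cd : {for t, continuous (fun t : R => (1 + t `^ z)^-1)}.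
    apply: continuousV; first by rewrite gt_eqF.
    by apply: continuousD; [exact: cvg_cst|exact: powR_continuous].
  apply: continuousM; first exact: cvg_cst.
  by apply: continuousM; [exact: powR_continuous|exact: continuousM].
apply: (@le_lt_trans _ _ (C / z)%:E); last by rewrite ltry.
apply: (cvge_le _ (cutitv_cvg (z := z))) => //; near=> k.
have pos (t : R) : k.+1%:R^-1 <= t <= k.+2%:R -> 0 < t.
  by move=> /andP[h1 _]; exact: lt_le_trans h1.
apply: (@le_trans _ _ (\int[mu]_(t in cutitv k) (h t)%:E)%E).
  apply: ge0_le_integral => //.
  - exact: measurable_itv.
  - by move=> t _; rewrite lee_fin gammaint_ge0.
  - by apply/measurable_EFinP; apply: measurable_funTS; exact: measurable_gammaint.
  - apply: measurable_int (_ : mu.-integrable _ _).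
    apply: continuous_compact_integrable; first exact: segment_compact.
    by apply: continuous_in_subspaceT => t; rewrite inE /cutitv/= in_itv/= => /pos/ch.
  - move=> t; rewrite /cutitv/= in_itv/= => /pos t0.
    by rewrite lee_fin gammaint_le.
rewrite (integral_derive_itv (lohi k) (fun t h => dH t (pos t h)) (fun t h => ch t (pos t h))).
rewrite lee_fin /H.
have Cz : 0 < C / z by rewrite divr_gt0.
set u := (1 + _)^-1; set v := (1 + _)^-1.
have u0 : 0 <= u by rewrite invr_ge0 ltW.
have v1 : v <= 1 by rewrite invf_le1// lerDl powR_ge0.
by nra.
Unshelve. all: end_near. Qed.

Lemma egamma_ge0 z : (0 <= egamma z)%E.
Proof. by apply: integral_ge0 => t _; rewrite lee_fin gammaint_ge0. Qed.

Lemma egamma_gt0 (z : R) : 0 < z -> (0 < egamma z)%E.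
Proof.
move=> z0; apply: (@lt_le_trans _ _ (2^-1 * expR (-2))%:E).
  by rewrite lte_fin mulr_gt0 ?expR_gt0.
apply: (@le_trans _ _ (\int[mu]_(t in [set` `[1%R, 2%R]]) (2^-1 * expR (-2))%:E)%E).
  rewrite integral_cst//= lebesgue_measure_itv/= lte_fin ltr1n -EFinB -EFinM lee_fin.
  by rewrite (_ : 2 - 1 = 1) ?mulr1//; ring.
apply: (@le_trans _ _ (\int[mu]_(t in [set` `[1%R, 2%R]]) (gammaint z t)%:E)%E).
  apply: ge0_le_integral => //.
    by apply/measurable_EFinP; apply: measurable_funTS; exact: measurable_gammaint.
  move=> t; rewrite /= in_itv/= => /andP[t1 t2]; rewrite lee_fin.
  apply: ler_pM; rewrite ?expR_ge0//.
    apply: (@le_trans _ _ (t `^ (-1))).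
      by rewrite powR_inv1; [rewrite lef_pV2 ?posrE; lra|lra].
    by apply: ler_powR => //; lra.
  by rewrite ler_expR; lra.
apply: ge0_subset_integral => //.
- by apply/measurable_EFinP; apply: measurable_funTS; exact: measurable_gammaint.
- by move=> t _; rewrite lee_fin gammaint_ge0.
- move=> t; rewrite /= !in_itv/= andbT => /andP[t1 _].
  by apply: lt_le_trans t1.
Qed.

Lemma gamma_boundary_cvg (z : R) : 0 < z ->
  k.+2%:R `^ z * expR (- k.+2%:R) - k.+1%:R^-1 `^ z * expR (- k.+1%:R^-1)
    @[k --> \oo] --> (0 : R).
Proof.
move=> z0.
have inv_cvg : (k.+1%:R^-1 : R) `^ z @[k --> \oo] --> (0 : R).
  apply: ((cvg_at_rightP (fun t : R => t `^ z) 0 0).1 (powR_cvg0 z0) (@harmonic R)).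
  by split; [exact: harmonic_gt0|exact: cvg_harmonic].
set C := (2 * z) `^ (2 * z).
have C0 : 0 <= C by exact: powR_ge0.
apply/cvgr0Pnorm_le => e e0.
have C10 : 0 < C + 1 by lra.
have eC : 0 < e / (C + 1) by rewrite divr_gt0.
have /cvgr0Pnorm_le/(_ _ eC) := inv_cvg.
apply: filterS => k; rewrite ger0_norm ?powR_ge0// ler_pdivlMr// => h.
set u : R := k.+1%:R^-1 `^ z in h *.
have u0 : 0 <= u by exact: powR_ge0.
have b1 : k.+2%:R `^ z * expR (- k.+2%:R) <= C * u.
  apply: (le_trans (gamma_tail z0 _)) => //; rewrite ler_wpM2l//.
  rewrite /u -[in leRHS]powR_inv1// -powRrM mulN1r.
  rewrite !powRN lef_pV2 ?posrE ?powR_gt0//.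
  by apply: ge0_ler_powR; rewrite ?nnegrE ?ler_nat// ltW.
have b10 : 0 <= k.+2%:R `^ z * expR (- k.+2%:R) by rewrite mulr_ge0 ?powR_ge0 ?expR_ge0.
have b2 : u * expR (- k.+1%:R^-1) <= u.
  by rewrite ler_piMr// -expR0 ler_expR oppr_le0.
have b20 : 0 <= u * expR (- k.+1%:R^-1) by rewrite mulr_ge0 ?expR_ge0.
by rewrite ler_norml; apply/andP; split; nra.
Qed.

(** Integration by parts on the compact intervals [cutitv k], whose boundary terms vanish in the
    limit. *)
Lemma egammaS (z : R) : 0 < z -> egamma (z + 1) = (z%:E * egamma z)%E.
Proof.
move=> z0.
pose b (k : nat) : R := k.+2%:R `^ z * expR (- k.+2%:R) - k.+1%:R^-1 `^ z * expR (- k.+1%:R^-1).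
have zfin : egamma z \is a fin_num by rewrite ge0_fin_numE ?egamma_ge0// egamma_fin.
have E k : (\int[mu]_(t in cutitv k) (gammaint (z + 1) t)%:E =
    z%:E * \int[mu]_(t in cutitv k) (gammaint z t)%:E - (b k)%:E)%E.
  have iz := gammaint_integrable z k; have iz1 := gammaint_integrable (z + 1) k.
  have pos (t : R) : k.+1%:R^-1 <= t <= k.+2%:R -> 0 < t.
    by move=> /andP[h1 _]; exact: lt_le_trans h1.
  have : (\int[mu]_(t in cutitv k) (z * gammaint z t - gammaint (z + 1) t)%:E = (b k)%:E)%E.
    pose dF (t : R) h := is_derive_powR_expR z (pos t h).
    rewrite (integral_derive_itv (lohi k) dF)// => t /pos t0.
    apply: continuousB; last exact: gammaint_continuous.
    by apply: (@continuousM _ _ (cst z)); [exact: cvg_cst|exact: gammaint_continuous].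
  under eq_integral do rewrite EFinB EFinM.
  have mc : measurable (cutitv k) by exact: measurable_itv.
  rewrite integralB//; last by apply: (integrableZl _ _ iz); exact: measurable_itv.
  rewrite integralZl//.
  have f1 : (\int[mu]_(t in cutitv k) (gammaint z t)%:E)%E \is a fin_num.
    by apply: (integrable_fin_num _ iz); exact: measurable_itv.
  have f2 : (\int[mu]_(t in cutitv k) (gammaint (z + 1) t)%:E)%E \is a fin_num.
    by apply: (integrable_fin_num _ iz1); exact: measurable_itv.
  move: f1 f2; rewrite /cutitv/=.
  set I0 := integral _ _ _; set I1 := integral _ _ _.
  case: I0 => // u _; case: I1 => // v _.
  by rewrite -!EFinM -!EFinB => -[<-]; congr EFin; ring.
have c1 := cutitv_cvg (z := z + 1).
have c2 : (\int[mu]_(t in cutitv k) (gammaint (z + 1) t)%:E @[k --> \oo] -->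
    z%:E * egamma z - 0%:E)%E.
  under eq_cvg do rewrite E.
  apply: cvgeB.
  - by rewrite fin_num_adde_defl.
  - apply: cvgeZl => //; exact: cutitv_cvg.
  - apply: cvg_EFin; first by near=> k.
    exact: gamma_boundary_cvg.
rewrite sube0 in c2.
exact: cvg_unique c1 c2.
Unshelve. all: end_near. Qed.

Lemma Gamma_gt0 (z : R) : 0 < z -> 0 < Gamma z.
Proof. by move=> z0; rewrite GammaE fine_gt0// egamma_gt0// egamma_fin. Qed.

Lemma GammaS (z : R) : 0 < z -> Gamma (z + 1) = z * Gamma z.
Proof.
move=> z0; rewrite !GammaE egammaS// fineM//.
by rewrite ge0_fin_numE ?egamma_ge0// egamma_fin.
Qed.

End gamma.

(** * Laguerre polynomials: differential equation, Stieltjes relations, size of the zeros *)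

Section laguerre_roots.
Context {R : realType}.
Variables (n : nat) (p : R).
Hypothesis p1 : -1 < p.

Definition laguerre_coef (i : nat) : R :=
  Gamma (n%:R + p + 1) / (Gamma (n%:R - i%:R + 1) * Gamma (p + i%:R + 1))
      / i`!%:R.

Lemma laguerre_coef_gt0 i : (i <= n)%N -> 0 < laguerre_coef i.
Proof.
move=> lin; rewrite /laguerre_coef divr_gt0 ?ltr0n ?fact_gt0//.
have n0 : 0 <= n%:R :> R by [].
have i0 : 0 <= i%:R :> R by [].
have : i%:R <= n%:R :> R by rewrite ler_nat.
move=> h; have p1' := p1.
have a0 : 0 < n%:R + p + 1 by lra.
have b0 : 0 < n%:R - i%:R + 1 :> R by lra.
have c0 : 0 < p + i%:R + 1 by lra.
by rewrite divr_gt0 ?mulr_gt0 ?Gamma_gt0.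
Qed.

Lemma laguerre_coefS i : (i < n)%N ->
  i.+1%:R * (p + 1 + i%:R) * laguerre_coef i.+1 = (n%:R - i%:R) * laguerre_coef i.
Proof.
move=> lin; rewrite /laguerre_coef.
have i0 : 0 <= i%:R :> R by [].
have hin : i%:R + 1 <= n%:R :> R by rewrite natr1 ler_nat.
have d0 : 0 < n%:R - i%:R :> R by lra.
have e0 : 0 < p + i%:R + 1 by have := p1; lra.
have f0 : i`!%:R != 0 :> R by rewrite pnatr_eq0 -lt0n fact_gt0.
have k0 : i.+1%:R != 0 :> R by rewrite pnatr_eq0.
have E0 : p + 1 + i%:R = p + i%:R + 1 by ring.
have Ed : n%:R - i.+1%:R + 1 = n%:R - i%:R :> R by rewrite -natr1; ring.
have Ee : p + i.+1%:R + 1 = (p + i%:R + 1) + 1 by rewrite -natr1; ring.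
rewrite E0 Ed Ee factS natrM (GammaS d0) (GammaS e0).
have := Gamma_gt0 d0; have := Gamma_gt0 e0.
move: (Gamma (n%:R + p + 1)) (Gamma (n%:R - i%:R)) (Gamma (p + i%:R + 1)).
move: (i.+1%:R : R) (n%:R - i%:R) (p + i%:R + 1) (i`!%:R : R) k0 d0 e0 f0.
move=> k d e f k0 d0 e0 f0 X g1 g2 g20 g10.
by field; rewrite k0 f0 !gt_eqF.
Qed.

Lemma coef_laguerre_poly i :
  (laguerre_poly n p)`_i = if (i <= n)%N then (-1) ^+ i * laguerre_coef i else 0.
Proof.
rewrite /laguerre_poly.
have -> : \sum_(j < n.+1) (Gamma (n%:R + p + 1) /
      (Gamma (n%:R - j%:R + 1) * Gamma (p + j%:R + 1)) / j`!%:R) *: (- 'X) ^+ j =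
  \poly_(j < n.+1) ((-1) ^+ j * laguerre_coef j).
  rewrite poly_def; apply: eq_bigr => j _.
  by rewrite -/(laguerre_coef j) -scaleN1r exprZn scalerA mulrC.
by rewrite coef_poly ltnS.
Qed.

Lemma size_laguerre_poly : size (laguerre_poly n p) = n.+1.
Proof.
apply/eqP; rewrite eqn_leq; apply/andP; split.
  by apply/leq_sizeP => j nj; rewrite coef_laguerre_poly leqNgt nj.
rewrite ltnNge; apply/negP => /leq_sizeP/(_ n (leqnn n))/eqP.
rewrite coef_laguerre_poly leqnn mulf_eq0 signr_eq0/=.
by rewrite gt_eqF ?laguerre_coef_gt0.
Qed.

Lemma laguerre_ode :
  'X * (laguerre_poly n p)^`()^`() + ((p + 1)%:P - 'X) * (laguerre_poly n p)^`()
    + n%:R *: laguerre_poly n p = 0.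
Proof.
set L := laguerre_poly n p.
have rec i : i.+1%:R * (p + 1 + i%:R) * L`_i.+1 + (n%:R - i%:R) * L`_i = 0.
  rewrite /L !coef_laguerre_poly.
  have [ltin|] := ltnP i n.
    rewrite (ltnW ltin) mulrCA laguerre_coefS// exprS mulN1r; ring.
  rewrite leq_eqVlt => /predU1P[<-|ni]; first by rewrite leqnn subrr mul0r mulr0 addr0.
  by rewrite leqNgt ni/= !mulr0 addr0.
apply/polyP => i; rewrite coef0 !coefD coefZ mulrBl coefB coefCM coefXM.
rewrite -[RHS](rec i).
rewrite coefXM; case: i => [|i] /=.
  by rewrite coef_deriv; ring.
have E1 : i.+1%:R = i%:R + 1 :> R by rewrite natr1.
have E2 : i.+2%:R = i%:R + 1 + 1 :> R by rewrite !natr1.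
rewrite !coef_deriv -(mulr_natl L`_i.+2) -(mulr_natl L`_i.+1) -(mulr_natl (_ * _)) E1 E2.
move: (L`_i.+2) (L`_i.+1) (i%:R : R) => u v k.
by ring.
Qed.

Lemma laguerre_root_gt0 y : root (laguerre_poly n p) y -> 0 < y.
Proof.
move=> /rootP ry; rewrite ltNge; apply/negP => y0.
have : 0 < (laguerre_poly n p).[y].
  rewrite /laguerre_poly horner_sum big_ord_recl ltr_pwDl//.
    rewrite expr0 hornerZ hornerC mulr1.
    exact: (@laguerre_coef_gt0 0).
  apply: sumr_ge0 => i _; rewrite hornerZ horner_exp hornerN hornerX.
  rewrite mulr_ge0 ?exprn_ge0 ?oppr_ge0//.
  by apply: ltW; apply: laguerre_coef_gt0; rewrite -ltnS.
by rewrite ry ltxx.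
Qed.

(** Concavity of log |P| between the roots, in polynomial form: one more root z multiplies P'^2 - P
    P'' by (y - z)^2 and adds P^2. *)
Lemma laguerre_inequality (s : seq R) y :
  let P := \prod_(z <- s) ('X - z%:P) in
  P.[y] * P^`()^`().[y] <= P^`().[y] ^+ 2.
Proof.
elim: s => [|z s /= ih].
  have d1 : (1 : {poly R})^`() = 0 by rewrite -polyC1 derivC.
  by rewrite /= big_nil d1 deriv0 !horner0 mulr0 expr0n.
rewrite big_cons; set P := \prod_(_ <- _) _ in ih *.
rewrite derivM derivXsubC mul1r derivD derivM derivXsubC mul1r !hornerE/=.
rewrite -subr_ge0 in ih; have := mulr_ge0 (sqr_ge0 (y - z)) ih.
have := sqr_ge0 P.[y].
by nra.
Qed.

Variable y : 'I_n -> R.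
Hypothesis y_inj : injective y.
Hypothesis y_root : forall i, root (laguerre_poly n p) (y i).

Let others (i : 'I_n) := [seq y j | j <- rem i (enum 'I_n)].

Let P (i : 'I_n) : {poly R} := \prod_(z <- others i) ('X - z%:P).

Lemma laguerre_factor i : exists2 k : R, k != 0 &
  laguerre_poly n p = k *: (('X - (y i)%:P) * P i).
Proof.
exists (lead_coef (laguerre_poly n p)).
  by rewrite lead_coef_eq0 -size_poly_eq0 size_laguerre_poly.
have -> : ('X - (y i)%:P) * P i = \prod_(z <- y i :: others i) ('X - z%:P).
  by rewrite big_cons.
have pe : perm_eq (y i :: others i) [seq y j | j <- enum 'I_n].
  rewrite perm_sym; apply: (perm_trans (perm_map y (perm_to_rem (mem_enum _ i)))).
  by rewrite /others /=.
apply: all_roots_prod_XsubC.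
- by rewrite (perm_size pe) size_map size_enum_ord size_laguerre_poly.
- by rewrite (perm_all _ pe); apply/allP => z /mapP[j _ ->].
- by rewrite uniq_rootsE (perm_uniq pe) map_inj_uniq ?enum_uniq.
Qed.

Lemma horner_others_neq0 i : (P i).[y i] != 0.
Proof.
rewrite /P horner_prod prodf_seq_neq0; apply/allP => z /mapP[j].
rewrite mem_rem_uniq ?enum_uniq// inE => /andP[ji _] -> /=.
by rewrite !hornerE subr_eq0 (inj_eq y_inj) eq_sym.
Qed.

Lemma sum_inv_others i :
  (P i)^`().[y i] / (P i).[y i] = \sum_(j | j != i) (y i - y j)^-1.
Proof.
have general (s : seq R) : (forall z, z \in s -> y i != z) ->
    (\prod_(z <- s) ('X - z%:P))^`().[y i] =
    (\prod_(z <- s) ('X - z%:P)).[y i] * \sum_(z <- s) (y i - z)^-1.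
  elim: s => [_|z s ih h].
    rewrite !big_nil (_ : (1 : {poly R})^`() = 0) ?horner0 ?mulr0//.
    by rewrite -polyC1 derivC.
  rewrite !big_cons derivM derivXsubC mul1r !hornerE/= ih; last first.
    by move=> w ws; apply: h; rewrite inE ws orbT.
  have : y i - z != 0 by rewrite subr_eq0 h// mem_head.
  move: (_.[y i]) (\sum_(_ <- _) _) (y i - z) => u v w w0.
  by field.
rewrite /P general; last first.
  move=> z /mapP[j]; rewrite mem_rem_uniq ?enum_uniq// inE => /andP[ji _] ->.
  by rewrite (inj_eq y_inj) eq_sym.
rewrite mulrC mulKf ?horner_others_neq0// big_map.
rewrite (rem_filter _ (enum_uniq _)) big_filter.
by rewrite big_enum_cond; apply: eq_bigl => j; rewrite !inE.
Qed.

(** Writing L = k (X - y_i) P, one has L' = k P and L'' = 2 k P' at y_i, so the differential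
    equation there determines P' / P, the sum of the inverse differences. *)
Lemma laguerre_stieltjes i :
  2 * y i * (\sum_(j | j != i) (y i - y j)^-1) = y i - (p + 1).
Proof.
have [k k0 E] := laguerre_factor i.
have := congr1 (fun q : {poly R} => q.[y i]) laguerre_ode.
rewrite E !derivZ derivM derivXsubC mul1r derivD derivM derivXsubC mul1r.
rewrite !hornerE/=.
rewrite -sum_inv_others.
have := horner_others_neq0 i; move: (P i).[y i] (P i)^`().[y i] => u v u0 h.
apply: (mulfI (mulf_neq0 k0 u0)); apply/eqP; rewrite -subr_eq0; apply/eqP.
by rewrite -h; field.
Qed.

(** The differentiated equation at y_i expresses P'' by P' and P. Laguerre's inequality for P bounds
    P P'' by P'^2, and the Stieltjes relation replaces P' by a multiple of P; dividing by P^2 leaves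
    a quadratic inequality in y_i. *)
Lemma laguerre_root_bound i :
  (y i - (p + 1)) ^+ 2 - 4 * (y i - (p + 1)) <= 4 * y i * (n%:R - 1).
Proof.
have [k k0 E] := laguerre_factor i.
have yi0 := laguerre_root_gt0 (y_root i).
have L := laguerre_inequality (others i) (y i); rewrite -/(P i) /= in L.
have S := laguerre_stieltjes i; rewrite -sum_inv_others in S.
have := congr1 (fun q : {poly R} => q^`().[y i]) laguerre_ode.
rewrite E !(derivD, derivM, derivZ, derivB, derivN, derivX, derivC, oppr0, derivXsubC, mul1r, deriv0) !hornerE/=.
have := horner_others_neq0 i.
move: (P i).[y i] (P i)^`().[y i] (P i)^`()^`().[y i] S L => a b c S L a0 h.
have {}h : 3 * y i * c + 2 * (p + 2 - y i) * b + (n%:R - 1) * a = 0.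
  apply: (mulfI k0); rewrite mulr0 -[RHS]h. by ring.
have Sb : 2 * y i * b = (y i - (p + 1)) * a by rewrite -S; field.
set u := y i - (p + 1) in Sb *.
have a2 : 0 < a ^+ 2 by rewrite exprn_even_gt0.
have yu : p + 2 - y i = 1 - u by rewrite /u; ring.
rewrite yu in h.
have h2 : 0 <= 3 * y i * b ^+ 2 + 2 * (1 - u) * (a * b) + (n%:R - 1) * a ^+ 2.
  have -> : 3 * y i * b ^+ 2 + 2 * (1 - u) * (a * b) + (n%:R - 1) * a ^+ 2 =
    3 * y i * (b ^+ 2 - a * c) + a * (3 * y i * c + 2 * (1 - u) * b + (n%:R - 1) * a).
    by ring.
  by rewrite h mulr0 addr0 mulr_ge0 ?subr_ge0// mulr_ge0// ltW.
have h3 : 0 <= (4 * y i * (n%:R - 1) - (u ^+ 2 - 4 * u)) * a ^+ 2.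
  have := mulr_ge0 (ltW yi0) h2.
  have -> : (4 * y i * (n%:R - 1) - (u ^+ 2 - 4 * u)) * a ^+ 2 =
     3 * (u * a) ^+ 2 + 4 * (1 - u) * a * (u * a) + 4 * y i * (n%:R - 1) * a ^+ 2 by ring.
  by rewrite -Sb; lra.
by rewrite -subr_ge0 -(pmulr_lge0 _ a2).
Qed.

End laguerre_roots.

(** Used with k = n - 1 and N = 2 alpha / beta, so that p + 1 = N - k; after rescaling by beta, 16 N
    becomes 32 alpha. *)
Lemma quadratic_bound (R : realFieldType) (k N y : R) : 1 <= k -> k < N ->
  (y - (N - k)) ^+ 2 - 4 * (y - (N - k)) <= 4 * y * k -> y <= 16 * N.
Proof.
move=> k1 kN; rewrite leNgt => h; apply/negP => yN; move: h.
set u := y - (N - k) => h.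
have u1 : 15 / 16 * y <= u by rewrite /u; lra.
have u2 : 11 / 16 * y <= u - 4 by rewrite /u; lra.
have y0 : 0 < y by lra.
have : (15 / 16 * y) * (11 / 16 * y) <= u * (u - 4) by apply: ler_pM => //; lra.
have : y * k <= y * (y / 16) by rewrite ler_wpM2l//; lra.
have : 0 < y * y by rewrite mulr_gt0.
by rewrite expr2 in h; lra.
Qed.

(** * The zeros in the scale of the ensemble *)

Section ensemble_nodes.
Context {R : realType}.
Variables (n : nat) (beta alpha : R) (x : 'I_n -> R).
Hypotheses (n1 : (1 <= n)%N) (beta0 : 0 < beta).
Hypothesis alphan : (n%:R - 1) * beta / 2 < alpha.
Hypothesis x_inj : injective x.
Hypothesis x_root : forall i,
  root (laguerre_poly n (2 * alpha / beta - n%:R) \Po (beta^-1 *: 'X)) (x i).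

Let N := 2 * alpha / beta.

Let Nn : n%:R - 1 < N.
Proof. by rewrite /N ltr_pdivlMr//; have := alphan; lra. Qed.

Let p1 : -1 < N - n%:R. Proof. by have := Nn; lra. Qed.

Let y i := x i / beta.

Let y_inj : injective y.
Proof. by move=> i j /(mulIf _) h; apply/x_inj/h; rewrite invr_eq0 gt_eqF. Qed.

Let y_root i : root (laguerre_poly n (N - n%:R)) (y i).
Proof.
have := x_root i; rewrite /root horner_comp hornerZ hornerX.
by rewrite [beta^-1 * _]mulrC.
Qed.

Let xE i : x i = beta * y i.
Proof. by rewrite /y mulrC divfK// gt_eqF. Qed.

Lemma node_gt0 i : 0 < x i.
Proof. by rewrite xE mulr_gt0//; exact: laguerre_root_gt0 p1 _ (y_root i). Qed.

Lemma node_stieltjes i : beta * (\sum_(j | j != i) (x i - x j)^-1) +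
  (alpha - (n%:R - 1) * beta / 2) / x i - 2^-1 = 0.
Proof.
have yi0 : 0 < y i by exact: laguerre_root_gt0 p1 _ (y_root i).
have S := laguerre_stieltjes p1 y_inj y_root i.
have -> : beta * (\sum_(j | j != i) (x i - x j)^-1) = \sum_(j | j != i) (y i - y j)^-1.
  rewrite mulr_sumr; apply: eq_bigr => j _.
  by rewrite !xE -mulrBr invfM mulrA divff ?mul1r// gt_eqF.
have b0 : beta != 0 by rewrite gt_eqF.
have y0 : y i != 0 by rewrite gt_eqF.
move: S; set s := \sum_(_ | _) _ => S.
apply: (mulfI (_ : 2 * y i != 0)); first by rewrite mulf_neq0.
rewrite xE mulr0 !mulrDr S /N; field.
by rewrite b0 y0.
Qed.

Lemma node_le i : x i <= 32 * alpha.
Proof.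
have yi0 : 0 < y i by exact: laguerre_root_gt0 p1 _ (y_root i).
have B := laguerre_root_bound p1 y_inj y_root i.
suff h : y i <= 16 * N.
  rewrite xE; apply: (le_trans (ler_wpM2l (ltW beta0) h)).
  rewrite /N (_ : beta * _ = 32 * alpha)//; field.
  by rewrite gt_eqF.
have [n2|] := ltnP 1 n.
  apply: (quadratic_bound (k := n%:R - 1)) => //.
    by rewrite lerBrDr (_ : 1 + 1 = 2%:R)// ler_nat.
  by rewrite (_ : N - (n%:R - 1) = N - n%:R + 1)//; ring.
(* For n = 1 the Stieltjes sum is empty and the zero is p + 1 = N. *)
rewrite leq_eqVlt ltnS leqn0 => /orP[/eqP n1E|]; last by rewrite eqn0Ngt n1.
have := laguerre_stieltjes p1 y_inj y_root i.
rewrite big1; last first.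
  move=> j; rewrite -val_eqE/=.
  have : (j < 1)%N by rewrite -n1E.
  have : (i < 1)%N by rewrite -n1E.
  by rewrite !ltnS !leqn0 => /eqP -> /eqP ->.
rewrite mulr0 n1E (_ : 1%:R = 1)// => h.
have := Nn; rewrite n1E (_ : 1%:R = 1)//; lra.
Qed.
End ensemble_nodes.

(** * The virial inequality *)

Section cutoff_density.
Context {R : realType}.
Local Notation RT := (measurableTypeR R).
Variables (beta a : R).
Hypotheses (beta0 : 0 < beta) (a1 : -1 < a).

Definition density1 (y : R) : R := if 0 < y then y `^ a * expR (- y / 2) else 0.
(** Evaluated at t_j - t_i with i < j. The cut at z = 0 carries the ordering constraint, so the
    ordered density is a plain product. *)
Definition density2 (z : R) : R := if 0 < z then z `^ beta else 0.

Lemma density1_ge0 y : 0 <= density1 y.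
Proof. by rewrite /density1; case: ifP => // _; rewrite mulr_ge0 ?powR_ge0 ?expR_ge0. Qed.

Lemma density2_ge0 z : 0 <= density2 z.
Proof. by rewrite /density2; case: ifP => // _; exact: powR_ge0. Qed.

Lemma measurable_density1 : measurable_fun setT density1.
Proof.
apply: measurable_fun_ifT => //.
- by apply: measurable_fun_ltr => //; exact: measurable_cst.
- apply: measurable_funM; first exact: measurable_powR.
  apply: measurableT_comp => //; apply: measurable_funM => //.
Qed.

Lemma measurable_density2 : measurable_fun setT density2.
Proof.
apply: measurable_fun_ifT => //.
by apply: measurable_fun_ltr => //; exact: measurable_cst.
Qed.

Variables (dl r : R).
Hypothesis dl0 : 0 < dl.

(** The last factor is the same cutoff reflected at r, with exponent 0 and width 1: it equals 1 up
    to r - 1 and 0 from r on. *)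
Definition cut1 (y : R) : R := zeta dl a y * (expR (- y / 2) * zeta 1 0 (r - y)).
Definition dlog_cut1 (y : R) : R := lzeta dl a y + (- 2^-1 + - lzeta 1 0 (r - y)).

Lemma C1log_cut1 : C1log cut1 dlog_cut1.
Proof.
apply: C1log_mul; first exact: C1log_zeta.
apply: C1log_mul.
  have de (y : R) : is_derive y 1 (fun y => expR (- y / 2)) (expR (- y / 2) * - 2^-1).
    apply: (@is_derive1_comp _ expR (fun y => - y / 2)).
    suff : is_derive y 1 (fun y : R => - y / 2) (- y *: (0 : R) + 2^-1 *: (-1 : R)).
      by rewrite /GRing.scale/= mulr0 add0r mulrN1.
    by apply: is_deriveM; exact: is_deriveN.
  split=> //.
  have ce : continuous (fun y : R => expR (- y / 2)) by exact: is_derive_continuous de.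
  move=> y; apply: (@continuousM _ _ (fun y : R => expR (- y / 2)) (cst (- 2^-1))).
    exact: ce.
  exact: cvg_cst.
have -> : (fun y => zeta 1 0 (r - y)) = (fun y => zeta 1 0 (r + -1 * y)).
  by apply/funext => y; rewrite mulN1r.
have -> : (fun y => - lzeta 1 0 (r - y)) = (fun y => -1 * lzeta 1 0 (r + -1 * y)).
  by apply/funext => y; rewrite !mulN1r.
by apply: C1log_affine; apply: C1log_zeta => //; lra.
Qed.

Lemma cut1_support y : ~~ (0 < y < r) -> cut1 y = 0.
Proof.
rewrite negb_and -!leNgt => /orP[y0|yr]; first by rewrite /cut1 zeta_le0E// mul0r.
by rewrite /cut1 (@zeta_le0E _ 1 0 (r - y)) ?mulr0 ?subr_le0//; lra.
Qed.

Lemma cut1_ge0 y : 0 <= cut1 y.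
Proof.
apply: mulr_ge0; first exact: zeta_ge0.
by apply: mulr_ge0; [exact: expR_ge0|apply: zeta_ge0].
Qed.

Lemma zeta10_le1 z : zeta 1 0 z <= 1 :> R.
Proof.
have [z0|z0] := leP z 0; first by rewrite zeta_le0E//; lra.
by apply: le_trans (zeta_le 0 _ z0) _; rewrite ?powRr0.
Qed.

Lemma cut1_le y : cut1 y <= density1 y.
Proof.
rewrite /density1; case: ltP => y0; last first.
  by rewrite cut1_support// negb_and -leNgt y0.
apply: ler_pM; rewrite ?zeta_ge0//; first by apply: mulr_ge0; [exact: expR_ge0|apply: zeta_ge0].
  exact: zeta_le.
by rewrite ler_piMr ?expR_ge0// zeta10_le1.
Qed.

Lemma cut1_eq y : dl <= y <= r - 1 -> cut1 y = density1 y.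
Proof.
move=> /andP[dly yr]; rewrite /density1 (lt_le_trans dl0 dly) /cut1 zeta_far//.
by rewrite (@zeta_far _ 1 0 (r - y)) ?powRr0 ?mulr1//; lra.
Qed.

Lemma zeta_le_density2 z : zeta dl beta z <= density2 z.
Proof.
rewrite /density2; case: ltP => z0; first exact: zeta_le.
by rewrite zeta_le0E//; have := beta0; lra.
Qed.

Lemma zeta_eq_density2 z : dl <= z -> zeta dl beta z = density2 z.
Proof. by move=> dlz; rewrite /density2 (lt_le_trans dl0 dlz) zeta_far. Qed.

Variable n : nat.
Implicit Type t : n.-tuple RT.

Definition cut_weight t := weight cut1 (zeta dl beta) t.
Definition base_weight t := weight density1 density2 t.

Lemma cut_weight_ge0 t : 0 <= cut_weight t.
Proof.
apply: prodr_ge0 => q _; rewrite /factor; case: ifP => _; first exact: zeta_ge0.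
by case: ifP => _; [exact: cut1_ge0|].
Qed.

Lemma cut_weight_le t : cut_weight t <= base_weight t.
Proof.
apply: ler_prod => q _; rewrite /factor; case: ifP => _.
  by rewrite zeta_ge0//= zeta_le_density2.
by case: ifP => _; [rewrite cut1_ge0 cut1_le|rewrite ler01 lexx].
Qed.

Definition separated : set (n.-tuple RT) :=
  [set t | (forall i, dl <= tnth t i <= r - 1) /\
           forall i j : 'I_n, (i < j)%N -> dl <= tnth t j - tnth t i].

Lemma cut_weight_eq t : separated t -> cut_weight t = base_weight t.
Proof.
move=> [ti tij]; apply: eq_bigr => q _; rewrite /factor.
case: ifP => [/tij|_]; first exact: zeta_eq_density2.
by case: ifP => _ //; exact: cut1_eq.
Qed.

Lemma cut_weight_neq0 t : cut_weight t != 0 ->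
  (forall i, 0 < tnth t i < r) /\
  (forall i j : 'I_n, (i < j)%N -> tnth t i < tnth t j).
Proof.
move=> W0; split=> [i|i j ij]; first exact: weight_support cut1_support _ W0 i.
rewrite ltNge; apply: contra W0 => h.
by rewrite /cut_weight /weight (bigD1 (i, j))//= /factor/= ij zeta_le0E ?mul0r ?subr_le0//; have := beta0; lra.
Qed.

End cutoff_density.

(** * The pointwise comparison of the fields with their counterparts at the zeros *)

Section virial.
Context {R : realType}.
Local Notation RT := (measurableTypeR R).
Variables (n : nat) (beta a : R) (x : 'I_n -> R).
Hypotheses (beta0 : 0 < beta) (a1 : -1 < a).
Hypothesis x_incr : forall i j : 'I_n, (i < j)%N -> x i < x j.
Hypothesis x_eq : forall i,
  beta * (\sum_(j | j != i) (x i - x j)^-1) + (a + 1) / x i - 2^-1 = 0.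

(** Splitting the numerators and swapping the indices in one half brings the sum over pairs to the
    form in which the Stieltjes relations can be inserted. *)
Lemma sum_pair_quotients (g : 'I_n -> R) :
  \sum_(q : 'I_n * 'I_n | (q.1 < q.2)%N) (g q.2 - g q.1) / (x q.2 - x q.1) =
  \sum_i g i * \sum_(j | j != i) (x i - x j)^-1.
Proof.
transitivity (\sum_(q : 'I_n * 'I_n | (q.1 < q.2)%N) g q.2 / (x q.2 - x q.1) +
  \sum_(q : 'I_n * 'I_n | (q.1 < q.2)%N) g q.1 / (x q.1 - x q.2)).
  rewrite -big_split/=; apply: eq_bigr => q _.
  by rewrite mulrBl -[x q.1 - _]opprB invrN mulrN.
have swapK : involutive (fun q : 'I_n * 'I_n => (q.2, q.1)) by case.
rewrite [X in X + _](reindex_inj (inv_inj swapK))/=.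
under [RHS]eq_bigr do rewrite mulr_sumr.
rewrite pair_big_dep/= [RHS](bigID (fun q : 'I_n * 'I_n => (q.2 < q.1)%N))/=.
congr (_ + _); apply: eq_bigl => -[i j] /=.
  by rewrite -val_eqE/=; lia.
by rewrite -val_eqE/=; lia.
Qed.

Variables (r dl : R).
Hypothesis dl0 : 0 < dl.
(* [F i] is the field acting on the point [t_i]; [G i] is its counterpart at the
   zero [x_i], against which the Stieltjes relation is summed. *)
Variables (F F' G Q : 'I_n -> R -> R) (MG : R).
Hypothesis potential : forall i y, 0 < y < r ->
  F' i y + F i y * dlog_cut1 a dl r y - G i y * ((a + 1) / x i - 2^-1) <= - Q i y.
Hypothesis repulsion : forall (i j : 'I_n) yi yj, (i < j)%N ->
  0 < yi -> yi < yj -> yj < r ->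
  (F j yj - F i yi) / (yj - yi) <= (G j yj - G i yi) / (x j - x i).
Hypothesis G_bounded : forall i y, 0 < y < r -> `|G i y| <= MG.

Definition close_pair : set (n.-tuple RT) :=
  [set t | exists i j : 'I_n, (i < j)%N && (tnth t j - tnth t i < dl)].

(** The 8 is 4 times 2: the cutoff excess is at most 4, and a difference of two values of G is at
    most 2 MG. The total does not depend on dl. *)
Definition close_cost : R :=
  \sum_(q : 'I_n * 'I_n | (q.1 < q.2)%N) 8 * MG / (x q.2 - x q.1).

(** The logarithmic derivative of a pair factor is (beta + excess) / gap, with excess >= 0, so
    [repulsion] bounds the interaction by quotients of G at the zeros. Their part in beta equals the
    one-body expression that [potential] subtracts; their part in the excess is nonzero only for
    gaps below dl. *)
Lemma virial_pointwise t : cut_weight beta a dl r t != 0 ->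
  \sum_i (F' i (tnth t i) +
    F i (tnth t i) * dlog_weight (dlog_cut1 a dl r) (lzeta dl beta) i t) <=
  - (\sum_i Q i (tnth t i)) + close_cost * \1_close_pair t.
Proof.
move=> /cut_weight_neq0[]// tr tinc.
pose Gt i := G i (tnth t i); pose Ft i := F i (tnth t i).
have FL : \sum_i Ft i * dlog_weight (dlog_cut1 a dl r) (lzeta dl beta) i t =
   \sum_i Ft i * dlog_cut1 a dl r (tnth t i) +
   \sum_(q : 'I_n * 'I_n | (q.1 < q.2)%N)
      lzeta dl beta (tnth t q.2 - tnth t q.1) * (Ft q.2 - Ft q.1).
  have delta (f : 'I_n -> R) k : \sum_i f i * (k == i)%:R = f k.
    rewrite (bigD1 k)//= eqxx mulr1 big1 ?addr0// => i ik.
    by rewrite eq_sym (negbTE ik) mulr0.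
  under eq_bigr do rewrite mulr_sumr.
  rewrite exchange_big/=.
  have E (q : 'I_n * 'I_n) : \sum_i Ft i * dlog_factor (dlog_cut1 a dl r) (lzeta dl beta) i t q =
    (if (q.1 < q.2)%N then lzeta dl beta (tnth t q.2 - tnth t q.1) * (Ft q.2 - Ft q.1) else 0) +
    (if q.1 == q.2 then Ft q.1 * dlog_cut1 a dl r (tnth t q.1) else 0).
    rewrite /dlog_factor; case: ltnP => [lt12|_].
      have -> : (q.1 == q.2) = false by rewrite -val_eqE/=; apply/eqP; lia.
      rewrite addr0.
      under eq_bigr do rewrite mulrCA mulrBr.
      by rewrite -mulr_sumr sumrB !delta.
    rewrite add0r; case: ifP => _; last by rewrite big1// => i _; rewrite mulr0.
    under eq_bigr do rewrite mulrA.
    by rewrite -mulr_suml delta.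
  rewrite (eq_bigr _ (fun q _ => E q)) big_split/= addrC; congr (_ + _).
    rewrite -big_mkcond/= -(pair_big_dep xpredT (fun i j => i == j) (fun i _ => Ft i * dlog_cut1 a dl r (tnth t i)))/=.
    by apply: eq_bigr => i _; rewrite (big_pred1 i)// => j; rewrite eq_sym.
  by rewrite -big_mkcond.
rewrite big_split/= -/(Ft _) FL.
have pairs : \sum_(q : 'I_n * 'I_n | (q.1 < q.2)%N)
      lzeta dl beta (tnth t q.2 - tnth t q.1) * (Ft q.2 - Ft q.1) <=
   - \sum_i Gt i * ((a + 1) / x i - 2^-1) + close_cost * \1_close_pair t.
  have -> : - \sum_i Gt i * ((a + 1) / x i - 2^-1) =
      \sum_(q : 'I_n * 'I_n | (q.1 < q.2)%N) beta * ((Gt q.2 - Gt q.1) / (x q.2 - x q.1)).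
    rewrite -mulr_sumr sum_pair_quotients mulr_sumr -sumrN; apply: eq_bigr => i _.
    rewrite mulrCA -mulrN; congr (_ * _).
    by have := x_eq i; lra.
  rewrite /close_cost mulr_suml -big_split/=; apply: ler_sum => q q12.
  have z0 : 0 < tnth t q.2 - tnth t q.1 by rewrite subr_gt0 tinc.
  have /andP[t10 t1r] := tr q.1; have /andP[t20 t2r] := tr q.2.
  have x12 : 0 < x q.2 - x q.1 by rewrite subr_gt0 x_incr.
  have quot := repulsion q12 t10 (tinc _ _ q12) t2r.
  rewrite lzetaE// mulrAC -mulrA.
  have ex0 := cutexcess_ge0 (tnth t q.2 - tnth t q.1) dl0.
  have ex4 := cutexcess_le dl0 (ltW z0).
  apply: (@le_trans _ _ ((beta + cutexcess dl (tnth t q.2 - tnth t q.1)) *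
     ((Gt q.2 - Gt q.1) / (x q.2 - x q.1)))).
    by rewrite ler_wpM2l// addr_ge0// ltW.
  rewrite mulrDl lerD2l.
  have [near|far] := ltP (tnth t q.2 - tnth t q.1) dl; last first.
    rewrite cutexcess_far// mul0r mulr_ge0 ?indicE// divr_ge0 ?(ltW x12)//.
    by rewrite mulr_ge0//; exact: le_trans (normr_ge0 _) (G_bounded q.1 (tr q.1)).
  rewrite indicE mem_set ?mulr1; last by exists q.1, q.2; rewrite q12.
  rewrite mulrA ler_pM2r ?invr_gt0//.
  have : `|Gt q.1| <= MG by exact: G_bounded.
  have : `|Gt q.2| <= MG by exact: G_bounded.
  rewrite !ler_norml => /andP[g1 g2] /andP[g3 g4].
  have : Gt q.2 - Gt q.1 <= 2 * MG by lra.
  have MG0 : 0 <= MG by lra.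
  by nra.
have : \sum_i (F' i (tnth t i) + F i (tnth t i) * dlog_cut1 a dl r (tnth t i)
    - G i (tnth t i) * ((a + 1) / x i - 2^-1)) <= \sum_i - Q i (tnth t i).
  by apply: ler_sum => i _; exact: potential.
rewrite sumrN sumrB big_split/=.
by move: pairs; rewrite /Gt /Ft; lra.
Qed.
End virial.

(** * The integrated virial inequality *)

Section virial_integral.
Context {R : realType}.
Local Notation RT := (measurableTypeR R).

Lemma measurable_forall_fin (d : measure_display) (T : measurableType d)
    (I : finType) (P : I -> set T) : (forall i, measurable (P i)) ->
  measurable [set t | forall i, P i t].
Proof.
move=> mP; rewrite (_ : [set t | _] = \bigcap_(i in [set: I]) P i).
  by apply: fin_bigcap_measurable => // i _.
by apply/seteqP; split=> [t h i _|t h i]; exact: h.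
Qed.

Lemma measurable_exists_fin (d : measure_display) (T : measurableType d)
    (I : finType) (P : I -> set T) : (forall i, measurable (P i)) ->
  measurable [set t | exists i, P i t].
Proof.
move=> mP; rewrite (_ : [set t | _] = \bigcup_(i in [set: I]) P i).
  by apply: fin_bigcup_measurable => // i _.
by apply/seteqP; split=> [t [i h]|t [i _ h]]; exists i.
Qed.

Lemma measurable_tnth_preimage n (i : 'I_n) (A : set R) : measurable A ->
  measurable [set t : n.-tuple RT | A (tnth t i)].
Proof.
move=> mA; rewrite -[X in measurable X]setTI.
exact: (measurable_tnth i).
Qed.

Lemma measurable_tnthB_preimage n (i j : 'I_n) (A : set R) : measurable A ->
  measurable [set t : n.-tuple RT | A (tnth t j - tnth t i)].
Proof.
move=> mA; rewrite -[X in measurable X]setTI.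
have : measurable_fun [set: n.-tuple RT] (fun t => tnth t j - tnth t i : R).
  by apply: measurable_funB; exact: measurable_tnth.
by apply.
Qed.

Lemma measurable_separated n (dl r : R) : measurable (separated dl r (n := n)).
Proof.
apply: measurableI.
  apply: measurable_forall_fin => i.
  rewrite (_ : (fun t => _) = [set t : n.-tuple RT | [set` `[dl, r - 1]] (tnth t i)]).
    exact: measurable_tnth_preimage.
  by apply/seteqP; split=> t /=; rewrite in_itv.
apply: measurable_forall_fin => i; apply: measurable_forall_fin => j.
have [ij|ij] := boolP (i < j)%N; last first.
  by rewrite (_ : (fun t => _) = setT)//; apply/seteqP; split=> t //= _.
rewrite (_ : (fun t => _) = [set t : n.-tuple RT | [set` `[dl, +oo[] (tnth t j - tnth t i)]).
  exact: measurable_tnthB_preimage.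
by apply/seteqP; split=> t /=; rewrite in_itv/= andbT => // /(_ isT).
Qed.

Lemma measurable_close_pair n (dl : R) : measurable (close_pair dl (n := n)).
Proof.
apply: measurable_exists_fin => i; apply: measurable_exists_fin => j.
have [ij|ij] := boolP (i < j)%N; last first.
  by rewrite (_ : (fun t => _) = set0)//; apply/seteqP; split=> t.
rewrite (_ : (fun t => _) = [set t : n.-tuple RT | [set` `]-oo, dl[] (tnth t j - tnth t i)]).
  exact: measurable_tnthB_preimage.
by apply/seteqP; split=> t /=; rewrite in_itv.
Qed.

Variables (n : nat) (beta a : R) (x : 'I_n -> R).
Hypotheses (beta0 : 0 < beta) (a1 : -1 < a).
Hypothesis x_incr : forall i j : 'I_n, (i < j)%N -> x i < x j.
Hypothesis x_eq : forall i,
  beta * (\sum_(j | j != i) (x i - x j)^-1) + (a + 1) / x i - 2^-1 = 0.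
Variables (r dl : R).
Hypothesis dl0 : 0 < dl.
Variables (F1 F1' F2 F2' : 'I_n -> R -> R) (m : 'I_n -> R).
Hypothesis m0 : forall i, 0 < m i.
Hypothesis mr : forall i, m i < r.
Hypothesis dF1 : forall i (y : R), 0 <= y <= m i -> is_derive y 1 (F1 i) (F1' i y).
Hypothesis cF1 : forall i (y : R), 0 <= y <= m i -> {for y, continuous (F1' i)}.
Hypothesis dF2 : forall i (y : R), m i <= y <= r -> is_derive y 1 (F2 i) (F2' i y).
Hypothesis cF2 : forall i (y : R), m i <= y <= r -> {for y, continuous (F2' i)}.
Hypothesis F12 : forall i, F1 i (m i) = F2 i (m i).
Hypothesis mF : forall i, [/\ measurable_fun setT (F1 i), measurable_fun setT (F2 i),
  measurable_fun setT (F1' i) & measurable_fun setT (F2' i)].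
Variables (G Q : 'I_n -> R -> R) (MG Qmin Qbad : R) (bad : 'I_n -> set R).
Let F i := glue (m i) (F1 i) (F2 i).
Let F' i := glue (m i) (F1' i) (F2' i).
Hypothesis potential : forall i y, 0 < y < r ->
  F' i y + F i y * dlog_cut1 a dl r y - G i y * ((a + 1) / x i - 2^-1) <= - Q i y.
Hypothesis repulsion : forall (i j : 'I_n) yi yj, (i < j)%N ->
  0 < yi -> yi < yj -> yj < r ->
  (F j yj - F i yi) / (yj - yi) <= (G j yj - G i yi) / (x j - x i).
Hypothesis G_bounded : forall i y, 0 < y < r -> `|G i y| <= MG.
Hypothesis Q_ge : forall i y, - Qmin <= Q i y.
Hypothesis Q_bad : forall i y, bad i y -> Qbad - Qmin <= Q i y.
Hypothesis bad_meas : forall i, measurable (bad i).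
Hypotheses (Qbad0 : 0 <= Qbad) (Qmin0 : 0 <= Qmin) (MG0 : 0 <= MG).
Local Notation w := (base_weight beta a (n := n)).
Hypothesis w_int : (lebesgue_tuple n).-integrable setT (EFin \o w).

Definition bad_tuple : set (n.-tuple RT) := [set t | exists i, bad i (tnth t i)].

Lemma measurable_bad_tuple : measurable bad_tuple.
Proof. by apply: measurable_exists_fin => i; exact: measurable_tnth_preimage. Qed.

Lemma base_weight_ge0 t : 0 <= w t.
Proof.
apply: prodr_ge0 => q _; rewrite /factor; case: ifP => _; first exact: density2_ge0.
by case: ifP => _; [exact: density1_ge0|].
Qed.

Definition partial_mass (A : set (n.-tuple RT)) : \bar R :=
  (\int[lebesgue_tuple n]_t (w t * \1_A t)%:E)%E.

Lemma integrable_partial A : measurable A ->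
  (lebesgue_tuple n).-integrable setT (EFin \o (fun t => w t * \1_A t)).
Proof.
move=> mA; apply: le_integrable w_int => //.
  apply/measurable_EFinP; apply: measurable_funM.
    by have /integrableP[/measurable_EFinP] := w_int.
  exact: measurable_indic.
move=> t _ /=; rewrite lee_fin normrM ler_piMr// indicE.
by case: (_ \in _); rewrite ?normr0 ?normr1.
Qed.

(** Markov's inequality for the sum of the Q_i + Qmin, which are nonnegative, under the cut weight:
    the by-parts integrals vanish. The cut weight is replaced by the true one on the left over
    [separated], where both agree, and on the right by domination. *)
Lemma virial_integral :
  (Qbad%:E * partial_mass (bad_tuple `&` separated dl r (n := n)) <=
   (n%:R * Qmin)%:E * partial_mass setT +
   (close_cost x MG)%:E * partial_mass (close_pair dl (n := n)))%E.
Proof.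
pose g t := \sum_i by_parts_integrand (cut1 a dl r) (dlog_cut1 a dl r)
   (zeta dl beta) (lzeta dl beta) (F1 i) (F1' i) (F2 i) (F2' i) (m i) i t.
have beta1 : -1 < beta by have := beta0; lra.
have hA := C1log_cut1 a1 r dl0; have hZ := C1log_zeta dl0 beta1.
have mlA : measurable_fun setT (dlog_cut1 a dl r).
  apply: measurable_funD; first exact: measurable_lzeta.
  apply: measurable_funD => //; apply: measurableT_comp => //.
  apply: measurableT_comp; first by apply: measurable_lzeta; lra.
  by apply: measurable_funB.
have mlZ : measurable_fun setT (lzeta dl beta) by exact: measurable_lzeta.
have A0 := @cut1_support _ a a1 dl r.
have gi i : (lebesgue_tuple n).-integrable setT (EFin \o
    by_parts_integrand (cut1 a dl r) (dlog_cut1 a dl r)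
   (zeta dl beta) (lzeta dl beta) (F1 i) (F1' i) (F2 i) (F2' i) (m i) i).
  by have [? ? ? ?] := mF i; apply: integrable_by_parts; eauto.
have g0 i : (\int[lebesgue_tuple n]_t (
    by_parts_integrand (cut1 a dl r) (dlog_cut1 a dl r)
   (zeta dl beta) (lzeta dl beta) (F1 i) (F1' i) (F2 i) (F2' i) (m i) i t)%:E = 0)%E.
  by have [? ? ? ?] := mF i; apply: integral_by_parts; eauto.
have gsum : EFin \o g = (fun t => \sum_(i < n) (by_parts_integrand (cut1 a dl r) (dlog_cut1 a dl r)
   (zeta dl beta) (lzeta dl beta) (F1 i) (F1' i) (F2 i) (F2' i) (m i) i t)%:E)%E.
  by apply/funext => t; rewrite /= sumEFin.
have gint : (lebesgue_tuple n).-integrable setT (EFin \o g).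
  by rewrite gsum; apply: integrable_sum => // i _; exact: gi.
have gE : (\int[lebesgue_tuple n]_t (g t)%:E = 0)%E.
  rewrite [LHS](_ : _ = \int[lebesgue_tuple n]_t ((EFin \o g) t))%E//.
  rewrite gsum integral_sum//.
  by rewrite big1// => i _; exact: g0.
pose f1 t := Qbad * (w t * \1_(bad_tuple `&` separated dl r (n := n)) t).
pose f2 t := n%:R * Qmin * (w t * \1_setT t) + close_cost x MG * (w t * \1_(close_pair dl (n := n)) t).
have f12 t : f1 t + g t <= f2 t.
  have w0 := base_weight_ge0 t.
  have i0 (A : set (n.-tuple RT)) : 0 <= \1_A t :> R by rewrite indicE.
  have cost0 : 0 <= close_cost x MG.
    apply: sumr_ge0 => q q12; rewrite divr_ge0 ?mulr_ge0// subr_ge0 ltW//.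
    exact: x_incr.
  have W0 := cut_weight_ge0 beta a r dl0 t.
  have Ww := cut_weight_le beta0 a1 r dl0 t.
  have gW : g t = cut_weight beta a dl r t * \sum_i (F' i (tnth t i) +
      F i (tnth t i) * dlog_weight (dlog_cut1 a dl r) (lzeta dl beta) i t).
    by rewrite mulr_sumr.
  have f1W : f1 t <= cut_weight beta a dl r t * (\sum_i Q i (tnth t i) + n%:R * Qmin).
    have -> : \sum_i Q i (tnth t i) + n%:R * Qmin = \sum_i (Q i (tnth t i) + Qmin).
      by rewrite big_split/= sumr_const card_ord mulr_natl.
    have Q0 i : 0 <= Q i (tnth t i) + Qmin by have := Q_ge i (tnth t i); lra.
    rewrite /f1 indicE.
    case: (boolP (t \in bad_tuple `&` separated dl r (n := n))) => [|_]; last first.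
      by rewrite !mulr0 mulr_ge0// sumr_ge0.
    rewrite inE => -[[i bi] sep]; rewrite mulr1 mulrC (cut_weight_eq _ _ dl0 sep)//.
    rewrite ler_wpM2l// (bigD1 i)//=.
    have := Q_bad bi; have : 0 <= \sum_(j < n | j != i) (Q j (tnth t j) + Qmin).
      exact: sumr_ge0.
    by lra.
  have [W0'|Wn0] := eqVneq (cut_weight beta a dl r t) 0.
    have -> : g t = 0 by rewrite gW W0' mul0r.
    rewrite W0' mul0r in f1W; rewrite addr0; apply: (le_trans f1W).
    by rewrite /f2; apply: addr_ge0; apply: mulr_ge0 => //; apply: mulr_ge0.
  have := virial_pointwise beta0 a1 x_incr x_eq dl0 potential repulsion G_bounded Wn0.
  rewrite -(ler_pM2l (_ : 0 < cut_weight beta a dl r t)); last by rewrite lt_def Wn0.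
  rewrite -gW => gle.
  apply: (@le_trans _ _ (cut_weight beta a dl r t *
      (n%:R * Qmin + close_cost x MG * \1_(close_pair dl (n := n)) t))).
    by move: gle f1W; lra.
  have -> : f2 t = w t * (n%:R * Qmin + close_cost x MG * \1_(close_pair dl (n := n)) t).
    by rewrite /f2 indicT mulr1 /=; ring.
  rewrite ler_wpM2r//.
  by apply: addr_ge0; apply: mulr_ge0.
have mB : measurable (bad_tuple `&` separated dl r (n := n)).
  by apply: measurableI; [exact: measurable_bad_tuple|exact: measurable_separated].
have mC : measurable (close_pair dl (n := n)) by exact: measurable_close_pair.
have iB := integrable_partial mB; have iC := integrable_partial mC.
have iT := integrable_partial measurableT.
have if1 : (lebesgue_tuple n).-integrable setT (EFin \o f1).
  by rewrite (_ : EFin \o f1 = fun t => (Qbad%:E * (w t * \1_(bad_tuple `&` separated dl r (n := n)) t)%:E)%E); [exact: integrableZl|].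
have iT' : (lebesgue_tuple n).-integrable setT
    (fun t => ((n%:R * Qmin)%:E * (w t * \1_setT t)%:E)%E) by exact: integrableZl.
have iC' : (lebesgue_tuple n).-integrable setT
    (fun t => ((close_cost x MG)%:E * (w t * \1_(close_pair dl (n := n)) t)%:E)%E).
  exact: integrableZl.
have := @le_integral _ _ _ (lebesgue_tuple n) setT measurableT
  (fun t => (EFin \o f1) t + (EFin \o g) t)%E
  (fun t => (n%:R * Qmin)%:E * (w t * \1_setT t)%:E +
    (close_cost x MG)%:E * (w t * \1_(close_pair dl (n := n)) t)%:E)%E
  (integrableD measurableT if1 gint) (integrableD measurableT iT' iC').
rewrite integralD//= gE adde0 integralD// !integralZl//.
move=> h; apply: le_trans (h _); last first.
  by move=> t _ /=; rewrite -EFinD -!EFinM -EFinD lee_fin f12.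
by rewrite /partial_mass -integralZl.
Qed.
End virial_integral.

(** * The fields of the upper and lower tails *)

Section sqrt_fields.
Context {R : realType}.
Variable p : nat.
Hypothesis p2 : (2 <= p)%N.

Let p0 : (0 < p)%N. Proof. exact: leq_trans p2. Qed.
Let pm0 : (0 < p.-1)%N. Proof. by rewrite -ltnS prednK. Qed.

Lemma is_derive_pospart_exp (z : R) :
  is_derive z 1 (fun z => pospart z ^+ p) (p%:R * pospart z ^+ p.-1).
Proof.
have -> : (fun z : R => pospart z ^+ p) = pospow p%:R.
  by apply/funext => y; rewrite /pospow powR_mulrn ?pospart_ge0.
have -> : p%:R * pospart z ^+ p.-1 = p%:R * pospow (p%:R - 1) z.
  rewrite /pospow -[in X in X - 1](prednK p0) -natr1 addrK.
  by rewrite powR_mulrn ?pospart_ge0.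
by apply: is_derive_pospow; rewrite ltr1n.
Qed.

(** Here rho is the square root of a zero; the sign sg is 1 for the upper tail and -1 for the lower
    one. *)
Definition sqrt_dev (sg rho y : R) : R := pospart (sg * (Num.sqrt y - rho)).

Definition sqrt_field (sg rho y : R) : R :=
  sg * (2 * Num.sqrt y) * sqrt_dev sg rho y ^+ p.

Definition sqrt_field' (sg rho y : R) : R :=
  sg * (sqrt_dev sg rho y ^+ p / Num.sqrt y) + p%:R * sqrt_dev sg rho y ^+ p.-1.

Lemma sqrt_dev_ge0 sg rho y : 0 <= sqrt_dev sg rho y.
Proof. exact: pospart_ge0. Qed.

Lemma is_derive_sqrt_field (sg rho y : R) : sg ^+ 2 = 1 -> 0 < y ->
  is_derive y 1 (sqrt_field sg rho) (sqrt_field' sg rho y).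
Proof.
move=> sg2 y0; have ds := is_derive1_sqrt y0.
have sy0 : Num.sqrt y != 0 by rewrite gt_eqF// sqrtr_gt0.
have d1 : is_derive y 1 (fun y => sg * (2 * Num.sqrt y)) (sg *: (2 *: (2 * Num.sqrt y)^-1)).
  by apply: is_deriveZ; exact: is_deriveZ.
have d2 : is_derive y 1 (fun y => sg * (Num.sqrt y - rho)) (sg *: ((2 * Num.sqrt y)^-1 - 0)).
  by apply: is_deriveZ; exact: is_deriveB.
have d3 : is_derive y 1 (fun y => sqrt_dev sg rho y ^+ p)
    (p%:R * sqrt_dev sg rho y ^+ p.-1 * (sg *: ((2 * Num.sqrt y)^-1 - 0))).
  apply: (@is_derive1_comp _ (fun z => pospart z ^+ p) (fun y => sg * (Num.sqrt y - rho))) d2.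
  exact: is_derive_pospart_exp.
have -> : sqrt_field' sg rho y = (sg * (2 * Num.sqrt y)) *:
    (p%:R * sqrt_dev sg rho y ^+ p.-1 * (sg *: ((2 * Num.sqrt y)^-1 - 0))) +
    (sqrt_dev sg rho y ^+ p) *: (sg *: (2 *: (2 * Num.sqrt y)^-1)).
  rewrite /sqrt_field' /GRing.scale/=.
  move: (_ ^+ p) (_ ^+ p.-1) (p%:R : R) sy0 => u v w; move: (Num.sqrt y) => s s0.
  have -> : (sg * (2 * s)) * (w * v * (sg * ((2 * s)^-1 - 0))) = sg ^+ 2 * (w * v).
    by field.
  by rewrite sg2; field.
exact: is_deriveM.
Qed.

Lemma sqrt_dev_continuous sg rho : continuous (sqrt_dev sg rho).
Proof.
move=> y; apply: (@continuous_comp _ _ _ (fun y : R => sg * (Num.sqrt y - rho)) (@pospart R)).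
  have -> : (fun y : R => sg * (Num.sqrt y - rho)) = cst sg \* ((@Num.sqrt R) \- cst rho) by [].
  apply: continuousM; first exact: cvg_cst.
  by apply: cvgB; [exact: sqrt_continuous|exact: cvg_cst].
exact: pospart_continuous.
Qed.

Lemma sqrt_dev_exp_continuous sg rho k : continuous (fun y => sqrt_dev sg rho y ^+ k).
Proof.
move=> y; apply: (@continuous_comp _ _ _ (sqrt_dev sg rho) (fun y : R => y ^+ k)).
  exact: sqrt_dev_continuous.
exact: exprn_continuous.
Qed.

Lemma sqrt_field'_continuous (sg rho y : R) : 0 < y ->
  {for y, continuous (sqrt_field' sg rho)}.
Proof.
move=> y0.
have -> : sqrt_field' sg rho = (cst sg \* ((fun y => sqrt_dev sg rho y ^+ p) \* (fun y => (Num.sqrt y)^-1)))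
   \+ (cst p%:R \* (fun y => sqrt_dev sg rho y ^+ p.-1)) by [].
apply: continuousD; apply: continuousM; [exact: cvg_cst| |exact: cvg_cst|exact: sqrt_dev_exp_continuous].
apply: continuousM; first exact: sqrt_dev_exp_continuous.
by apply: continuousV; [rewrite gt_eqF// sqrtr_gt0|exact: sqrt_continuous].
Qed.

Lemma measurable_sqrt_field sg rho : measurable_fun setT (sqrt_field sg rho).
Proof.
apply: measurable_funM.
  apply: measurable_funM => //; apply: measurable_funM => //.
  by apply: continuous_measurable_fun; exact: sqrt_continuous.
by apply: continuous_measurable_fun; exact: sqrt_dev_exp_continuous.
Qed.

Lemma measurable_sqrt_field' sg rho : measurable_fun setT (sqrt_field' sg rho).
Proof.
have mdev k : measurable_fun setT (fun y => sqrt_dev sg rho y ^+ k).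
  by apply: continuous_measurable_fun; exact: sqrt_dev_exp_continuous.
apply: measurable_funD; apply: measurable_funM => //.
apply: measurable_funM => //.
rewrite (_ : (fun y => _) = (fun z : R => z `^ (-1)) \o @Num.sqrt R); last first.
  by apply/funext => y /=; rewrite powR_inv1 ?sqrtr_ge0.
apply: measurableT_comp; first exact: measurable_powR.
by apply: continuous_measurable_fun; exact: sqrt_continuous.
Qed.

Lemma sqrt_mono (x y : R) : 0 <= x -> x < y -> Num.sqrt x < Num.sqrt y.
Proof. by move=> x0 xy; rewrite ltr_sqrt//; exact: le_lt_trans xy. Qed.

Lemma sqrt_node (rho y : R) : 0 < rho -> 0 < y -> (rho < Num.sqrt y) = (rho ^+ 2 < y).
Proof.
by move=> r0 y0; rewrite -[in RHS](sqr_sqrtr (ltW y0)) ltr_pXn2r// nnegrE ?sqrtr_ge0// ltW.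
Qed.

Definition high_dev (rho y : R) := sqrt_dev 1 rho y.
Definition low_dev (rho y : R) := lowdev p (Num.sqrt y) rho.

Definition high_G (rho y : R) := 2 * rho * high_dev rho y ^+ p.
Definition low_G (rho y : R) := - (2 * rho * low_dev rho y ^+ p).

(* Linear continuation of the lower field below [s = rho / (4p)]. *)
Definition low_start (rho y : R) : R :=
  - (2 * y * ((rho - rho / (4 * p%:R)) ^+ p / (rho / (4 * p%:R)))).

Definition low_start' (rho : R) : R :=
  - (2 * ((rho - rho / (4 * p%:R)) ^+ p / (rho / (4 * p%:R)))).

Definition high_F rho := glue (rho ^+ 2) (cst 0) (sqrt_field 1 rho).
Definition high_F' rho := glue (rho ^+ 2) (cst 0) (sqrt_field' 1 rho).
Definition low_F rho := glue ((rho / (4 * p%:R)) ^+ 2) (low_start rho) (sqrt_field (-1) rho).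
Definition low_F' rho := glue ((rho / (4 * p%:R)) ^+ 2) (cst (low_start' rho)) (sqrt_field' (-1) rho).

Lemma high_devE rho y : high_dev rho y = pospart (Num.sqrt y - rho).
Proof. by rewrite /high_dev /sqrt_dev mul1r. Qed.

Lemma high_FE (rho y : R) : 0 < rho -> 0 < y ->
  high_F rho y = 2 * Num.sqrt y * high_dev rho y ^+ p.
Proof.
move=> r0 y0; rewrite /high_F /glue; case: ifPn => [yr|_]; last first.
  by rewrite /sqrt_field mul1r.
rewrite high_devE pospart_eq0 ?expr0n ?gtn_eqF// ?mulr0//.
by rewrite subr_le0 leNgt sqrt_node// -leNgt.
Qed.

Let frac0 (rho : R) : 0 < rho -> 0 < rho / (4 * p%:R).
Proof. by move=> r0; rewrite divr_gt0// mulr_gt0// ltr0n. Qed.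

Let frac_lt (rho : R) : 0 < rho -> rho / (4 * p%:R) < rho.
Proof.
move=> r0; rewrite ltr_pdivrMr ?mulr_gt0 ?ltr0n// ltr_pMr//.
have : 2 <= p%:R :> R by rewrite (ler_nat _ 2).
by lra.
Qed.

Lemma low_FE (rho y : R) : 0 < rho -> 0 < y ->
  low_F rho y = - (2 * (Num.sqrt y ^+ 2 * (low_dev rho y ^+ p / floor_at p (Num.sqrt y) rho))).
Proof.
move=> r0 y0; have c0 := frac0 r0; have cr := frac_lt r0.
rewrite /low_F /glue /low_dev /lowdev /floor_at; case: ifPn => [yc|yc].
  have -> : Num.max (Num.sqrt y) (rho / (4 * p%:R)) = rho / (4 * p%:R).
    by apply/max_idPr; rewrite leNgt sqrt_node// -leNgt.
  by rewrite /low_start pospart_id ?subr_ge0 ?(ltW cr)// sqr_sqrtr ?(ltW y0)// -mulrA.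
have sc : rho / (4 * p%:R) < Num.sqrt y by rewrite sqrt_node// ltNge.
have -> : Num.max (Num.sqrt y) (rho / (4 * p%:R)) = Num.sqrt y.
  by apply/max_idPl; exact: ltW.
rewrite /sqrt_field /sqrt_dev !mulN1r opprB.
have : Num.sqrt y != 0 by rewrite gt_eqF// sqrtr_gt0.
by set u := pospart _ ^+ p; set s := Num.sqrt y => s0; field.
Qed.

(** [pair_sqrt] with exchanged roles: the square roots of the points stand for r1, r2 and those of
    the zeros for s1, s2. *)
Lemma high_repulsion (rho1 rho2 y1 y2 : R) : 0 < rho2 -> rho2 < rho1 -> 0 < y2 -> y2 < y1 ->
  (high_F rho1 y1 - high_F rho2 y2) / (y1 - y2) <=
  (high_G rho1 y1 - high_G rho2 y2) / (rho1 ^+ 2 - rho2 ^+ 2).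
Proof.
move=> r20 r21 y20 y21; have y10 := lt_trans y20 y21; have r10 := lt_trans r20 r21.
rewrite !high_FE// /high_G.
rewrite -[in y1 - y2](sqr_sqrtr (ltW y10)) -[in _ - y2](sqr_sqrtr (ltW y20)).
have := @pair_sqrt R p _ _ _ _ p0 (ltW r20) r21 (sqrtr_ge0 y2) (sqrt_mono (ltW y20) y21).
rewrite -!high_devE => /(ler_wpM2l (ler0n R 2)).
by rewrite !mulrA !mulrBr !mulrA.
Qed.

Lemma low_repulsion (rho1 rho2 y1 y2 : R) : 0 < rho2 -> rho2 < rho1 -> 0 < y2 -> y2 < y1 ->
  (low_F rho1 y1 - low_F rho2 y2) / (y1 - y2) <=
  (low_G rho1 y1 - low_G rho2 y2) / (rho1 ^+ 2 - rho2 ^+ 2).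
Proof.
move=> r20 r21 y20 y21; have y10 := lt_trans y20 y21; have r10 := lt_trans r20 r21.
rewrite !low_FE// /low_G.
rewrite -[in y1 - y2](sqr_sqrtr (ltW y10)) -[in _ - y2](sqr_sqrtr (ltW y20)).
have := @pair_floor R p p2 _ _ _ _ (sqrtr_ge0 y2) (sqrt_mono (ltW y20) y21) r20 r21.
rewrite -!/(low_dev _ _) -lerN2 => /(ler_wpM2l (ler0n R 2)).
set u := _ / (_ ^+ 2 - _ ^+ 2); set v := _ / (_ ^+ 2 - _ ^+ 2).
set u' := _ / (_ ^+ 2 - _ ^+ 2); set v' := _ / (_ ^+ 2 - _ ^+ 2).
suff [-> ->] : u' = 2 * - u /\ v' = 2 * - v by [].
by split; rewrite mulrN /u /v /u' /v' -[RHS]mulNr [RHS]mulrA; congr (_ / _); ring.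
Qed.

(* Summed over the points, the gain has nonpositive expectation; this bounds the
   [p+1]-st moment of the deviations by the [p-1]-st. *)
Definition dev_gain (e : R) : R := e ^+ p.+1 - 5 * p%:R * e ^+ p.-1.

Let dev_gain0 : dev_gain 0 = 0.
Proof. by rewrite /dev_gain !expr0n/= gtn_eqF// mulr0 subr0. Qed.

Let expS (e : R) : e ^+ p = e * e ^+ p.-1.
Proof. by rewrite -exprS prednK. Qed.

Let expSS (e : R) : e ^+ p.+1 = e ^+ 2 * e ^+ p.-1.
Proof. by rewrite exprS expS mulrA expr2. Qed.

Variables (a dl r rho : R).
Hypotheses (a1 : -1 < a) (dl0 : 0 < dl) (rho0 : 0 < rho).

(** With e = s - rho the terms sum to p e^(p-1) - e^(p+1) - 2 (a + 1) e^p (1 / rho - 1 / s) - e^p /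
    s, plus the nonpositive contribution of the decreasing cutoff at r. The cutoff at the origin
    acts only below dl, where the field vanishes. *)
Lemma high_potential y : dl <= rho ^+ 2 -> 0 < y < r ->
  high_F' rho y + high_F rho y * dlog_cut1 a dl r y
    - high_G rho y * ((a + 1) / rho ^+ 2 - 2^-1) <= - dev_gain (high_dev rho y).
Proof.
move=> dlr /andP[y0 yr]; rewrite high_FE// /high_G.
have [yrho|rhoy] := leP y (rho ^+ 2).
  have d0 : high_dev rho y = 0.
    by rewrite high_devE pospart_eq0// subr_le0 leNgt sqrt_node// -leNgt.
  rewrite d0 dev_gain0 expr0n gtn_eqF// !mulr0 !mul0r.
  by rewrite /high_F' /glue yrho/=; lra.
have rs : rho < Num.sqrt y by rewrite sqrt_node.
have lz : 0 <= lzeta 1 0 (r - y) by apply: lzeta0_ge0; lra.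
rewrite /high_F' /glue [y <= _]leNgt rhoy/= /sqrt_field' /dlog_cut1 lzetaE//.
rewrite cutexcess_far ?(ltW (le_lt_trans dlr rhoy))// -/(high_dev rho y).
have eE : high_dev rho y = Num.sqrt y - rho.
  by rewrite high_devE pospart_id// subr_ge0 ltW.
rewrite /dev_gain expSS expS eE.
have -> : (a + 0) / y = (a + 0) / Num.sqrt y ^+ 2 by rewrite sqr_sqrtr// ltW.
have e0 : 0 < Num.sqrt y - rho by rewrite subr_gt0.
have K0 : 0 <= (Num.sqrt y - rho) ^+ p.-1 by rewrite exprn_ge0// ltW.
have pR : 2 <= p%:R :> R by rewrite (ler_nat _ 2).
set K := (Num.sqrt y - rho) ^+ p.-1 in K0 *.
move: K (lzeta _ _ _) (Num.sqrt y) (p%:R : R) K0 lz rs e0 pR.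
move=> K l s q K0 l0 rs e0 q2.
have s0 : 0 < s := lt_trans rho0 rs.
rewrite -subr_ge0.
have -> : - ((s - rho) ^+ 2 * K - 5 * q * K) -
  (1 * ((s - rho) * K / s) + q * K +
   2 * s * ((s - rho) * K) * ((a + 0) / s ^+ 2 + (- 2^-1 + - l)) -
   2 * rho * ((s - rho) * K) * ((a + 1) / rho ^+ 2 - 2^-1)) =
  4 * (q * K) + (s - rho) * K * ((s - rho) * (2 * (a + 1)) / (s * rho) + s^-1 + 2 * s * l).
  by field; rewrite !gt_eqF.
have aa : 0 < 2 * (a + 1) by have := a1; lra.
have q0 : 0 < q by lra.
apply: addr_ge0; first by rewrite !mulr_ge0// ltW.
apply: mulr_ge0; first by rewrite mulr_ge0// ltW.
apply: addr_ge0; last by rewrite !mulr_ge0// ltW.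
apply: addr_ge0; last by rewrite invr_ge0 ltW.
by apply: divr_ge0; apply: ltW; apply: mulr_gt0.
Qed.

(** Above the floor e = rho - s leaves the unfavourable term e^p / s, at most 4p e^(p-1) because rho
    < 4 p s. Below the floor c, the linear field F = -2 y e^p / c, with e = rho - c, turns F' + a F
    / y into -2 (a + 1) e^p / c, which outweighs the term in (a + 1) / rho. The field is
    nonpositive, so the increasing cutoff at the origin helps, and the one at r acts only beyond
    rho^2, where the field vanishes. *)
Lemma low_potential y : rho ^+ 2 + 1 <= r -> 0 < y < r ->
  low_F' rho y + low_F rho y * dlog_cut1 a dl r y
    - low_G rho y * ((a + 1) / rho ^+ 2 - 2^-1) <= - dev_gain (low_dev rho y).
Proof.
move=> rhor /andP[y0 yr]; have c0 := frac0 rho0; have cr := frac_lt rho0.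
have c2r : (rho / (4 * p%:R)) ^+ 2 < rho ^+ 2.
  by rewrite ltr_pXn2r// nnegrE ltW.
have [rhoy|yrho] := leP (rho ^+ 2) y.
  have rs : rho <= Num.sqrt y.
    by rewrite -[rho](ger0_norm (ltW rho0)) -sqrtr_sqr; exact: ler_wsqrtr.
  have d0 : low_dev rho y = 0.
    rewrite /low_dev /lowdev pospart_eq0// subr_le0 /floor_at.
    by rewrite le_max rs.
  have s0 : sqrt_dev (-1) rho y = 0.
    by rewrite /sqrt_dev mulN1r opprB pospart_eq0// subr_le0.
  rewrite low_FE// /low_G d0 dev_gain0 expr0n gtn_eqF// !mul0r !mulr0 oppr0 !mul0r.
  rewrite /low_F' /glue [y <= _]leNgt (lt_le_trans c2r rhoy)/= /sqrt_field' s0.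
  by rewrite !expr0n !gtn_eqF// !mul0r !mulr0; lra.
have sr : Num.sqrt y < rho.
  by rewrite -[rho](ger0_norm (ltW rho0)) -sqrtr_sqr ltr_sqrt// exprn_gt0.
have ex := cutexcess_ge0 y dl0.
have aa : 0 < a + 1 by have := a1; lra.
have pR : 2 <= p%:R :> R by rewrite (ler_nat _ 2).
rewrite /low_F /low_F' /low_G /low_dev /lowdev /floor_at /glue.
rewrite /dlog_cut1 lzetaE// lzeta_far//; last by lra.
have [yc|yc] := leP y ((rho / (4 * p%:R)) ^+ 2).
  have -> : Num.max (Num.sqrt y) (rho / (4 * p%:R)) = rho / (4 * p%:R).
    by apply/max_idPr; rewrite leNgt sqrt_node// -leNgt.
  rewrite pospart_id ?subr_ge0 ?(ltW cr)// /low_start /low_start' /dev_gain expSS expS.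
  have K0 : 0 <= (rho - rho / (4 * p%:R)) ^+ p.-1 by rewrite exprn_ge0// subr_ge0 ltW.
  set K := _ ^+ p.-1 in K0 *; move: K K0 => K K0.
  move: (rho / (4 * p%:R)) c0 cr yc {c2r} => c c0 cr yc.
  move: (p%:R : R) (cutexcess dl y) ex pR => q l l0 q2; rewrite -subr_ge0.
  have -> : - ((rho - c) ^+ 2 * K - 5 * q * K) -
     (cst (- (2 * ((rho - c) * K / c))) y +
      - (2 * y * ((rho - c) * K / c)) * ((a + l) / y + (- 2^-1 + - 0)) -
      - (2 * rho * ((rho - c) * K)) * ((a + 1) / rho ^+ 2 - 2^-1)) =
     5 * q * K + (rho - c) * K * ((rho - c) * (2 * (a + 1)) / (c * rho) + 2 * l / c
        + (c ^+ 2 - y) / c).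
    by rewrite /=; field; rewrite !gt_eqF.
  have q0 : 0 < q by lra.
  have rc : 0 < rho - c by lra.
  apply: addr_ge0; first by rewrite !mulr_ge0// ltW.
  apply: mulr_ge0; first by rewrite mulr_ge0// ltW.
  apply: addr_ge0; last by rewrite divr_ge0 ?subr_ge0// ltW.
  apply: addr_ge0; first by apply: divr_ge0; apply: ltW; apply: mulr_gt0 => //; lra.
  by rewrite divr_ge0 ?mulr_ge0// ltW.
have sc : rho / (4 * p%:R) < Num.sqrt y by rewrite sqrt_node// ltNge.
have -> : Num.max (Num.sqrt y) (rho / (4 * p%:R)) = Num.sqrt y.
  by apply/max_idPl; exact: ltW.
have sc' : rho < Num.sqrt y * (4 * p%:R) by rewrite -ltr_pdivrMr// mulr_gt0// ltr0n.
rewrite /sqrt_field /sqrt_field' /sqrt_dev !mulN1r opprB pospart_id ?subr_ge0 ?(ltW sr)//.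
rewrite /dev_gain expSS expS.
have -> : (a + cutexcess dl y) / y = (a + cutexcess dl y) / Num.sqrt y ^+ 2.
  by rewrite sqr_sqrtr// ltW.
have K0 : 0 <= (rho - Num.sqrt y) ^+ p.-1 by rewrite exprn_ge0// subr_ge0 ltW.
have s0 : 0 < Num.sqrt y by rewrite sqrtr_gt0.
set K := (rho - Num.sqrt y) ^+ p.-1 in K0 *.
move: K (cutexcess _ _) (Num.sqrt y) (p%:R : R) K0 ex sr sc' s0 pR.
move=> K l s q K0 l0 sr sc' s0 q2; rewrite -subr_ge0.
have -> : - ((rho - s) ^+ 2 * K - 5 * q * K) -
  (- ((rho - s) * K / s) + q * K +
   - (2 * s) * ((rho - s) * K) * ((a + l) / s ^+ 2 + (- 2^-1 + - 0)) -
   - (2 * rho * ((rho - s) * K)) * ((a + 1) / rho ^+ 2 - 2^-1)) =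
  (s * (4 * q) - rho + s) / s * K +
  (rho - s) * K * ((rho - s) * (2 * (a + 1)) / (s * rho) + 2 * l / s).
  by field; rewrite !gt_eqF.
have q0 : 0 < q by lra.
have rs : 0 < rho - s by lra.
apply: addr_ge0; first by rewrite mulr_ge0// divr_ge0 ?(ltW s0)//; lra.
apply: mulr_ge0; first by rewrite mulr_ge0// ltW.
apply: addr_ge0; first by apply: divr_ge0; apply: ltW; apply: mulr_gt0 => //; lra.
by rewrite divr_ge0 ?mulr_ge0// ltW.
Qed.

End sqrt_fields.

(** * Moment inequalities for the two tails under the cutoffs *)

Section tail_mass.
Context {R : realType}.
Local Notation RT := (measurableTypeR R).
Variables (n : nat) (beta a : R) (x : 'I_n -> R).
Hypotheses (beta0 : 0 < beta) (a1 : -1 < a).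
Hypothesis x_incr : forall i j : 'I_n, (i < j)%N -> x i < x j.
Hypothesis x_eq : forall i,
  beta * (\sum_(j | j != i) (x i - x j)^-1) + (a + 1) / x i - 2^-1 = 0.
Hypothesis x_gt0 : forall i, 0 < x i.
Local Notation w := (base_weight beta a (n := n)).
Hypothesis w_int : (lebesgue_tuple n).-integrable setT (EFin \o w).

Variables (k : nat) (T : R).
Hypothesis k1 : (1 <= k)%N.
Local Notation p := (k.*2.+1).
Hypothesis T0 : 0 <= T.
Hypothesis Tp : 2 * (5 * p%:R) <= T ^+ 2.

Let p2 : (2 <= p)%N. Proof. by case: (k) k1. Qed.

(** For p = 2k + 1 the gain is e^(2k) (e^2 - 5p). It is at least T^(2k) T^2 / 2 once e >= T, because
    T^2 >= 10p, and never below -(5p)^k 5p, which gives [gain_min]. *)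
Definition gain_bad : R := T ^+ k.*2.+2 / 2.
Definition gain_min : R := (5 * p%:R) ^+ k.+1.

Let C := 5 * p%:R : R.
Let C0 : 0 <= C. Proof. by rewrite mulr_ge0. Qed.

Let gainE e : dev_gain p e = e ^+ k.*2 * (e ^+ 2 - C).
Proof. by rewrite /dev_gain /= mulrBr -exprD addn2 [in RHS]mulrC. Qed.

Lemma gain_ge e : 0 <= e -> - gain_min <= dev_gain p e.
Proof.
move=> e0; rewrite gainE; have ek : 0 <= e ^+ k.*2 by exact: exprn_ge0.
have [h|h] := leP C (e ^+ 2).
  apply: (@le_trans _ _ 0); first by rewrite oppr_le0 exprn_ge0.
  by rewrite mulr_ge0// subr_ge0.
rewrite lerNl -mulrN opprB /gain_min -/C [leRHS]exprSr.
apply: ler_pM => //; first by rewrite subr_ge0 ltW.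
  rewrite -mul2n exprM; apply: lerXn2r; rewrite ?nnegrE ?sqr_ge0//.
  exact: ltW.
by rewrite lerBlDr lerDl sqr_ge0.
Qed.

Lemma gain_far e : T <= e -> gain_bad - gain_min <= dev_gain p e.
Proof.
move=> Te; rewrite gainE.
have ek : T ^+ k.*2 <= e ^+ k.*2.
  by apply: lerXn2r; rewrite ?nnegrE// (le_trans T0).
have e2 : T ^+ 2 <= e ^+ 2 by apply: lerXn2r; rewrite ?nnegrE// (le_trans T0).
have Tk : 0 <= T ^+ k.*2 by exact: exprn_ge0.
have gm : 0 <= gain_min by exact: exprn_ge0.
have TC : T ^+ 2 / 2 <= e ^+ 2 - C by have := Tp; rewrite -/C; lra.
have T2 : 0 <= T ^+ 2 / 2 by rewrite divr_ge0 ?sqr_ge0.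
have := ler_pM Tk T2 ek TC.
have -> : gain_bad = T ^+ k.*2 * (T ^+ 2 / 2).
  by rewrite /gain_bad mulrA -exprD addn2.
by lra.
Qed.

Let rho i := Num.sqrt (x i).
Let rho0 i : 0 < rho i. Proof. by rewrite sqrtr_gt0. Qed.
Let rho2 i : rho i ^+ 2 = x i. Proof. by rewrite sqr_sqrtr// ltW. Qed.
Let rho_incr (i j : 'I_n) : (i < j)%N -> rho i < rho j.
Proof. by move=> ij; apply: sqrt_mono; [exact: ltW|exact: x_incr]. Qed.

Definition high_bad (i : 'I_n) : set R := [set y | T <= high_dev (Num.sqrt (x i)) y].
Definition low_bad (i : 'I_n) : set R := [set y | T <= low_dev p (Num.sqrt (x i)) y].

Let meas_ge (f : R -> R) : continuous f -> measurable [set y | T <= f y].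
Proof.
move=> cf; rewrite -[X in measurable X]setTI.
have mf : measurable_fun setT f by exact: continuous_measurable_fun.
have := mf measurableT [set` `[T, +oo[] (measurable_itv _).
rewrite (_ : _ @^-1` _ = [set y | T <= f y])//.
by apply/seteqP; split=> y /=; rewrite in_itv/= andbT.
Qed.

Lemma measurable_high_bad i : measurable (high_bad i).
Proof. by apply: meas_ge; exact: sqrt_dev_continuous. Qed.

Lemma measurable_low_bad i : measurable (low_bad i).
Proof.
apply: meas_ge => y.
apply: (@continuous_comp _ _ _ (fun y => rho i - Num.max (Num.sqrt y) (rho i / (4 * p%:R))) (@pospart R)).
  apply: (@continuousB _ _ _ (cst (rho i)) (fun y => Num.max (Num.sqrt y) (rho i / (4 * p%:R)))).
    exact: cvg_cst.
  apply: (@continuous_max R R (@Num.sqrt R) (cst (rho i / (4 * p%:R)))).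
    exact: sqrt_continuous.
  exact: cvg_cst.
exact: pospart_continuous.
Qed.

(** A crude bound on all the G_i over (0, r) when c = sqrt r; what counts is that it is independent
    of dl. *)
Definition G_bound (c : R) : R := \sum_i 2 * Num.sqrt (x i) * (c + Num.sqrt (x i)) ^+ p.

Let G_le c i d : 0 <= c -> 0 <= d -> d <= c + rho i ->
  2 * rho i * d ^+ p <= G_bound c.
Proof.
move=> c0 d0 dc; rewrite /G_bound (bigD1 i)//=.
apply: (@le_trans _ _ (2 * rho i * (c + rho i) ^+ p)).
  rewrite ler_wpM2l ?mulr_ge0 ?(ltW (rho0 i))//.
  by apply: lerXn2r; rewrite ?nnegrE// addr_ge0// ltW.
rewrite lerDl sumr_ge0// => j _.
by rewrite mulr_ge0 ?mulr_ge0 ?sqrtr_ge0// exprn_ge0// addr_ge0 ?sqrtr_ge0.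
Qed.

Variables (r dl : R).
Hypotheses (dl0 : 0 < dl) (dlx : forall i, dl <= x i) (xr : forall i, x i + 1 <= r).
Hypothesis r0 : 0 <= r.

Let cost := close_cost x (G_bound (Num.sqrt r)).

Let MG0 : 0 <= G_bound (Num.sqrt r).
Proof.
apply: sumr_ge0 => j _.
by rewrite mulr_ge0 ?mulr_ge0 ?sqrtr_ge0// exprn_ge0// addr_ge0 ?sqrtr_ge0.
Qed.

Let gm0 : 0 <= gain_min. Proof. exact: exprn_ge0. Qed.
Let gb0 : 0 <= gain_bad. Proof. by rewrite divr_ge0 ?exprn_ge0. Qed.

Lemma high_mass :
  (gain_bad%:E * partial_mass beta a (bad_tuple high_bad `&` separated dl r (n := n)) <=
   (n%:R * gain_min)%:E * partial_mass beta a [set: n.-tuple RT] +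
   cost%:E * partial_mass beta a (close_pair dl (n := n)))%E.
Proof.
apply: (@virial_integral R n beta a x beta0 a1 x_incr x_eq r dl dl0
  (fun i => cst 0) (fun i => cst 0)
  (fun i => sqrt_field p 1 (rho i)) (fun i => sqrt_field' p 1 (rho i)) (fun i => rho i ^+ 2)
  _ _ _ _ _ _ _ _ (fun i => high_G p (rho i)) (fun i y => dev_gain p (high_dev (rho i) y))) => //.
- by move=> i; rewrite exprn_gt0.
- by move=> i; rewrite rho2; have := xr i; lra.
- by move=> i y _; exact: cvg_cst.
- by move=> i y /andP[h _]; apply: is_derive_sqrt_field => //; [rewrite expr1n|apply: lt_le_trans h; rewrite exprn_gt0].
- by move=> i y /andP[h _]; apply: sqrt_field'_continuous; apply: lt_le_trans h; rewrite exprn_gt0.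
- by move=> i; rewrite /sqrt_field /sqrt_dev sqrtr_sqr ger0_norm ?(ltW (rho0 i))// subrr mulr0
    pospart_eq0// expr0n/= mulr0.
- move=> i; split; [exact: measurable_cst|exact: measurable_sqrt_field|exact: measurable_cst|].
  exact: measurable_sqrt_field'.
- by move=> i y yr; rewrite -[x i]rho2; apply: high_potential => //; rewrite rho2.
- move=> i j yi yj ij yi0 yij yjr; rewrite -[x i]rho2 -[x j]rho2.
  by apply: high_repulsion => //; exact: rho_incr.
- move=> i y /andP[y0 yr].
  rewrite ger0_norm; last by rewrite mulr_ge0 ?mulr_ge0 ?exprn_ge0 ?sqrt_dev_ge0 ?ltW.
  apply: G_le; rewrite ?sqrtr_ge0 ?sqrt_dev_ge0// high_devE.
  rewrite -[leRHS]pospart_id ?addr_ge0 ?sqrtr_ge0//; apply: pospart_le.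
  have : Num.sqrt y <= Num.sqrt r by apply: ler_wsqrtr; exact: ltW.
  by have := rho0 i; lra.
- by move=> i y; apply: gain_ge; exact: sqrt_dev_ge0.
- by move=> i y; exact: gain_far.
- exact: measurable_high_bad.
Qed.

Lemma low_mass :
  (gain_bad%:E * partial_mass beta a (bad_tuple low_bad `&` separated dl r (n := n)) <=
   (n%:R * gain_min)%:E * partial_mass beta a [set: n.-tuple RT] +
   cost%:E * partial_mass beta a (close_pair dl (n := n)))%E.
Proof.
pose c i := rho i / (4 * p%:R).
have c0 i : 0 < c i by rewrite divr_gt0// mulr_gt0// ltr0n.
have cr i : c i < rho i.
  rewrite ltr_pdivrMr ?mulr_gt0 ?ltr0n// ltr_pMr//.
  have : 2 <= p%:R :> R by rewrite (ler_nat _ 2).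
  by lra.
apply: (@virial_integral R n beta a x beta0 a1 x_incr x_eq r dl dl0
  (fun i => low_start p (rho i)) (fun i => cst (low_start' p (rho i)))
  (fun i => sqrt_field p (-1) (rho i)) (fun i => sqrt_field' p (-1) (rho i)) (fun i => c i ^+ 2)
  _ _ _ _ _ _ _ _ (fun i => low_G p (rho i)) (fun i y => dev_gain p (low_dev p (rho i) y))) => //.
- by move=> i; rewrite exprn_gt0.
- move=> i; have : c i ^+ 2 < rho i ^+ 2 by rewrite ltr_pXn2r// nnegrE ltW.
  by rewrite rho2; have := xr i; lra.
- move=> i y _; rewrite /low_start /low_start'; set K := _ / _.
  have -> : (fun y => - (2 * y * K)) = (fun y => - (2 * K) * y) by apply/funext => z; ring.
  suff : is_derive y 1 (fun y : R => - (2 * K) * y) (- (2 * K) *: (1 : R)).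
    by rewrite /GRing.scale/= mulr1.
  exact: is_deriveZ.
- by move=> i y _; exact: cvg_cst.
- move=> i y /andP[h _]; apply: is_derive_sqrt_field => //; first by rewrite sqrrN expr1n.
  by apply: lt_le_trans h; rewrite exprn_gt0.
- by move=> i y /andP[h _]; apply: sqrt_field'_continuous; apply: lt_le_trans h; rewrite exprn_gt0.
- move=> i; rewrite /sqrt_field /sqrt_dev sqrtr_sqr ger0_norm ?(ltW (c0 i))//.
  rewrite /low_start -/(c i) !mulN1r opprB pospart_id ?subr_ge0 ?(ltW (cr i))//.
  set u := _ ^+ p; have := c0 i; move: u (c i) => u z z0.
  by field; rewrite gt_eqF.
- move=> i; split; [|exact: measurable_sqrt_field|exact: measurable_cst|exact: measurable_sqrt_field'].
  rewrite /low_start; set K := _ / _.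
  have -> : (fun y => - (2 * y * K)) = (fun y : R => cst (- (2 * K)) y * y).
    by apply/funext => z /=; ring.
  by apply: measurable_funM; [exact: measurable_cst|exact: measurable_id].
- by move=> i y yr; rewrite -[x i]rho2; apply: low_potential => //; rewrite rho2.
- move=> i j yi yj ij yi0 yij yjr; rewrite -[x i]rho2 -[x j]rho2.
  by apply: low_repulsion => //; exact: rho_incr.
- move=> i y /andP[y0 yr].
  have d0 : 0 <= low_dev p (rho i) y by exact: lowdev_ge0.
  rewrite normrN ger0_norm; last first.
    by apply: mulr_ge0; [rewrite mulr_ge0// ltW|exact: exprn_ge0].
  apply: G_le; rewrite ?sqrtr_ge0//.
  rewrite -[leRHS]pospart_id ?addr_ge0 ?sqrtr_ge0//; apply: pospart_le.
  have := floor_at_gt0 p2 (Num.sqrt y) (rho0 i).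
  by have := sqrtr_ge0 r; lra.
- by move=> i y; apply: gain_ge; exact: lowdev_ge0.
- by move=> i y; exact: gain_far.
- exact: measurable_low_bad.
Qed.
End tail_mass.

(** * Tail bounds for the ensemble *)

Section ordered_density.
Context {R : realType}.
Local Notation RT := (measurableTypeR R).
Variables (n : nat) (beta alpha : R).
Hypothesis beta0 : 0 < beta.
Let a := alpha - (n%:R - 1) * beta / 2 - 1.

(** Outside the ordered positive tuples some factor on the right vanishes. Ties count as ordered on
    the left, where 0^beta = 0 agrees with [density2]. *)
Lemma laguerre_densityE (t : n.-tuple RT) :
  laguerre_density beta alpha t = base_weight beta a t.
Proof.
have E : base_weight beta a t =
    (\prod_(i < n) \prod_(j < n | (i < j)%N) density2 beta (tnth t j - tnth t i)) *
    \prod_(i < n) density1 a (tnth t i).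
  rewrite /base_weight /weight -(pair_bigA _ (fun i j => factor (density1 a) (density2 beta) t (i, j)))/=.
  rewrite -big_split/=; apply: eq_bigr => i _.
  rewrite [X in X * _]big_mkcond/=.
  have -> : density1 a (tnth t i) = \prod_(j < n) if j == i then density1 a (tnth t i) else 1.
    by rewrite -big_mkcond/= big_pred1_eq.
  rewrite -big_split/=; apply: eq_bigr => j _; rewrite /factor/=.
  have [ij|ji] := ltnP i j.
    by rewrite (_ : j == i = false) ?mulr1//; apply/eqP => ji; rewrite ji ltnn in ij.
  by rewrite mul1r eq_sym.
rewrite /laguerre_density; case: ifPn => [/andP[st /allP tp]|].
  have t_gt0 i : 0 < tnth t i by apply: tp; exact: mem_tnth.
  have t_le (i j : 'I_n) : (i < j)%N -> tnth t i <= tnth t j.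
    move=> ij; rewrite !(tnth_nth 0); apply: sorted_leq_nth => //.
    - exact: le_trans.
    - by rewrite inE size_tuple.
    - by rewrite inE size_tuple.
    - exact: ltnW.
  rewrite E; congr (_ * _); last by apply: eq_bigr => i _; rewrite /density1 t_gt0.
  apply: eq_bigr => i _; apply: eq_bigr => j ij.
  rewrite /density2 subr_gt0 distrC ger0_norm ?subr_ge0 ?t_le//.
  case: ltP => // ji; have -> : tnth t j = tnth t i by apply/le_anti; rewrite ji t_le.
  by rewrite subrr powR0// gt_eqF.
rewrite negb_and => /orP[/negP nst|/allPn[y /tnthP[i ->] ti]]; last first.
  by rewrite E (bigD1 i _ (F := fun i => density1 a _))//= /density1 (negbTE ti) mul0r mulr0.
have [[i j]/= /andP[ij tji]|h] := pickP (fun q : 'I_n * 'I_n => (q.1 < q.2)%N && (tnth t q.2 < tnth t q.1)).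
  rewrite /base_weight /weight (bigD1 (i, j))//= /factor/= ij.
  by rewrite /density2 subr_gt0 ltNge (ltW tji)/= mul0r.
exfalso; apply: nst; apply/(sortedP 0) => k; rewrite size_tuple => kn.
have kn' : (k < n)%N by exact: ltnW.
have := h (Ordinal kn', Ordinal kn); rewrite /= ltnS leqnn/= => /negbT.
by rewrite -leNgt !(tnth_nth 0).
Qed.

Lemma measurable_base_weight b : measurable_fun setT (base_weight beta b (n := n)).
Proof.
apply: measurable_prod => -[i j] _; rewrite /factor/=.
case: (boolP (i < j)%N) => _.
  by apply: measurable_comp_tnthB; exact: measurable_density2.
case: (boolP (i == j)) => _; last exact: measurable_cst.
by apply: measurable_comp_tnth; exact: measurable_density1.
Qed.
End ordered_density.

(** * Probability bounds with the cutoffs removed *)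

Section ensemble_tail.
Context {R : realType}.
Local Notation RT := (measurableTypeR R).
Variables (n : nat) (beta alpha : R).
Hypothesis beta0 : 0 < beta.
Hypothesis alphan : (n%:R - 1) * beta / 2 < alpha.
Variables (d : measure_display) (T : measurableType d) (P : probability T R).
Variable lam : 'I_n -> {RV P >-> R}.
Variable c : R.
Hypothesis c0 : 0 < c.
Hypothesis lamP : forall A : set (n.-tuple RT), measurable A ->
  P [set w | A [tuple lam i w | i < n]] =
  (c%:E * \int[lebesgue_tuple n]_(t in A) (laguerre_density beta alpha t)%:E)%E.

Let a := alpha - (n%:R - 1) * beta / 2 - 1.
Let a1 : -1 < a. Proof. by rewrite /a; have := alphan; lra. Qed.

Let X (w : T) : n.-tuple RT := [tuple lam i w | i < n].

Lemma measurable_sample : measurable_fun setT X.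
Proof.
apply/measurable_fun_tnthP => i.
rewrite (_ : _ \o _ = lam i); first exact: (@measurable_funPT _ _ _ _ (lam i)).
by apply/funext => w /=; rewrite tnth_mktuple.
Qed.

Definition pr (A : set (n.-tuple RT)) : R := fine (P (X @^-1` A)).

Let mX A : measurable A -> measurable (X @^-1` A).
Proof. by move=> mA; rewrite -[X in measurable X]setTI; exact: measurable_sample. Qed.

Let prE A : measurable A -> P (X @^-1` A) = (pr A)%:E.
Proof. by move=> mA; rewrite /pr fineK// fin_num_measure//; exact: mX. Qed.

Lemma pr_ge0 A : 0 <= pr A.
Proof. by rewrite /pr fine_ge0. Qed.

Lemma le_pr A B : measurable A -> measurable B -> A `<=` B -> pr A <= pr B.
Proof.
move=> mA mB AB; rewrite -lee_fin -!prE//.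
by apply: le_measure; rewrite ?inE; [exact: mX|exact: mX|move=> w; exact: AB].
Qed.

Lemma prU A B : measurable A -> measurable B -> pr (A `|` B) <= pr A + pr B.
Proof.
move=> mA mB; rewrite -lee_fin EFinD -!prE//; last exact: measurableU.
by rewrite preimage_setU; apply: measureU2; exact: mX.
Qed.

Lemma prT : pr setT = 1.
Proof. by rewrite /pr preimage_setT probability_setT. Qed.

Lemma partial_massE A : measurable A -> partial_mass beta a A = (pr A / c)%:E.
Proof.
move=> mA; have := lamP mA; rewrite -/(X @^-1` A) prE// => h.
have -> : partial_mass beta a A =
    (\int[lebesgue_tuple n]_(t in A) (laguerre_density beta alpha t)%:E)%E.
  rewrite [RHS]integral_mkcond; apply: eq_integral => t _.
  rewrite /patch laguerre_densityE//; case: ifPn => tA.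
    by rewrite indicE tA mulr1.
  by rewrite indicE (negbTE tA) mulr0.
move: h; case: (integral _ _ _) => [u| |].
- by rewrite -EFinM => -[->]; rewrite mulrC mulKf// gt_eqF.
- by rewrite gt0_muley// lte_fin.
- by rewrite gt0_muleNy// lte_fin.
Qed.

(** Finiteness of the total mass is read off the probability measure: c > 0 times that mass is 1. *)
Lemma integrable_density :
  (lebesgue_tuple n).-integrable setT (EFin \o base_weight beta a (n := n)).
Proof.
apply/integrableP; split.
  by apply/measurable_EFinP; exact: measurable_base_weight.
have -> : (\int[lebesgue_tuple n]_(t in setT) `|(EFin \o base_weight beta a (n := n)) t| =
    partial_mass beta a [set: n.-tuple RT])%E.
  apply: eq_integral => t _ /=.
  by rewrite ger0_norm ?base_weight_ge0// indicE mem_set// mulr1.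
by rewrite partial_massE// ltry.
Qed.

Definition degenerate : set (n.-tuple RT) :=
  [set t | exists i, tnth t i <= 0] `|`
  [set t | exists i j : 'I_n, (i < j)%N && (tnth t j <= tnth t i)].

Definition low_or_close (dl : R) : set (n.-tuple RT) :=
  [set t | exists i, tnth t i < dl] `|` close_pair dl (n := n).

Definition escaped (r : R) : set (n.-tuple RT) := [set t | exists i, r < tnth t i].

Lemma measurable_escaped r : measurable (escaped r).
Proof.
apply: (@measurable_exists_fin _ _ 'I_n) => i.
rewrite (_ : (fun t => _) = [set t : n.-tuple RT | [set` `]r, +oo[] (tnth t i)]).
  exact: measurable_tnth_preimage.
by apply/seteqP; split=> t /=; rewrite in_itv/= andbT.
Qed.

Lemma measurable_low_or_close dl : measurable (low_or_close dl).
Proof.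
apply: measurableU; last exact: measurable_close_pair.
apply: (@measurable_exists_fin _ _ 'I_n) => i.
rewrite (_ : (fun t => _) = [set t : n.-tuple RT | [set` `]-oo, dl[] (tnth t i)]).
  exact: measurable_tnth_preimage.
by apply/seteqP; split=> t /=; rewrite in_itv.
Qed.

Lemma measurable_degenerate : measurable degenerate.
Proof.
apply: measurableU; apply: (@measurable_exists_fin _ _ 'I_n) => i.
  rewrite (_ : (fun t => _) = [set t : n.-tuple RT | [set` `]-oo, 0]] (tnth t i)]).
    exact: measurable_tnth_preimage.
  by apply/seteqP; split=> t /=; rewrite in_itv.
apply: (@measurable_exists_fin _ _ 'I_n) => j.
have [ij|ij] := boolP (i < j)%N; last first.
  by rewrite (_ : (fun t => _) = set0)//; apply/seteqP; split=> t.
rewrite (_ : (fun t => _) = [set t : n.-tuple RT | [set` `]-oo, 0]] (tnth t j - tnth t i)]).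
  exact: measurable_tnthB_preimage.
by apply/seteqP; split=> t /=; rewrite in_itv/= subr_le0.
Qed.

Lemma pr_degenerate : pr degenerate = 0.
Proof.
have := partial_massE measurable_degenerate.
rewrite /partial_mass integral0_eq => [[h]|t _].
  apply: (mulIf (_ : c^-1 != 0)); first by rewrite invr_eq0 gt_eqF.
  by rewrite mul0r -h.
congr EFin; rewrite indicE; case: (boolP (t \in degenerate)) => [|_]; last by rewrite mulr0.
rewrite inE => -[[i ti]|[i [j /andP[ij tji]]]].
  by rewrite /base_weight /weight (bigD1 (i, i))//= /factor/= ltnn eqxx /density1 ltNge ti/= !mul0r.
by rewrite /base_weight /weight (bigD1 (i, j))//= /factor/= ij /density2 subr_gt0 ltNge tji/= !mul0r.
Qed.

Lemma pr_cvg0 (A : (set (n.-tuple RT))^nat) : (forall k, measurable (A k)) ->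
  (forall k l, (k <= l)%N -> A l `<=` A k) -> \bigcap_k A k `<=` degenerate ->
  pr (A k) @[k --> \oo] --> 0.
Proof.
move=> mA ndA capA.
have mI : measurable (\bigcap_k (X @^-1` A k)).
  by apply: bigcap_measurableType => k _; exact: mX.
have I0 : P (\bigcap_k (X @^-1` A k)) = 0%E.
  apply/eqP; rewrite eq_le measure_ge0 andbT -[leRHS]/((0 : R)%:E).
  rewrite -pr_degenerate -prE; last exact: measurable_degenerate.
  apply: le_measure; rewrite ?inE//; first by apply: mX; exact: measurable_degenerate.
  by move=> w h; apply: capA => k _; exact: h.
have h : (P \o (fun k => X @^-1` A k)) k @[k --> \oo] --> P (\bigcap_k (X @^-1` A k)).
  apply: nonincreasing_cvg_mu => //.
  - by rewrite (le_lt_trans (probability_le1 P (mX (mA 0%N)))) ?ltry.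
  - by move=> k; exact: mX.
  - by move=> k l kl; apply/subsetPset => w; exact: ndA.
by move: h; rewrite I0 => /fine_cvgP[].
Qed.

Lemma pr_escaped_cvg0 : pr (escaped k%:R) @[k --> \oo] --> 0.
Proof.
apply: pr_cvg0.
- by move=> k; exact: measurable_escaped.
- move=> k l kl t [i h]; exists i; apply: le_lt_trans h.
  by rewrite ler_nat.
- move=> t h; exfalso.
  pose K : R := \sum_i `|tnth t i|.
  have [k hk] : exists k : nat, K <= k%:R.
    by exists (Num.bound K); rewrite ltW// archi_boundP// sumr_ge0.
  have [i ti] := h k I.
  have : tnth t i <= K.
    rewrite /K (bigD1 i)//=; apply: le_trans (ler_norm _) _.
    by rewrite lerDl sumr_ge0.
  by move/(lt_le_trans ti)/lt_le_trans => /(_ _ hk); rewrite ltxx.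
Qed.

Lemma pr_low_or_close_cvg0 : pr (low_or_close k.+1%:R^-1) @[k --> \oo] --> 0.
Proof.
apply: pr_cvg0.
- by move=> k; exact: measurable_low_or_close.
- move=> k l kl.
  have le_inv : l.+1%:R^-1 <= k.+1%:R^-1 :> R by rewrite lef_pV2 ?posrE// ler_nat.
  move=> t [[i h]|[i [j /andP[ij h]]]].
    by left; exists i; exact: lt_le_trans le_inv.
  by right; exists i, j; rewrite ij (lt_le_trans h le_inv).
- move=> t h; apply: contrapT => ndeg.
  have ti i : 0 < tnth t i.
    by rewrite ltNge; apply/negP => ti; apply: ndeg; left; exists i.
  have tij (i j : 'I_n) : (i < j)%N -> 0 < tnth t j - tnth t i.
    move=> ij; rewrite subr_gt0 ltNge; apply/negP => tji; apply: ndeg; right.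
    by exists i, j; rewrite ij.
  pose gap (q : 'I_n * 'I_n) := if (q.1 < q.2)%N then (tnth t q.2 - tnth t q.1)^-1 else 0.
  have gap0 q : 0 <= gap q by rewrite /gap; case: ifP => // /tij/ltW h'; rewrite invr_ge0.
  (* K dominates the inverse of every coordinate and of every gap, so no coordinate or gap is below
     1 / (k + 1) once k >= K. *)
  pose K : R := \sum_i (tnth t i)^-1 + \sum_q gap q.
  have inv0 i : 0 <= (tnth t i)^-1 by rewrite invr_ge0 ltW.
  have S1 : 0 <= \sum_i (tnth t i)^-1 by exact: sumr_ge0.
  have S2 : 0 <= \sum_q gap q by exact: sumr_ge0.
  have [k hk] : exists k : nat, K <= k%:R.
    by exists (Num.bound K); rewrite ltW// archi_boundP// addr_ge0.
  have contra (y : R) : 0 < y -> y^-1 <= K -> ~ (y < k.+1%:R^-1).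
    move=> y0 yK yk; have : k.+1%:R < y^-1 by rewrite -[ltLHS]invrK ltf_pV2 ?posrE.
    by move/lt_le_trans/(_ yK)/lt_le_trans/(_ hk); rewrite ltr_nat ltnNge leqnSn.
  have [[i hi]|[i [j /andP[ij hij]]]] := h k I.
    apply: contra hi => //; rewrite /K (bigD1 i)//= -addrA lerDl addr_ge0//.
    exact: sumr_ge0.
  apply: contra hij; first exact: tij.
  rewrite /K (bigD1 (i, j) _ (F := gap))//= {1}/gap/= ij addrCA lerDl addr_ge0//.
  exact: sumr_ge0.
Qed.

Variable x : 'I_n -> R.
Hypothesis x_incr : forall i j : 'I_n, (i < j)%N -> x i < x j.
Hypothesis x_eq : forall i,
  beta * (\sum_(j | j != i) (x i - x j)^-1) + (a + 1) / x i - 2^-1 = 0.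
Hypothesis x_gt0 : forall i, 0 < x i.
Variables (k : nat) (U : R).
Hypothesis k1 : (1 <= k)%N.
Hypothesis U0 : 0 <= U.
Hypothesis Up : 2 * (5 * (k.*2.+1)%:R) <= U ^+ 2.

(* Removing the cutoffs: first [dl -> 0], then [r -> oo]. *)
Lemma pr_bad_le (bad : 'I_n -> set R) : (forall i, measurable (bad i)) ->
  (forall r dl : R, 0 < dl -> (forall i, dl <= x i) -> (forall i, x i + 1 <= r) -> 0 <= r ->
   ((gain_bad k U)%:E * partial_mass beta a (bad_tuple bad `&` separated dl r (n := n)) <=
   (n%:R * gain_min k)%:E * partial_mass beta a [set: n.-tuple RT] +
   (close_cost x (G_bound x k (Num.sqrt r)))%:E * partial_mass beta a (close_pair dl (n := n)))%E) ->
  gain_bad k U * pr (bad_tuple bad) <= n%:R * gain_min k.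
Proof.
move=> mbad mass.
have gb0 : 0 <= gain_bad k U by rewrite divr_ge0 ?exprn_ge0.
apply/ler_addgt0Pr => e e0.
pose e' := e / (2 * (gain_bad k U + 1)).
have e'0 : 0 < e' by rewrite divr_gt0//; lra.
pose K : R := \sum_i x i.
have xK i : x i <= K.
  by rewrite /K (bigD1 i)//= lerDl sumr_ge0// => j _; exact: ltW.
have K0 : 0 <= K by apply: sumr_ge0 => j _; exact: ltW.
have [r [rK r0 r_esc]] : exists r, [/\ K + 1 <= r, 0 <= r & pr (escaped (r - 1)) <= e'].
  have /cvgr0Pnorm_le/(_ _ e'0)[N _ hN] := pr_escaped_cvg0.
  exists ((maxn N (Num.bound K))%:R + 1); split.
  - rewrite lerD2r; apply: (@le_trans _ _ (Num.bound K)%:R).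
      by rewrite ltW// archi_boundP.
    by rewrite ler_nat leq_maxr.
  - by rewrite addr_ge0.
  - rewrite addrK; have := hN (maxn N (Num.bound K)) (leq_maxl _ _).
    by rewrite /= ger0_norm ?pr_ge0.
(* The cost depends on r but not on dl: r is fixed by now, and dl is chosen so small that [cost]
   times the mass of close pairs is negligible. Each cutoff spends e / 2. *)
pose cost := close_cost x (G_bound x k (Num.sqrt r)).
pose e2 := e / (2 * (gain_bad k U + `|cost| + 1)).
have den0 : 0 < gain_bad k U + `|cost| + 1 by have := normr_ge0 cost; lra.
have e20 : 0 < e2 by rewrite divr_gt0//; lra.
have [dl [dl0 dlx dl_low]] : exists dl, [/\ 0 < dl, forall i, dl <= x i & pr (low_or_close dl) <= e2].
  have /cvgr0Pnorm_le/(_ _ e20)[N _ hN] := pr_low_or_close_cvg0.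
  pose M : R := \sum_i (x i)^-1.
  have M0 : 0 <= M by apply: sumr_ge0 => j _; rewrite invr_ge0 ltW.
  exists (maxn N (Num.bound M)).+1%:R^-1; split.
  - by rewrite invr_gt0.
  - move=> i; rewrite -[leRHS]invrK lef_pV2 ?posrE ?invr_gt0//.
    apply: (@le_trans _ _ M).
      by rewrite /M (bigD1 i)//= lerDl sumr_ge0// => j _; rewrite invr_ge0 ltW.
    apply: (@le_trans _ _ (Num.bound M)%:R); first by rewrite ltW// archi_boundP.
    by rewrite ler_nat leqW// leq_maxr.
  - have := hN (maxn N (Num.bound M)) (leq_maxl _ _).
    by rewrite /= ger0_norm ?pr_ge0.
have xr i : x i + 1 <= r by have := xK i; lra.
have mB := measurable_bad_tuple mbad.
have mS := @measurable_separated R n dl r.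
have mC := @measurable_close_pair R n dl.
have mBS : measurable (bad_tuple bad `&` separated dl r (n := n)) by exact: measurableI.
have := mass r dl dl0 dlx xr r0.
rewrite !partial_massE// -!EFinM -EFinD lee_fin prT -/cost => h.
have {}h : gain_bad k U * pr (bad_tuple bad `&` separated dl r (n := n)) <=
    n%:R * gain_min k + cost * pr (close_pair dl (n := n)).
  rewrite -(ler_pM2r (_ : 0 < c^-1)) ?invr_gt0//.
  by rewrite mulrDl -[leLHS]mulrA -[cost * _ / c]mulrA -[c^-1 in X in X + _]div1r.
have split1 : pr (bad_tuple bad) <= pr (bad_tuple bad `&` separated dl r (n := n)) +
    (pr (escaped (r - 1)) + pr (low_or_close dl)).
  have mE := @measurable_escaped (r - 1); have mL := @measurable_low_or_close dl.
  apply: (@le_trans _ _ (pr ((bad_tuple bad `&` separated dl r (n := n)) `|`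
      (escaped (r - 1) `|` low_or_close dl)))).
    apply: le_pr => //; first by apply: measurableU => //; exact: measurableU.
    move=> t bt; have [|nesc] := pselect ((escaped (r - 1) `|` low_or_close dl) t); first by right.
    left; split => //; split=> [i|i j ij].
      apply/andP; split; rewrite leNgt; apply/negP => hi; apply: nesc.
        by right; left; exists i.
      by left; exists i.
    by rewrite leNgt; apply/negP => hi; apply: nesc; right; right; exists i, j; rewrite ij.
  apply: (le_trans (prU _ _)) => //; first exact: measurableU.
  by rewrite lerD2l; exact: prU.
have closele : pr (close_pair dl (n := n)) <= e2.
  apply: le_trans dl_low; apply: le_pr => //; first exact: measurable_low_or_close.
  by move=> t; right.
have c1 : cost * pr (close_pair dl (n := n)) <= `|cost| * e2.
  apply: (@le_trans _ _ (`|cost| * pr (close_pair dl (n := n)))).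
    by rewrite ler_wpM2r ?pr_ge0// ler_norm.
  by rewrite ler_wpM2l.
have E1 : gain_bad k U * e' <= e / 2.
  rewrite /e' mulrA ler_pdivrMr; last by lra.
  by nra.
have E2 : (gain_bad k U + `|cost|) * e2 <= e / 2.
  rewrite /e2 mulrA ler_pdivrMr; last by lra.
  have := normr_ge0 cost; set v := `|cost|; move=> v0.
  by nra.
have := ler_wpM2l gb0 split1; have := ler_wpM2l gb0 r_esc; have := ler_wpM2l gb0 dl_low.
by rewrite !mulrDr; rewrite mulrDl in E2; lra.
Qed.

Lemma pr_high : gain_bad k U * pr (bad_tuple (high_bad x U)) <= n%:R * gain_min k.
Proof.
apply: pr_bad_le; first by move=> i; exact: measurable_high_bad.
by move=> r dl *; apply: high_mass => //; exact: integrable_density.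
Qed.

Lemma pr_low : gain_bad k U * pr (bad_tuple (low_bad x k U)) <= n%:R * gain_min k.
Proof.
apply: pr_bad_le; first by move=> i; exact: measurable_low_bad.
by move=> r dl *; apply: low_mass => //; exact: integrable_density.
Qed.
End ensemble_tail.

(** * From square roots to points, and the choice of the moment *)

Section deviation_transfer.
Variable R : realType.

(** If |s - rho| < t then |l - x| = |s - rho| (s + rho) <= t (2 rho + t). Since rho^2 <= 32 alpha,
    the bound eps min(eps, 1) <= eps^2 controls rho t, and the bound by eps controls t^2; together
    they stay below 2 alpha eps. *)
Lemma deviation_transfer (p : nat) (x l alpha eps U : R) : (2 <= p)%N ->
  0 < l -> 0 < x -> x <= 32 * alpha -> 0 < eps -> 0 <= U ->
  U ^+ 2 = alpha * (eps * Num.min eps 1) / 64 -> 2 * alpha * eps < `|l - x| ->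
  U <= high_dev (Num.sqrt x) l \/ U <= low_dev p (Num.sqrt x) l.
Proof.
move=> p2 l0 x0 xa e0 U0 UE far.
have alpha0 : 0 < alpha by lra.
set m := eps * Num.min eps 1 in UE.
have m0 : 0 <= m by rewrite mulr_ge0 ?(ltW e0)// le_min (ltW e0) ler01.
have m1 : m <= eps by rewrite /m ler_piMr ?(ltW e0)// ge_min lexx orbT.
have m2 : m <= eps ^+ 2 by rewrite expr2 /m ler_wpM2l ?(ltW e0)// ge_min lexx.
set s := Num.sqrt l; set rho := Num.sqrt x.
have s0 : 0 < s by rewrite sqrtr_gt0.
have rho0 : 0 < rho by rewrite sqrtr_gt0.
have lE : l = s ^+ 2 by rewrite sqr_sqrtr// ltW.
have xE : x = rho ^+ 2 by rewrite sqr_sqrtr// ltW.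
(* The factor 8/7 pays for the floor of the lower deviation: it is at most rho / 8, so at least 7/8
   of rho - s survives. *)
pose t := 8 / 7 * U.
have t0 : 0 <= t by rewrite mulr_ge0// divr_ge0.
have t2 : t ^+ 2 = alpha * m / 49 by rewrite /t exprMn UE; field.
have dev : t <= `|s - rho|.
  rewrite leNgt; apply/negP => near.
  have rt : rho * t <= 9 / 10 * (alpha * eps).
    have ae : 0 <= alpha * eps by rewrite mulr_ge0 ?ltW.
    have h9 : 0 <= 9 / 10 * (alpha * eps) by lra.
    have rt0 : 0 <= rho * t by rewrite mulr_ge0// ltW.
    rewrite -(@ler_pXn2r _ 2)//.
    rewrite exprMn -xE t2.
    have h1 : x * (alpha * m / 49) <= 32 * alpha * (alpha * eps ^+ 2 / 49).
      apply: ler_pM => //; first exact: ltW.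
        by rewrite divr_ge0// mulr_ge0// ltW.
      by rewrite ler_wpM2r// ler_wpM2l ?(ltW alpha0).
    apply: (le_trans h1); rewrite !exprMn.
    have : 0 <= alpha ^+ 2 * eps ^+ 2 by rewrite mulr_ge0 ?sqr_ge0.
    by lra.
  have t2' : t ^+ 2 <= alpha * eps / 49.
    by rewrite t2 ler_wpM2r// ler_wpM2l ?(ltW alpha0).
  suff : `|l - x| <= 2 * alpha * eps by rewrite leNgt far.
  have -> : l - x = (s - rho) * (s + rho) by rewrite lE xE; ring.
  rewrite normrM [`|s + rho|]ger0_norm; last by apply: addr_ge0; exact: ltW.
  have sr : s + rho <= 2 * rho + t by move: near; rewrite ltr_norml => /andP[]; lra.
  apply: (@le_trans _ _ (t * (2 * rho + t))).
    by apply: ler_pM => //; [apply: addr_ge0; exact: ltW|exact: ltW].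
  have : 0 < alpha * eps by rewrite mulr_gt0.
  by move: rt t2'; rewrite expr2; lra.
have tU : t = 8 / 7 * U by [].
have [rs|sr] := leP rho s.
  left; rewrite high_devE -/s -/rho pospart_id ?subr_ge0//.
  by move: dev; rewrite ger0_norm ?subr_ge0//; lra.
right; move: dev; rewrite ltr0_norm ?subr_lt0// opprB => dev.
have pR : 2 <= p%:R :> R by rewrite (ler_nat _ 2).
have cE : rho / (4 * p%:R) <= rho / 8.
  by rewrite ler_wpM2l ?(ltW rho0)// lef_pV2 ?posrE; lra.
rewrite /low_dev /lowdev /floor_at -/s -/rho /pospart le_max; apply/orP; left.
by rewrite /Num.max; case: ifPn => _; lra.
Qed.
End deviation_transfer.

(* The moment order [k] is the largest one with [15 e k <= T2], where [T2] is
   the squared threshold for the square roots of the points. *)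
Lemma moment_choice {R : realType} (T2 : R) : 15 * expR 1 <= T2 ->
  exists (k : nat) (U : R), [/\ (0 < k)%N, 0 < U, U ^+ 2 = T2,
    2 * (5 * (k.*2.+1)%:R) <= U ^+ 2 /\ 0 < gain_bad k U &
    forall m : nat, m%:R * gain_min k / gain_bad k U <=
      2 * m%:R * expR (- (T2 / (15 * expR 1)))].
Proof.
move=> T2big.
have e2 : 2 <= expR 1 :> R by have := expR_ge1Dx (1 : R).
have e0 : 0 < expR 1 :> R by exact: expR_gt0.
set y := T2 / (15 * expR 1).
have y1 : 1 <= y by rewrite ler_pdivlMr ?mulr_gt0// mul1r.
have /andP[ky yk] := truncn_itv (le_trans ler01 y1).
set k := Num.trunc y in ky yk.
have k1 : (1 <= k)%N.
  by rewrite -ltnS -(ltr_nat R); exact: le_lt_trans y1 yk.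
have kT : 15 * k%:R * expR 1 <= T2.
  by move: ky; rewrite ler_pdivlMr ?mulr_gt0//; lra.
have T20 : 0 < T2 by apply: lt_le_trans T2big; rewrite mulr_gt0.
pose U := Num.sqrt T2.
have U2 : U ^+ 2 = T2 by rewrite sqr_sqrtr// ltW.
have U0 : 0 < U by rewrite sqrtr_gt0.
pose p := k.*2.+1.
have p3 : p%:R <= 3 * k%:R :> R.
  have : 1 <= k%:R :> R by rewrite ler1n.
  by rewrite /p -natr1 -mul2n natrM; lra.
have kR : 0 <= k%:R :> R by [].
have Up : 2 * (5 * p%:R) <= U ^+ 2.
  by rewrite U2; nra.
have pe : 5 * p%:R * expR 1 <= T2.
  by apply: le_trans kT; rewrite ler_wpM2r ?(ltW e0)//; lra.
have gb0 : 0 < gain_bad k U by rewrite divr_gt0// exprn_gt0.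
exists k, U; split => // m.
rewrite /gain_min /gain_bad -/p.
have -> : U ^+ k.*2.+2 = T2 ^+ k.+1 by rewrite -U2 -exprM mul2n.
have T2k : 0 < T2 ^+ k.+1 by rewrite exprn_gt0.
rewrite ler_pdivrMr ?divr_gt0// (_ : 2 * m%:R * expR (- y) * (T2 ^+ k.+1 / 2) =
  m%:R * (expR (- y) * T2 ^+ k.+1)); last by field.
rewrite ler_wpM2l// expRN [leRHS]mulrC ler_pdivlMr ?expR_gt0//.
(* Since y < k + 1, one has e^y <= e^(k+1), and each of the k + 1 factors 5 p e is at most T2, by p
   <= 3k and 15 e k <= T2. *)
apply: (@le_trans _ _ ((5 * p%:R) ^+ k.+1 * expR (k.+1%:R * 1))).
  by rewrite ler_wpM2l ?exprn_ge0 ?mulr_ge0// ler_expR mulr1 ltW.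
rewrite expRM_natl -exprMn; apply: lerXn2r; rewrite ?nnegrE ?(ltW T20)//.
Qed.

(** * The deviation inequality for the ensemble *)

Section ensemble_deviation.
Context {R : realType}.
Local Notation RT := (measurableTypeR R).
Variables (n : nat) (beta alpha : R).
Hypotheses (n1 : (1 <= n)%N) (beta0 : 0 < beta).
Hypothesis alphan : (n%:R - 1) * beta / 2 < alpha.
Variables (d : measure_display) (T : measurableType d) (P : probability T R).
Variable lam : 'I_n -> {RV P >-> R}.
Hypothesis lam_ensemble : laguerre_ensemble beta alpha lam.
Variable x : 'I_n -> R.
Hypothesis x_incr : forall i j : 'I_n, (i < j)%N -> x i < x j.
Hypothesis x_root : forall i,
  root (laguerre_poly n (2 * alpha / beta - n%:R) \Po (beta^-1 *: 'X)) (x i).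
Variable eps : R.
Hypothesis eps0 : 0 < eps.

Let alpha0 : 0 < alpha.
Proof.
apply: le_lt_trans alphan; rewrite divr_ge0// mulr_ge0 ?(ltW beta0)//.
by rewrite subr_ge0 ler1n.
Qed.

Let x_inj : injective x.
Proof.
move=> i j xij; apply: val_inj; case: (ltngtP (val i) (val j)) => // ij.
  by have := x_incr ij; rewrite xij ltxx.
by have := x_incr ij; rewrite xij ltxx.
Qed.

Let x_gt0 i : 0 < x i. Proof. exact: node_gt0 x_root i. Qed.
Let x_le i : x i <= 32 * alpha. Proof. exact: node_le x_root i. Qed.

Let x_eq i : beta * (\sum_(j | j != i) (x i - x j)^-1) +
  (alpha - (n%:R - 1) * beta / 2 - 1 + 1) / x i - 2^-1 = 0.
Proof. by rewrite subrK; exact: node_stieltjes. Qed.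

Let far : set T := [set w | exists i, 2 * alpha * eps < `|lam i w - x i|].

Lemma measurable_far : measurable far.
Proof.
apply: measurable_exists_fin => i.
have mf : measurable_fun setT (fun w => `|lam i w - x i|).
  apply: measurableT_comp => //; apply: measurable_funB => //.
have := mf measurableT [set` `]2 * alpha * eps, +oo[] (measurable_itv _).
rewrite setTI; congr (measurable _).
by apply/seteqP; split=> w /=; rewrite in_itv/= andbT.
Qed.

Lemma max_deviation_far :
  [set w | eps < 1 / (2 * alpha) * \big[Num.max/0]_(i < n) `|lam i w - x i|] = far.
Proof.
have a20 : 0 < 2 * alpha by rewrite mulr_gt0.
apply/seteqP; split=> w /=.
  move=> h; apply: contrapT => nfar; move: h; apply/negP; rewrite -leNgt.
  rewrite div1r mulrC ler_pdivrMr// mulrC.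
  apply: bigmax_le => [|i _]; first by rewrite mulr_ge0 ?ltW.
  by rewrite leNgt; apply/negP => h; apply: nfar; exists i.
move=> [i h]; rewrite div1r mulrC ltr_pdivlMr// mulrC.
by apply: lt_le_trans h _; exact: le_bigmax.
Qed.

(** A far point is nonpositive, a null event, or belongs to one of the two tails; each tail
    contributes a factor 2. *)
Lemma far_tail (T2 : R) : T2 = alpha * (eps * Num.min eps 1) / 64 ->
  15 * expR 1 <= T2 -> fine (P far) <= 4 * n%:R * expR (- (T2 / (15 * expR 1))).
Proof.
move=> T2E /moment_choice[k [U [k1 U0 U2 [Up gb0] ratio]]].
case: lam_ensemble => c c0 lamP.
have hi := pr_high beta0 alphan c0 lamP x_incr x_eq x_gt0 k1 (ltW U0) Up.
have lo := pr_low beta0 alphan c0 lamP x_incr x_eq x_gt0 k1 (ltW U0) Up.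
have dg := pr_degenerate beta0 c0 lamP.
set Hi := bad_tuple _ in hi; set Lo := bad_tuple _ in lo.
have mHi : measurable Hi by apply: measurable_bad_tuple => i; exact: measurable_high_bad.
have mLo : measurable Lo by apply: measurable_bad_tuple => i; exact: measurable_low_bad.
have mdg := @measurable_degenerate R n.
pose X (w : T) : n.-tuple RT := [tuple lam i w | i < n].
have farX : far `<=` X @^-1` (Hi `|` (Lo `|` degenerate (n := n))).
  move=> w [i farw]; have [l0|l0] := leP (lam i w) 0.
    by right; right; left; exists i; rewrite tnth_mktuple.
  have p2 : (2 <= k.*2.+1)%N by rewrite ltnS double_gt0.
  have := deviation_transfer p2 l0 (x_gt0 i) (x_le i) eps0 (ltW U0) (etrans U2 T2E) farw.
  case=> h; [left|right; left]; exists i; rewrite tnth_mktuple; exact: h.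
have mXc A : measurable A -> measurable (X @^-1` A).
  by move=> mA; rewrite -[Y in measurable Y]setTI; exact: measurable_sample.
have mc : measurable (Hi `|` (Lo `|` degenerate (n := n))).
  by apply: measurableU => //; exact: measurableU.
apply: (@le_trans _ _ (pr lam (Hi `|` (Lo `|` degenerate (n := n))))).
  apply: fine_le; [exact: fin_num_measure measurable_far|exact: fin_num_measure (mXc _ mc)|].
  by apply: le_measure; rewrite ?inE//; [exact: measurable_far|exact: mXc].
apply: (le_trans (prU lam mHi (measurableU _ _ mLo mdg))).
have := prU lam mLo mdg; rewrite dg addr0 => h2.
have bound A : gain_bad k U * pr lam A <= n%:R * gain_min k ->
    pr lam A <= 2 * n%:R * expR (- (T2 / (15 * expR 1))).
  move=> h; apply: le_trans (ratio n).
  by rewrite ler_pdivlMr// mulrC.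
apply: (le_trans (lerD (bound _ hi) (le_trans h2 (bound _ lo)))).
by rewrite -mulrDl -mulrDl -natrD.
Qed.

(** Here 960 e = 64 * 15 e. When T2 is below 15 e no moment is available, but then the factor e in
    the constant makes the right-hand side at least 1. *)
Lemma max_deviation_tail :
  (P [set w | (eps < 1 / (2 * alpha) * \big[Num.max/0]_(i < n) `|lam i w - x i|)%R] <=
   (4 * expR 1 * n%:R * expR (- ((960 * expR 1)^-1 * alpha * eps * Num.min eps 1)))%:E)%E.
Proof.
have e0 : 0 < expR 1 :> R by exact: expR_gt0.
have e1 : 1 <= expR 1 :> R by have := expR_ge1Dx (1 : R); lra.
rewrite max_deviation_far.
have -> : (960 * expR 1)^-1 * alpha * eps * Num.min eps 1 =
    alpha * (eps * Num.min eps 1) / 64 / (15 * expR 1).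
  by field; rewrite gt_eqF.
set T2 := alpha * (eps * Num.min eps 1) / 64.
have fP : P far \is a fin_num by exact: fin_num_measure measurable_far.
have n0 : 0 <= n%:R :> R by [].
have q0 : 0 <= expR (- (T2 / (15 * expR 1))) by exact: expR_ge0.
have [big|small] := leP (15 * expR 1) T2.
  rewrite -(fineK fP) lee_fin; apply: (le_trans (far_tail erefl big)).
  by rewrite ler_wpM2r// ler_wpM2r// ler_peMr.
apply: (le_trans (probability_le1 P measurable_far)); rewrite lee_fin.
have nR : 1 <= n%:R :> R by rewrite ler1n.
have qe : 1 <= expR 1 * expR (- (T2 / (15 * expR 1))).
  by rewrite -expRD -[leLHS]expR0 ler_expR subr_ge0 ler_pdivrMr ?mulr_gt0// mul1r ltW.
rewrite (_ : 4 * _ * _ * _ = 4 * (n%:R * (expR 1 * expR (- (T2 / (15 * expR 1)))))).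
  by apply: mulr_ege1; [rewrite ler1n|exact: mulr_ege1].
by rewrite -!mulrA; congr (_ * _); rewrite mulrCA.
Qed.
End ensemble_deviation.

Theorem theorem3 (R : realType) :
  exists C1 C2 : R, 0 < C1 /\ 0 < C2 /\
  forall (n : nat) (beta alpha : R),
    (1 <= n)%N -> 0 < beta -> (n%:R - 1) * beta / 2 < alpha ->
  forall (d : measure_display) (T : measurableType d) (P : probability T R)
    (lam : 'I_n -> {RV P >-> R}),
    laguerre_ensemble beta alpha lam ->
  forall x : 'I_n -> R,
    (forall i j : 'I_n, (i < j)%N -> x i < x j) ->
    (forall y : R,
       root (laguerre_poly n (2 * alpha / beta - n%:R) \Po (beta^-1 *: 'X)) y
       <-> exists i, y = x i) ->
  forall eps : R, 0 < eps ->
    (P [set w | (eps < 1 / (2 * alpha) *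
                   \big[Num.max/0]_(i < n) `|lam i w - x i|)%R]
     <= (C1 * n%:R * expR (- (C2 * alpha * eps * Num.min eps 1)))%:E)%E.
Proof.
exists (4 * expR 1), (960 * expR 1)^-1.
split; first by rewrite mulr_gt0 ?expR_gt0 ?ltr0n.
split; first by rewrite invr_gt0 mulr_gt0 ?expR_gt0 ?ltr0n.
move=> n beta alpha n1 beta0 alphan d T P lam lamP x x_incr x_root eps eps0.
have x_rooti i :
    root (laguerre_poly n (2 * alpha / beta - n%:R) \Po (beta^-1 *: 'X)) (x i).
  by apply/x_root; exists i.
exact: (max_deviation_tail n1 beta0 alphan lamP x_incr x_rooti eps0).
Qed.
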